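(* Let $A$, $A'$, $A''$ be homotopy Gerstenhaber algebras (hgas) over a commutative ring $\Bbbk$, with hga morphisms $A\to A'$ and $A\to A''$. Then the family $(m_n)_{n\ge2}$ of maps $m_n\colon\mathbf{B}(A',A,A'')^{\otimes n}\to\mathbf{B}(A',A,A'')$ defined in the context is an augmented $A_\infty$-structure on the two-sided bar construction $\mathbf{B}(A',A,A'')$, with unit $1_{A'}\otimes\mathbf 1_{\mathbf{B}A}\otimes1_{A''}$ and augmentation $\epsilon(a'\otimes\mathbf a\otimes a'')=\epsilon(a')\,\epsilon(\mathbf a)\,\epsilon(a'')$.
   Context: **General conventions.** $\otimes=\otimes_{\Bbbk}$; complexes are cochain complexes; maps on tensor products are evaluated with the Koszul sign rule; $d(f)=d\,f-(-1)^{|f|}f\,d$. **Bar constructions.** Let $A$ be an augmented dga with augmentation $\epsilon$, $\bar A=\ker\epsilon$, $\bar a=a-\epsilon(a)1$. $\mathbf{B}A=\bigoplus_{k\ge0}(s^{-1}\bar A)^{\otimes k}$, with elements $\mathbf a=[a_1|\dots|a_k]$ of length $k$ and degree $\sum_i(|a_i|-1)$, is a coaugmented dgc: the diagonal is deconcatenation, $\Delta\mathbf a=\sum\mathbf a^{(1)}\otimes\mathbf a^{(2)}$; $\mathbf 1=[\,]$; $\epsilon(\mathbf a)=0$ for length $\ge1$, $\epsilon(\mathbf 1)=1$; the differential is the tensor product differential (with $d[a]=-[da]$) plus $\sum_{i=1}^{k-1}(-1)^{\epsilon_i}[a_1|\dots|a_ia_{i+1}|\dots|a_k]$, $\epsilon_i=|a_1|+\dots+|a_i|-i$.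 Canonical twisting cochain $t\colon\mathbf{B}A\to A$: $[a]\mapsto a$, zero on length $\ne1$. Given morphisms of augmented dgas $A\to A'$, $A\to A''$ (suppressed from the notation), $\mathbf{B}(A',A,A'')=A'\otimes\mathbf{B}A\otimes A''$, with elements $\overleftrightarrow{a}=a'\otimes\mathbf a\otimes a''=a'[a_1|\dots|a_k]a''$ and differential $d\overleftrightarrow{a}=d_\otimes\overleftrightarrow{a}+(-1)^{|a'|}a'a_1[a_2|\dots|a_k]a''-(-1)^{|a'|+\epsilon_{k-1}}a'[a_1|\dots|a_{k-1}]a_ka''$ (last two terms only if $k\ge1$). Write $\overleftarrow{a}=a'\otimes\mathbf a\in\mathbf{B}(A',A,\Bbbk)$, $\overrightarrow{a}=\mathbf a\otimes a''\in\mathbf{B}(\Bbbk,A,A'')$, and $\sum\overleftarrow{a}^{(1)}\otimes\overrightarrow{a}^{(2)}=\sum_{i}a'[a_1|\dots|a_i]\otimes[a_{i+1}|\dots|a_k]a''$. **Hgas.** An hga is an augmented dga $A$ with an associative product $\mu(\mathbf a,\mathbf b)=\mathbf a\cdot\mathbf b$ on $\mathbf{B}A$ with unit $\mathbf 1$, turning $\mathbf{B}A$ (with the diagonal above) into a dg bialgebra, such that the twisting cochain $\mathbf E=t\,\mu\colon\mathbf{B}A\otimes\mathbf{B}A\to\bar A$ (of degree $1$) satisfies $\mathbf E(\mathbf a,\mathbf b)=0$ if $\mathbf a$ has length $\ge2$. ($\mu$ is determined by $\mathbf E$, and $\mathbf E(\mathbf a,\mathbf 1)=\mathbf E(\mathbf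 1,\mathbf a)=t(\mathbf a)$.) Morphisms of hgas are morphisms of augmented dgas compatible with $\mathbf E$. $\Bbbk$ is an hga with $\mathbf E([a],\mathbf b)=0$ whenever $\mathbf b$ has length $\ge1$; augmentations are hga morphisms. **Product on the right bar construction.** For an hga morphism $A\to A''$, $\mathbf{B}(\Bbbk,A,A'')$ is an (associative) augmented dga with product $\overrightarrow{a}\cdot\overrightarrow{b}=\sum(-1)^{|a''||\mathbf b^{(1)}|}\,\mathbf a\cdot\mathbf b^{(1)}\otimes\mathbf E([\bar a''],\mathbf b^{(2)})\,b''+\mathbf a\cdot\mathbf b\otimes\epsilon(a'')b''$ (Kadeishvili--Saneblidze). **Maps $S$, $h$, $h_n$** (case $A=A'$): $S\colon\mathbf{B}(A,A,A'')\to\mathbf{B}(\Bbbk,A,A'')$, $a[a_1|\dots|a_k]a''\mapsto[\bar a|a_1|\dots|a_k]a''$ (degree $-1$); $h(\overleftrightarrow{a},\overleftrightarrow{b})=(-1)^{|\overleftrightarrow{a}|}\,a'\otimes\overrightarrow{a}\cdot S(\overleftrightarrow{b})\in\mathbf{B}(A,A,A'')$ (degree $-1$); $h_1=1$, $h_2=h$, $h_n=h_{n-1}(1^{\otimes(n-2)}\otimes h)\colon\mathbf{B}(A,A,A'')^{\otimes n}\to\mathbf{B}(A,A,A'')$ (degree $1-n$). **Maps $m_n$** on $\mathbf{B}(A',A,A'')$, of degree $2-n$. For $n\ge2$ set $$\tilde m_n(\overleftrightarrow{a}_1,\dots,\overleftrightarrow{a}_n)=\sum(-1)^{\kappa}\,a_1'\,\mathbf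 E\bigl(\mathbf a_1^{(1)},S\,h_{n-1}(\overleftarrow{a}_2^{(1)},\dots,\overleftarrow{a}_n^{(1)})\bigr)\otimes\overrightarrow{a}_1^{(2)}\cdots\overrightarrow{a}_n^{(2)},$$ $\kappa=\sum_{1\le i<j\le n}|\overrightarrow{a}_i^{(2)}||\overleftarrow{a}_j^{(1)}|+n|a_1'|+(n-1)|\mathbf a_1^{(1)}|$ (the Koszul sign). Here $\mathbf a_1^{(1)}$ is considered as an element of $\mathbf{B}A'$, the $\overleftarrow{a}_j^{(1)}$ as elements of $\mathbf{B}(A',A',\Bbbk)$, so that $S\,h_{n-1}(\dots)\in\mathbf{B}A'$, and $\mathbf E$ is that of $A'$. Then $m_2(\overleftrightarrow{a}_1,\overleftrightarrow{a}_2)=\tilde m_2(\overleftrightarrow{a}_1,\overleftrightarrow{a}_2)+a_1'\,\epsilon(a_2')\otimes\overrightarrow{a}_1\cdot\overrightarrow{a}_2$, and $m_n=\tilde m_n$ for $n\ge3$. **$A_\infty$.** An $A_\infty$-structure on a cochain complex $A$ is a family $m_n\colon A^{\otimes n}\to A$, $n\ge2$, of degree $2-n$ with $d(m_n)=-\sum_{l=2}^{n-1}\sum_{i=0}^{n-l}(-1)^{i+l(n-i-l)}m_{n-l+1}(1^{\otimes i}\otimes m_l\otimes1^{\otimes(n-i-l)})$ for all $n\ge2$. It is strictly unital with unit a cocycle $1\in A$ if $m_2(a,1)=m_2(1,a)=a$ for all $a$ and $m_n$, $n\ge3$, vanishes if some argument equals $1$. An augmentation is a chain map $\epsilon\colon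 A\to\Bbbk$ with $\epsilon(1)=1$, $\epsilon(m_2(a,b))=\epsilon(a)\epsilon(b)$ and $\epsilon\,m_n=0$ for $n\ge3$; $A$ is then called augmented (and is strictly unital). *)

(* Defs.v *)
From HB Require Import structures.
From mathcomp Require Import all_boot all_order all_algebra.
From mathcomp Require Import boolp.
Set Implicit Arguments.
Unset Strict Implicit.
Unset Printing Implicit Defensive.
Import Order.TTheory GRing.Theory Num.Theory.
Local Open Scope ring_scope.
Local Open Scope quotient_scope.

(* The k-module with generators X and relations x = \sum_i c_i y_i, one for   *)
(* each pair with R x [:: (c_1, y_1); ...; (c_n, y_n)].                        *)
Section Presentation.
Variables (k : comNzRingType) (X : Type) (R : X -> seq (k * X) -> Prop).

Definition fsum : Type := seq (k * X).

HB.instance Definition _ := gen_eqMixin fsum.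
HB.instance Definition _ := gen_choiceMixin fsum.

Definition fscale (c : k) (s : fsum) : fsum := [seq (c * p.1, p.2) | p <- s].

Inductive feq : fsum -> fsum -> Prop :=
| feq_refl s : feq s s
| feq_sym s t : feq s t -> feq t s
| feq_trans s t u : feq s t -> feq t u -> feq s u
| feq_cat s s' t t' : feq s s' -> feq t t' -> feq (s ++ t) (s' ++ t')
| feq_catC s t : feq (s ++ t) (t ++ s)
| feq_zero x : feq [:: (0, x)] [::]
| feq_add a b x : feq [:: (a + b, x)] [:: (a, x); (b, x)]
| feq_rel c x s : R x s -> feq [:: (c, x)] (fscale c s).

Lemma feq_scale c s t : feq s t -> feq (fscale c s) (fscale c t).
Proof.
elim=> {s t} [s|s t _ IH|s t u _ IH1 _ IH2|s s' t t' _ IH1 _ IH2|s t|x|a b x|a x s Rxs].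
- exact: feq_refl.
- exact: feq_sym.
- exact: feq_trans IH1 IH2.
- by rewrite /fscale !map_cat; apply: feq_cat.
- by rewrite /fscale !map_cat; apply: feq_catC.
- by rewrite /= mulr0; apply: feq_zero.
- by rewrite /= mulrDr; apply: feq_add.
- have -> : fscale c (fscale a s) = fscale (c * a) s.
    by rewrite /fscale -map_comp; apply: eq_map => p /=; rewrite mulrA.
  exact: feq_rel.
Qed.

Lemma feq_scaleD a b s : feq (fscale (a + b) s) (fscale a s ++ fscale b s).
Proof.
elim: s => [|[c x] s IH]; first exact: feq_refl.
rewrite /= -/(fscale _ _) mulrDl.
apply: feq_trans (feq_cat (feq_add (a * c) (b * c) x) IH) _.
apply: (@feq_cat [:: (a * c, x)] [:: (a * c, x)]); first exact: feq_refl.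
have -> : fscale a s ++ (b * c, x) :: fscale b s
    = (fscale a s ++ [:: (b * c, x)]) ++ fscale b s by rewrite -catA.
apply: (@feq_cat ((b * c, x) :: fscale a s)); last exact: feq_refl.
exact: (feq_catC [:: (b * c, x)]).
Qed.

Lemma feq_scale0 s : feq (fscale 0 s) [::].
Proof.
elim: s => [|[c x] s IH]; first exact: feq_refl.
rewrite /= mul0r; exact: (feq_cat (feq_zero x) IH).
Qed.

Definition feqb (s t : fsum) : bool := `[<feq s t>].

Lemma feqb_refl : reflexive feqb.
Proof. by move=> s; apply/asboolP/feq_refl. Qed.

Lemma feqb_sym : symmetric feqb.
Proof. by move=> s t; apply/asboolP/asboolP; apply: feq_sym. Qed.

Lemma feqb_trans : transitive feqb.
Proof. by move=> t s u /asboolP st /asboolP tu; apply/asboolP; exact: feq_trans st tu. Qed.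

Canonical feqb_equiv := EquivRel feqb feqb_refl feqb_sym feqb_trans.

Definition pmod : Type := {eq_quot feqb_equiv}.
HB.instance Definition _ := Choice.on pmod.

Definition pcls (s : fsum) : pmod := \pi_({eq_quot feqb_equiv}) s.
Definition prep (x : pmod) : fsum := repr (x : {eq_quot feqb_equiv}).

Lemma prepK x : pcls (prep x) = x.
Proof. exact: reprK. Qed.

Lemma pclsP s t : pcls s = pcls t <-> feq s t.
Proof.
rewrite /pcls; split=> [/(@eqmodP _ feqb_equiv)/asboolP //|st].
by apply/(@eqmodP _ feqb_equiv)/asboolP.
Qed.

Lemma prep_cls s : feq (prep (pcls s)) s.
Proof. by apply/pclsP; rewrite prepK. Qed.

Definition padd (x y : pmod) : pmod := pcls (prep x ++ prep y).
Definition pscale (c : k) (x : pmod) : pmod := pcls (fscale c (prep x)).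
Definition popp (x : pmod) : pmod := pscale (-1) x.
Definition pzero : pmod := pcls [::].

Lemma paddE s t : padd (pcls s) (pcls t) = pcls (s ++ t).
Proof. by apply/pclsP/feq_cat; apply: prep_cls. Qed.

Lemma pscaleE c s : pscale c (pcls s) = pcls (fscale c s).
Proof. by apply/pclsP/feq_scale/prep_cls. Qed.

Lemma paddA : associative padd.
Proof. by move=> x y z; rewrite -[x]prepK -[y]prepK -[z]prepK !paddE catA. Qed.

Lemma paddC : commutative padd.
Proof.
by move=> x y; rewrite -[x]prepK -[y]prepK !paddE; apply/pclsP/feq_catC.
Qed.

Lemma padd0 : left_id pzero padd.
Proof. by move=> x; rewrite -[x]prepK paddE. Qed.

Lemma fscale1 s : fscale 1 s = s.
Proof. by rewrite -[RHS]map_id; apply: eq_map => -[c x] /=; rewrite mul1r. Qed.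

Lemma paddN : left_inverse pzero popp padd.
Proof.
move=> x; rewrite -[x]prepK /popp pscaleE paddE -{2}[prep x]fscale1.
apply/pclsP/(feq_trans (feq_sym (feq_scaleD _ _ _))).
by rewrite addNr; apply: feq_scale0.
Qed.

HB.instance Definition _ := GRing.isZmodule.Build pmod paddA paddC padd0 paddN.

Lemma pscaleA a b x : pscale a (pscale b x) = pscale (a * b) x.
Proof.
rewrite -[x]prepK !pscaleE /fscale -map_comp; congr pcls.
by apply: eq_map => p /=; rewrite mulrA.
Qed.

Lemma pscale1 : left_id 1 pscale.
Proof. by move=> x; rewrite -[x]prepK pscaleE fscale1. Qed.

Lemma pclsD s t : pcls s + pcls t = pcls (s ++ t).
Proof. exact: paddE. Qed.

Lemma pscaleDr : right_distributive pscale +%R.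
Proof.
move=> c x y; rewrite -[x]prepK -[y]prepK pclsD !pscaleE pclsD.
by rewrite /fscale map_cat.
Qed.

Lemma pscaleDl x : {morph pscale^~ x : a b / a + b}.
Proof.
move=> a b /=; rewrite -[x]prepK !pscaleE pclsD.
exact/pclsP/feq_scaleD.
Qed.

HB.instance Definition _ :=
  GRing.Zmodule_isLmodule.Build k pmod pscaleA pscale1 pscaleDr pscaleDl.

Definition pgen (x : X) : pmod := pcls [:: (1, x)].

Definition feval (M : lmodType k) (f : X -> M) (s : fsum) : M :=
  \sum_(p <- s) p.1 *: f p.2.

(* The linear extension of f.  It is computed on a representative, hence is    *)
(* meaningful exactly when f respects the relations; see plift_linear and      *)
(* plift_gen.                                                                  *)
Definition plift (M : lmodType k) (f : X -> M) (x : pmod) : M :=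
  feval f (prep x).

Definition respects (M : lmodType k) (f : X -> M) : Prop :=
  forall x s, R x s -> f x = feval f s.

Lemma feval_cat (M : lmodType k) (f : X -> M) s t :
  feval f (s ++ t) = feval f s + feval f t.
Proof. exact: big_cat. Qed.

Lemma feval_scale (M : lmodType k) (f : X -> M) c s :
  feval f (fscale c s) = c *: feval f s.
Proof.
by rewrite /feval big_map scaler_sumr; apply: eq_bigr => p _; rewrite scalerA.
Qed.

Lemma feval_feq (M : lmodType k) (f : X -> M) :
  respects f -> forall s t, feq s t -> feval f s = feval f t.
Proof.
move=> fR s t.
elim=> {s t} // [s t u _ -> _ -> //|s s' t t' _ IH1 _ IH2|s t|x|a b x|a x s Rxs].
- by rewrite !feval_cat IH1 IH2.
- by rewrite !feval_cat addrC.
- by rewrite /feval big_seq1 big_nil scale0r.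
- by rewrite /feval !big_cons big_nil !addr0 scalerDl.
- by rewrite feval_scale -(fR _ _ Rxs) /feval big_cons big_nil addr0.
Qed.

Lemma plift_linear (M : lmodType k) (f : X -> M) :
  respects f -> linear (plift f).
Proof.
move=> fR c x y; rewrite /plift -feval_scale -feval_cat.
apply: feval_feq => //.
rewrite [c *: x]/(pscale c x) [_ + y]/(padd _ y) /padd.
apply: feq_trans (prep_cls _) _; apply: feq_cat (prep_cls _) (feq_refl _).
Qed.

Lemma plift_gen (M : lmodType k) (f : X -> M) :
  respects f -> forall x, plift f (pgen x) = f x.
Proof.
move=> fR x; rewrite /plift (feval_feq fR (prep_cls _)) /feval big_seq1.
by rewrite scale1r.
Qed.

End Presentation.

Section Tensor.
Variables (k : comNzRingType) (V W : lmodType k).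

Inductive tens_rel : V * W -> seq (k * (V * W)) -> Prop :=
| tens_rell c v1 v2 w :
    tens_rel (c *: v1 + v2, w) [:: (c, (v1, w)); (1, (v2, w))]
| tens_relr c v w1 w2 :
    tens_rel (v, c *: w1 + w2) [:: (c, (v, w1)); (1, (v, w2))].

Definition tens : lmodType k := pmod tens_rel.

Definition tpure (v : V) (w : W) : tens := pgen tens_rel (v, w).

Definition tlift (M : lmodType k) (f : V -> W -> M) : tens -> M :=
  plift (fun p => f p.1 p.2).

End Tensor.

Definition sg (k : comNzRingType) (p : int) : k := (-1) ^+ `|p|%N.
Arguments sg {k} p.

(* A Z-grading V = \bigoplus_p V_p is given by the projections pr p : V -> V   *)
(* onto the summands V_p = {v | pr p v = v}.                                   *)
Section Graded.
Variables (k : comNzRingType) (V : lmodType k) (pr : int -> V -> V).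

Definition homog (p : int) (v : V) : Prop := pr p v = v.

Record is_grading : Prop := IsGrading {
  gr_linear : forall p, linear (pr p);
  gr_proj : forall p q v, pr p (pr q v) = if p == q then pr q v else 0;
  gr_sum : forall v, exists2 s : seq int, uniq s & v = \sum_(p <- s) pr p v }.

Record is_complex (d : V -> V) : Prop := IsComplex {
  cx_grading : is_grading;
  cx_linear : linear d;
  cx_degree : forall p v, homog p v -> homog (p + 1) (d v);
  cx_square : forall v, d (d v) = 0 }.

Record helt := Helt { hdeg : int; hval :> V; hvalP : homog hdeg hval }.

End Graded.

(* Augmented dgas: ca is the total space, a k-algebra.                         *)
Record adga (k : comNzRingType) := ADGA {
  ca :> algType k;
  apr : int -> ca -> ca;
  adiff : ca -> ca;
  aug : {lrmorphism ca -> k | *%R};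
  adga_complex : is_complex apr adiff;
  adga_one : homog apr 0 1;
  adga_mul : forall p q a b,
    homog apr p a -> homog apr q b -> homog apr (p + q) (a * b);
  adga_leibniz : forall p a b, homog apr p a ->
    adiff (a * b) = adiff a * b + sg p *: (a * adiff b);
  adga_aug_deg : forall p a, homog apr p a -> p != 0 -> aug a = 0;
  adga_aug_diff : forall a, aug (adiff a) = 0 }.
Arguments apr {k a} p x : rename.
Arguments adiff {k a} x : rename.
Arguments aug {k a} : rename.

Record adga_mor (k : comNzRingType) (A B : adga k) := AdgaMor {
  amor :> {lrmorphism A -> B};
  amor_pr : forall p a, amor (apr p a) = apr p (amor a);
  amor_diff : forall a, amor (adiff a) = adiff (amor a);
  amor_aug : forall a, aug (amor a) = aug a }.

Section Homogeneous.
Variables (k : comNzRingType) (A : adga k).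

Definition hel : Type := helt (@apr k A).

Lemma apr_homog p (a : A) : homog apr p (apr p a).
Proof. by rewrite /homog (gr_proj (cx_grading (adga_complex A))) eqxx. Qed.

Definition support (a : A) : seq int :=
  sval (cid2 (gr_sum (cx_grading (adga_complex A)) a)).

Definition components (a : A) : seq hel :=
  [seq Helt (apr_homog p a) | p <- support a].

(* The extension to A of a map given on homogeneous elements and linear on     *)
(* each A_p.                                                                   *)
Definition hext (M : lmodType k) (f : hel -> M) (a : A) : M :=
  \sum_(x <- components a) f x.

Record letter := Letter { lhom :> hel; laug : aug (hval lhom) = 0 }.

Definition lval (l : letter) : A := hval (lhom l).
Definition ldeg (l : letter) : int := hdeg (lhom l).

Definition word : Type := seq letter.

Definition wdeg (w : word) : int := \sum_(l <- w) (ldeg l - 1).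

Lemma homog_aug (a : hel) : homog apr (hdeg a) (hval a - (aug (hval a))%:A).
Proof.
case: a => p a /= ha; have hl := gr_linear (cx_grading (adga_complex A)) p.
have e0 : apr p (0 : A) = 0.
  by have := hl (-1) a a; rewrite !scaleN1r !addNr.
rewrite /homog addrC -scaleNr hl ha; congr (_ + _).
have [p0|p0] := eqVneq p 0; first by rewrite p0 (adga_one A).
by rewrite (adga_aug_deg ha p0) oppr0 !scale0r.
Qed.

Lemma aug_bar (a : A) : aug (a - (aug a)%:A) = 0.
Proof. by rewrite raddfB /= linearZ /= rmorph1 mulr1 subrr. Qed.

Definition lbar (a : hel) : letter :=
  @Letter (Helt (homog_aug a)) (aug_bar (hval a)).

Lemma homog_diff (l : letter) : homog apr (ldeg l + 1) (adiff (lval l)).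
Proof. by apply: (cx_degree (adga_complex A)); apply: hvalP. Qed.

Definition ldiff (l : letter) : letter :=
  @Letter (Helt (homog_diff l)) (adga_aug_diff _).

Lemma homog_mul (l l' : letter) :
  homog apr (ldeg l + ldeg l') (lval l * lval l').
Proof. by apply: adga_mul; apply: hvalP. Qed.

Lemma aug_mul (l l' : letter) : aug (lval l * lval l') = 0.
Proof. by rewrite rmorphM /= (laug l) mul0r. Qed.

Definition lmul (l l' : letter) : letter :=
  @Letter (Helt (homog_mul l l')) (aug_mul l l').

End Homogeneous.

Section LetterMap.
Variables (k : comNzRingType) (A B : adga k) (f : adga_mor A B).

Lemma homog_mor (l : letter A) : homog apr (ldeg l) (f (lval l)).
Proof. by rewrite /homog -amor_pr; congr (f _); apply: hvalP. Qed.

Lemma aug_mor (l : letter A) : aug (f (lval l)) = 0.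
Proof. by rewrite amor_aug; apply: laug. Qed.

Definition lmap (l : letter A) : letter B :=
  @Letter _ _ (Helt (homog_mor l)) (aug_mor l).

Definition wmap (w : word A) : word B := map lmap w.

End LetterMap.

Section Bar.
Variables (k : comNzRingType) (A : adga k).

(* BA is presented by words in homogeneous elements of the augmentation ideal, *)
(* the relations being multilinearity.                                         *)
Inductive bar_rel : word A -> seq (k * word A) -> Prop :=
| BarRel w1 w2 (l l1 l2 : letter A) c :
    ldeg l = ldeg l1 -> ldeg l = ldeg l2 -> lval l = c *: lval l1 + lval l2 ->
    bar_rel (w1 ++ l :: w2) [:: (c, w1 ++ l1 :: w2); (1, w1 ++ l2 :: w2)].

Definition bar : lmodType k := pmod bar_rel.

Definition bw (w : word A) : bar := pgen bar_rel w.

Definition bar_pr (p : int) : bar -> bar :=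
  plift (fun w => if wdeg w == p then bw w else 0).

Definition bar_eps : bar -> k :=
  plift (fun w => (if w is [::] then 1 else 0 : k^o)).

Definition bar_t : bar -> A :=
  plift (fun w => if w is [:: l] then lval l else 0).

Definition bar_delta : bar -> tens bar bar :=
  plift (fun w => \sum_(i < (size w).+1) tpure (bw (take i w)) (bw (drop i w))).

Definition word_diff (w : word A) : bar :=
  \sum_(i < size w)
     (if drop i w is l :: w2
      then - (sg (wdeg (take i w)) *: bw (take i w ++ ldiff l :: w2)) else 0)
  + \sum_(i < size w)
     (if drop i w is l1 :: l2 :: w2
      then sg (wdeg (take i.+1 w)) *: bw (take i w ++ lmul l1 l2 :: w2) else 0).

Definition bar_diff : bar -> bar := plift word_diff.

(* The dg bialgebra structures on BA defining an hga structure on A.           *)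
Record is_hga (mu : bar -> bar -> bar) : Prop := IsHga {
  hga_linl : forall y, linear (mu^~ y);
  hga_linr : forall x, linear (mu x);
  hga_deg : forall v w, homog bar_pr (wdeg v + wdeg w) (mu (bw v) (bw w));
  hga_assoc : associative mu;
  hga_unitl : left_id (bw [::]) mu;
  hga_unitr : right_id (bw [::]) mu;
  hga_diff : forall v w, bar_diff (mu (bw v) (bw w)) =
    mu (bar_diff (bw v)) (bw w) + sg (wdeg v) *: mu (bw v) (bar_diff (bw w));
  hga_delta : forall v w, bar_delta (mu (bw v) (bw w)) =
    \sum_(i < (size v).+1) \sum_(j < (size w).+1)
      sg (wdeg (drop i v) * wdeg (take j w)) *:
        tpure (mu (bw (take i v)) (bw (take j w)))
              (mu (bw (drop i v)) (bw (drop j w)));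
  hga_eps : forall x y, bar_eps (mu x y) = bar_eps x * bar_eps y;
  hga_E : forall v w, (1 < size v)%N -> bar_t (mu (bw v) (bw w)) = 0 }.

End Bar.

Record hga (k : comNzRingType) := Hga {
  hga_adga :> adga k;
  bmul : bar hga_adga -> bar hga_adga -> bar hga_adga;
  hgaP : is_hga bmul }.
Arguments bmul {k h} x y : rename.

Definition EE (k : comNzRingType) (A : hga k) (x y : bar A) : A :=
  bar_t (bmul x y).

Record hga_mor (k : comNzRingType) (A B : hga k) := HgaMor {
  hmor :> adga_mor A B;
  hmor_E : forall v w : word A,
    EE (bw (wmap hmor v)) (bw (wmap hmor w)) = hmor (EE (bw v) (bw w)) }.

(* S, h and h_n in the case A = A', A'' = k, where B(A, A, k) = A (x) BA and   *)
(* B(k, A, k) = BA.  The augmentation ideal of k being 0, the product on       *)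
(* B(k, A, k) is then that of BA.                                              *)
Section HomotopyMaps.
Variables (k : comNzRingType) (A : hga k).

Definition lbarc : lmodType k := tens (ca A) (bar A).

Definition lgen : Type := hel A * word A.

Definition lgdeg (x : lgen) : int := hdeg x.1 + wdeg x.2.

Definition lg (x : lgen) : lbarc := tpure (hval x.1) (bw x.2).

Definition SS : lbarc -> bar A :=
  tlift (fun (a : A) (u : bar A) =>
    hext (fun x => plift (fun w => bw (lbar x :: w)) u) a).

Definition hh (x : lgen) (y : lbarc) : lbarc :=
  sg (lgdeg x) *: tpure (hval x.1) (bmul (bw x.2) (SS y)).

(* h_n (x_1, ..., x_(n-1), y), where rs lists x_(n-1), ..., x_1.               *)
Fixpoint hn_rev (rs : seq lgen) (y : lbarc) : lbarc :=
  if rs is x :: rs' then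
    sg (\sum_(z <- rs') lgdeg z) *: hn_rev rs' (hh x y)
  else y.

Definition hn (xs : seq lgen) : lbarc :=
  if rev xs is y :: rs then hn_rev rs (lg y) else 0.

End HomotopyMaps.

Section TwoSided.
Variables (k : comNzRingType) (A A' A'' : hga k).
Variables (f' : hga_mor A A') (f'' : hga_mor A A'').

Definition rbarc : lmodType k := tens (bar A) (ca A'').

Definition bar2 : lmodType k := tens (ca A') rbarc.

Definition el3 (a' : A') (u : bar A) (a'' : A'') : bar2 :=
  tpure a' (tpure u a'').

Definition gen2 : Type := hel A' * word A * hel A''.

Definition gdeg (x : gen2) : int := hdeg x.1.1 + wdeg x.1.2 + hdeg x.2.

Definition g2 (x : gen2) : bar2 := el3 (hval x.1.1) (bw x.1.2) (hval x.2).

Definition lift2 (M : lmodType k) (f : gen2 -> M) : bar2 -> M :=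
  tlift (fun (a' : A') (y : rbarc) =>
    hext (fun x' =>
      tlift (fun (u : bar A) (a'' : A'') =>
        plift (fun w => hext (fun x'' => f (x', w, x'')) a'') u) y) a').

Definition bar2_pr (p : int) : bar2 -> bar2 :=
  lift2 (fun x => if gdeg x == p then g2 x else 0).

Definition gen2_diff (x : gen2) : bar2 :=
  let: (a', w, a'') := x in
    el3 (adiff (hval a')) (bw w) (hval a'')
  + sg (hdeg a') *: el3 (hval a') (bar_diff (bw w)) (hval a'')
  + sg (hdeg a' + wdeg w) *: el3 (hval a') (bw w) (adiff (hval a''))
  + (if w is l :: w2 then
       sg (hdeg a') *: el3 (hval a' * f' (lval l)) (bw w2) (hval a'')
       - sg (hdeg a' + wdeg (belast l w2)) *:
           el3 (hval a') (bw (belast l w2)) (f'' (lval (last l w2)) * hval a'')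
     else 0).

Definition bar2_diff : bar2 -> bar2 := lift2 gen2_diff.

Definition bar2_unit : bar2 := el3 1 (bw [::]) 1.

Definition bar2_aug : bar2 -> k :=
  lift2 (fun x => (aug (hval x.1.1) * bar_eps (bw x.1.2) * aug (hval x.2) : k^o)).

Definition rgen : Type := word A * hel A''.

Definition rgdeg (x : rgen) : int := wdeg x.1 + hdeg x.2.

Definition rg (x : rgen) : rbarc := tpure (bw x.1) (hval x.2).

Definition rlift (M : lmodType k) (f : rgen -> M) : rbarc -> M :=
  tlift (fun (u : bar A) (a'' : A'') =>
    plift (fun w => hext (fun x'' => f (w, x'')) a'') u).

Definition rgen_mul (x y : rgen) : rbarc :=
  let: (w, a) := x in let: (v, b) := y in
    \sum_(i < (size v).+1)
      sg (hdeg a * wdeg (take i v)) *: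
        tpure (bmul (bw w) (bw (take i v)))
              (EE (bw [:: lbar a]) (bw (wmap f'' (drop i v))) * hval b)
  + tpure (bmul (bw w) (bw v)) (aug (hval a) *: hval b).

Definition rmul (x y : rbarc) : rbarc :=
  rlift (fun a => rlift (fun b => rgen_mul a b) y) x.

Definition rprod (x : rgen) (s : seq rgen) : rbarc :=
  foldl (fun y z => rmul y (rg z)) (rg x) s.

Definition gsplit : Type := (hel A' * word A) * rgen.

Definition splits (x : gen2) : seq gsplit :=
  let: (a', w, a'') := x in
  [seq ((a', take i w), (drop i w, a'')) | i <- iota 0 (size w).+1].

Fixpoint allsplits (xs : seq gen2) : seq (seq gsplit) :=
  if xs is x :: xs' then [seq p :: c | p <- splits x, c <- allsplits xs']
  else [:: [::]].

(* The left parts of a_2, ..., a_n, considered as elements of B(A', A', k).    *)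
Definition left' (p : gsplit) : lgen A' := (p.1.1, wmap f' p.1.2).

Fixpoint crossing (c : seq gsplit) : int :=
  if c is p :: c' then
    rgdeg p.2 * (\sum_(q <- c') lgdeg (left' q)) + crossing c'
  else 0.

Definition kappa (c : seq gsplit) : int :=
  if c is p :: _ then
    crossing c + (size c)%:Z * hdeg p.1.1 + (size c).-1%:Z * wdeg p.1.2
  else 0.

Definition mtilde_term (c : seq gsplit) : bar2 :=
  if c is p :: c' then
    sg (kappa c) *:
      tpure (hval p.1.1 * EE (bw (wmap f' p.1.2)) (SS (hn (map left' c'))))
            (rprod p.2 [seq q.2 | q <- c'])
  else 0.

Definition mtilde (xs : seq gen2) : bar2 :=
  \sum_(c <- allsplits xs) mtilde_term c.

Definition mgen (xs : seq gen2) : bar2 :=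
  match xs with
  | [:: (a1', w1, a1''); (a2', w2, a2'')] =>
      mtilde xs + tpure (aug (hval a2') *: hval a1')
                        (rmul (rg (w1, a1'')) (rg (w2, a2'')))
  | _ => mtilde xs
  end.

Fixpoint multilift (f : seq gen2 -> bar2) (xs : seq bar2) : bar2 :=
  if xs is x :: xs' then
    lift2 (fun g => multilift (fun gs => f (g :: gs)) xs') x
  else f [::].

(* m_n is the restriction to sequences of size n >= 2.                         *)
Definition bar2_m : seq bar2 -> bar2 := multilift mgen.

End TwoSided.

(* A family of multilinear maps m_n : V^n -> V, n >= 2, is encoded as one      *)
(* function m on sequences, of which only the values on sequences of size at   *)
(* least 2 matter.                                                             *)
Section Ainfty.
Variables (k : comNzRingType) (V : lmodType k).
Variables (pr : int -> V -> V) (d : V -> V) (m : seq V -> V).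

Definition hvals (xs : seq (helt pr)) : seq V := [seq hval x | x <- xs].
Definition tdeg (xs : seq (helt pr)) : int := \sum_(x <- xs) hdeg x.

(* d (m_n) evaluated at xs.                                                    *)
Definition dm (xs : seq (helt pr)) : V :=
  let n := size xs in let vs := hvals xs in
  d (m vs) - sg (2 - n%:Z) *:
    \sum_(i < n) sg (tdeg (take i xs)) *:
      m (take i vs ++ d vs`_i :: drop i.+1 vs).

(* m_(n-l+1) (1^i (x) m_l (x) 1^(n-i-l)) evaluated at xs.                      *)
Definition mm (l i : nat) (xs : seq (helt pr)) : V :=
  let vs := hvals xs in
  sg ((2 - l%:Z) * tdeg (take i xs)) *:
    m (take i vs ++ m (take l (drop i vs)) :: drop (i + l)%N vs).

Record is_ainfty : Prop := IsAinfty {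
  ai_complex : is_complex pr d;
  ai_multilinear : forall s x y c t, (0 < size s + size t)%N ->
    m (s ++ (c *: x + y) :: t) = c *: m (s ++ x :: t) + m (s ++ y :: t);
  ai_degree : forall xs : seq (helt pr), (1 < size xs)%N ->
    homog pr (tdeg xs + 2 - (size xs)%:Z) (m (hvals xs));
  ai_stasheff : forall xs : seq (helt pr), let n := size xs in (1 < n)%N ->
    dm xs = - \sum_(2 <= l < n) \sum_(0 <= i < (n - l).+1)
                (-1) ^+ (i + l * (n - i - l)) *: mm l i xs }.

Record is_strict_unit (e : V) : Prop := IsStrictUnit {
  su_degree : homog pr 0 e;
  su_cocycle : d e = 0;
  su_right : forall x, m [:: x; e] = x;
  su_left : forall x, m [:: e; x] = x;
  su_vanish : forall xs, (2 < size xs)%N -> e \in xs -> m xs = 0 }.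

Record is_ainfty_aug (e : V) (eps : V -> k) : Prop := IsAinftyAug {
  ag_linear : linear (eps : V -> k^o);
  ag_degree : forall p v, homog pr p v -> p != 0 -> eps v = 0;
  ag_diff : forall v, eps (d v) = 0;
  ag_unit : eps e = 1;
  ag_mul : forall x y, eps (m [:: x; y]) = eps x * eps y;
  ag_vanish : forall xs, (2 < size xs)%N -> eps (m xs) = 0 }.

Record is_augmented_ainfty (e : V) (eps : V -> k) : Prop := IsAugmentedAinfty {
  aa_ainfty : is_ainfty;
  aa_unit : is_strict_unit e;
  aa_aug : is_ainfty_aug e eps }.

End Ainfty.

(* Main.v *)
Require Import Defs.
From mathcomp Require Import all_boot all_order all_algebra.
From mathcomp Require Import boolp.
From mathcomp Require Import zify.
Set Implicit Arguments.
Unset Strict Implicit.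
Unset Printing Implicit Defensive.
Import Order.TTheory GRing.Theory Num.Theory.
Local Open Scope ring_scope.

(** Put R = B(k, A, A'') and Q = BA' (x) R.  The coaction of BA' on R, through
    the map BA -> BA', makes Q a left R-module, and x = a (x) r in
    B(A', A, A'') = A' (x) R acts on Q by Phi x q = [abar | r q].  The chain
    F(x_2, ..., x_n) = Phi x_2 (... (Phi x_n 1)) and the twisting cochain t of
    A' give m_n(x_1, ..., x_n) = a_1 (t (x) 1)(r_1 F(x_2, ..., x_n)) up to
    signs, plus a_1 eps(a_2) (x) r_1 r_2 for n = 2.  Composing with powers of
    the parity operator J in the arguments removes all signs: with the
    differential as beta_1, the Stasheff identities say that
    beta(- J s, beta(m), e), summed over all decompositions (s, m, e) of
    (x_1, ..., x_n), vanishes.  This follows from two facts, proved by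
    induction on the length: the diagonal of BA' maps F(xs) to the sum of
    F(s) (x) F(e), suitably multiplied, over xs = (s, e); and dF(xs) is, up to
    boundary terms, minus the sum of F(- J s, beta(m), e) over all (s, m, e).
    Indeed d[a | c] contains the term t(c') c'', which the diagonal formula
    turns into the terms beta(x, m), and applying the twisting identity for t
    gives the terms in which beta is outermost on the left. *)

(** The obstacle is the bar in [abar | c]: subtracting eps(a) 1 makes d[abar | c] differ from the
    usual formula by the defect eps(a) (c - eps(c) [ ]). Inside a chain these defects turn into
    inner operations, and two boundary terms remain: eps(a_1) r_1 F(x_2, ..., x_n) at the head and
    F(x_1, ..., x_(n-1)) times eps(a_n) r_n, up to signs, at the tail. This explains the summand a_1
    eps(a_2) (x) r_1 r_2 of m_2: as an inner operation it accounts for the defects inside a chain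
    and at its head, as the outermost operation for the one at the tail. Since t has values in the
    augmentation ideal, that summand cannot have a value of t as its second argument. What is left
    are the square of the untwisted differential, the Leibniz rule and associativity for this
    summand. The modules are quotients without a chosen basis, so identities are stated between
    linear maps and checked on generators. A sign (-1)^|a| makes no sense for inhomogeneous a, but
    the parity operator does; this is a further reason to absorb signs into operators. *)

(** * Identities in abelian groups by reflection *)

Section Abel.
Variable V : zmodType.

Inductive zexpr := ZVar of nat | ZZero | ZOpp of zexpr | ZAdd of zexpr & zexpr.

Fixpoint zeval (env : seq V) (e : zexpr) : V :=
  match e with
  | ZVar i => nth 0 env i
  | ZZero => 0
  | ZOpp e1 => - zeval env e1
  | ZAdd e1 e2 => zeval env e1 + zeval env e2
  end.

Fixpoint zcoef (e : zexpr) (i : nat) : int :=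
  match e with
  | ZVar j => (i == j)%:Z
  | ZZero => 0
  | ZOpp e1 => - zcoef e1 i
  | ZAdd e1 e2 => zcoef e1 i + zcoef e2 i
  end.

Lemma zevalE env e :
  zeval env e = \sum_(i < size env) nth 0 env i *~ zcoef e i.
Proof.
elim: e => [j||e1 IH1|e1 IH1 e2 IH2] /=.
- have [jn|jn] := ltnP j (size env); last first.
    rewrite nth_default // big1 // => i _; rewrite (_ : (i : nat) == j = false) ?mulr0z //.
    by apply/eqP => ij; rewrite -ij leqNgt ltn_ord in jn.
  rewrite (bigD1 (Ordinal jn)) //= eqxx mulr1z big1 ?addr0 // => i ij.
  rewrite (_ : (i : nat) == j = false) ?mulr0z //.
  by apply/negbTE; apply: contraNneq ij => ij; apply/eqP/val_inj.
- by rewrite big1 // => i _; rewrite mulr0z.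
- by rewrite IH1 -sumrN; apply: eq_bigr => i _; rewrite mulrNz.
by rewrite IH1 IH2 -big_split; apply: eq_bigr => i _; rewrite mulrzDr.
Qed.

(** Comparing the integer coefficients of the atoms in [env] suffices, since an index beyond [env]
    evaluates to the default 0. *)
Lemma abelP env e1 e2 :
  all (fun i => zcoef e1 i == zcoef e2 i) (iota 0 (size env)) ->
  zeval env e1 = zeval env e2.
Proof.
move/allP=> H; rewrite !zevalE; apply: eq_bigr => i _.
by have /eqP -> := H i (ltac:(by rewrite mem_iota ltn_ord)).
Qed.

End Abel.

Ltac abel_index x env :=
  lazymatch env with
  | x :: _ => constr:(0%N)
  | _ :: ?env' => let i := abel_index x env' in constr:(S i)
  end.

Ltac abel_vars t env :=
  lazymatch t with
  | ?a + ?b => let env1 := abel_vars a env in abel_vars b env1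
  | - ?a => abel_vars a env
  | 0 => env
  | _ => match env with
         | context [t :: _] => env
         | _ => constr:(t :: env)
         end
  end.

Ltac abel_reify t env :=
  lazymatch t with
  | ?a + ?b => let x := abel_reify a env in let y := abel_reify b env in
               constr:(ZAdd x y)
  | - ?a => let x := abel_reify a env in constr:(ZOpp x)
  | 0 => constr:(ZZero)
  | _ => let i := abel_index t env in constr:(ZVar i)
  end.

(** Generalizing the atoms to variables first keeps [vm_compute] from evaluating the terms that
    would be listed in the environment. *)
Ltac abel_atom t :=
  lazymatch t with
  | ?a + ?b => first [abel_atom a | abel_atom b]
  | - ?a => abel_atom a
  | 0 => fail
  | _ => tryif is_var t then fail else
         (let x := fresh "x" in set x := (t); clearbody x)
  end.

Ltac abel :=
  repeat match goal with
  | |- ?l = ?r => first [abel_atom l | abel_atom r]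
  end;
  lazymatch goal with
  | |- @eq ?T ?l ?r =>
    let env0 := abel_vars l (@nil T) in
    let env := abel_vars r env0 in
    let e1 := abel_reify l env in
    let e2 := abel_reify r env in
    refine (@abelP _ env e1 e2 _); vm_compute; reflexivity
  end.

(** * Linear maps and signs *)

Section Linear.
Variable k : comNzRingType.
Implicit Types U V W M : lmodType k.

Lemma lin0 V W (f : V -> W) : linear f -> f 0 = 0.
Proof. by move=> lf; have := lf (-1) 0 0; rewrite scaler0 addr0 scaleN1r addNr. Qed.

Lemma linD V W (f : V -> W) : linear f -> forall x y, f (x + y) = f x + f y.
Proof. by move=> lf x y; have := lf 1 x y; rewrite !scale1r. Qed.

Lemma linZ V W (f : V -> W) : linear f -> forall c x, f (c *: x) = c *: f x.
Proof. by move=> lf c x; have := lf c x 0; rewrite !addr0 (lin0 lf) addr0. Qed.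

Lemma linN V W (f : V -> W) : linear f -> forall x, f (- x) = - f x.
Proof. by move=> lf x; rewrite -scaleN1r (linZ lf) scaleN1r. Qed.

Lemma linB V W (f : V -> W) : linear f -> forall x y, f (x - y) = f x - f y.
Proof. by move=> lf x y; rewrite (linD lf) (linN lf). Qed.

Lemma lin_sumE V W (f : V -> W) : linear f ->
  forall I (r : seq I) (P : pred I) F,
    f (\sum_(i <- r | P i) F i) = \sum_(i <- r | P i) f (F i).
Proof. by move=> lf I r P F; apply: (big_morph f (linD lf) (lin0 lf)). Qed.

Lemma lin_id V : linear (fun x : V => x).
Proof. by []. Qed.

Lemma lin_zero V W : linear (fun _ : V => 0 : W).
Proof. by move=> c x y; rewrite scaler0 addr0. Qed.

Lemma lin_comp U V W (f : V -> W) (g : U -> V) :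
  linear f -> linear g -> linear (fun x => f (g x)).
Proof. by move=> lf lg c x y; rewrite lg lf. Qed.

Lemma lin_add V W (f g : V -> W) :
  linear f -> linear g -> linear (fun x => f x + g x).
Proof. by move=> lf lg c x y; rewrite lf lg scalerDr addrACA. Qed.

Lemma lin_opp V W (f : V -> W) : linear f -> linear (fun x => - f x).
Proof. by move=> lf c x y; rewrite lf opprD scalerN. Qed.

Lemma lin_scale V W (a : k) (f : V -> W) :
  linear f -> linear (fun x => a *: f x).
Proof. by move=> lf c x y; rewrite lf scalerDr !scalerA mulrC. Qed.

Lemma lin_scalel V W (f : V -> k) (w : W) :
  linear (f : V -> k^o) -> linear (fun x => f x *: w).
Proof. by move=> lf c x y; rewrite [f _]lf scalerDl -scalerA. Qed.

Lemma lin_sum V W I (r : seq I) (P : pred I) (F : I -> V -> W) :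
  (forall i, linear (F i)) -> linear (fun x => \sum_(i <- r | P i) F i x).
Proof.
move=> lF c x y; rewrite scaler_sumr -big_split; apply: eq_bigr => i _.
exact: lF.
Qed.

Lemma lin_if V W (b : bool) (f g : V -> W) :
  linear f -> linear g -> linear (fun x => if b then f x else g x).
Proof. by case: b. Qed.

End Linear.

(** * Presented modules and tensor products *)

Section PresentationLemmas.
Variables (k : comNzRingType) (X : Type) (R : X -> seq (k * X) -> Prop).

(** The chosen representative writes x as a combination of generators, on which G is evaluated term
    by term. This is why a linear map is determined by its values on generators. *)
Lemma feval_pgen (M : lmodType k) (G : pmod R -> M) : linear G ->
  forall x, G x = feval (fun g => G (pgen R g)) (prep x).
Proof.
move=> lG x; rewrite -{1}[x]prepK; elim: (prep x) => [|[c g] s IH].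
  by rewrite /feval big_nil (lin0 lG).
have -> : pcls R ((c, g) :: s) = c *: pgen R g + pcls R s.
  rewrite [c *: _](pscaleE R c [:: (1, g)]) pclsD /= mulr1; congr pcls.
by rewrite lG IH /feval big_cons.
Qed.

Lemma pmod_ext (M : lmodType k) (F G : pmod R -> M) :
  linear F -> linear G -> (forall g, F (pgen R g) = G (pgen R g)) ->
  forall x, F x = G x.
Proof.
move=> lF lG FG x; rewrite (feval_pgen lF) (feval_pgen lG).
by apply: eq_bigr => p _; rewrite FG.
Qed.

(** The comparison takes place on the representative on which [plift] computes, so a linear G
    matching f on generators identifies the lift at once. *)
Lemma plift_ext (M : lmodType k) (f : X -> M) (G : pmod R -> M) :
  linear G -> (forall g, f g = G (pgen R g)) -> forall x, plift f x = G x.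
Proof.
move=> lG fG x; rewrite (feval_pgen lG).
by apply: eq_bigr => p _; rewrite fG.
Qed.

Lemma pgen_rel x s : R x s -> pgen R x = feval (pgen R) s.
Proof.
move=> Rxs; rewrite /pgen.
have /pclsP -> : feq R [:: (1, x)] (fscale 1 s) by apply: feq_rel.
rewrite fscale1; elim: s {Rxs} => [|[c y] s IH]; first by rewrite /feval big_nil.
rewrite /feval big_cons -[\sum_(_ <- _) _]IH.
rewrite [c *: _](pscaleE R c [:: (1, y)]) pclsD /= mulr1; congr pcls.
Qed.

End PresentationLemmas.

Section TensorLemmas.
Variables (k : comNzRingType) (V W : lmodType k).

Lemma tpure_linl (w : W) : linear (fun v : V => tpure v w).
Proof.
move=> c x y; rewrite /tpure (pgen_rel (tens_rell c x y w)).
by rewrite /feval !big_cons big_nil addr0 scale1r.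
Qed.

Lemma tpure_linr (v : V) : linear (tpure v : W -> tens V W).
Proof.
move=> c x y; rewrite /tpure (pgen_rel (tens_relr c v x y)).
by rewrite /feval !big_cons big_nil addr0 scale1r.
Qed.

Lemma tens_ext (M : lmodType k) (F G : tens V W -> M) :
  linear F -> linear G -> (forall v w, F (tpure v w) = G (tpure v w)) ->
  forall x, F x = G x.
Proof. by move=> lF lG FG; apply: (pmod_ext lF lG) => -[v w]; apply: FG. Qed.

Lemma tlift_ext (M : lmodType k) (f : V -> W -> M) (G : tens V W -> M) :
  linear G -> (forall v w, f v w = G (tpure v w)) -> forall x, tlift f x = G x.
Proof. by move=> lG fG; apply: (plift_ext lG) => -[v w]; apply: fG. Qed.

Variables (M : lmodType k) (f : V -> W -> M).
Hypotheses (linl : forall w, linear (fun v => f v w)).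
Hypotheses (linr : forall v, linear (f v)).

Lemma tlift_respects : respects (@tens_rel k V W) (fun p => f p.1 p.2).
Proof.
move=> x s [c v1 v2 w|c v w1 w2]; rewrite /feval !big_cons big_nil addr0 /=.
  by rewrite linl scale1r.
by rewrite linr scale1r.
Qed.

Lemma tlift_lin : linear (tlift f).
Proof. exact: plift_linear tlift_respects. Qed.

Lemma tliftE v w : tlift f (tpure v w) = f v w.
Proof. exact: (plift_gen tlift_respects). Qed.

End TensorLemmas.

(* Lifts compute on representatives chosen in the quotient. Only their linearity and their values on
   generators are meaningful, so they are sealed here. *)
#[global] Opaque plift tlift.

#[export] Hint Extern 0 (GRing.linear_for _ (fun x => x)) => exact: lin_id : lin.
#[export] Hint Extern 0 (GRing.linear_for _ (fun _ => 0)) => exact: lin_zero : lin.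
#[export] Hint Extern 0 (GRing.linear_for _ (tpure _)) => exact: tpure_linr : lin.
#[export] Hint Extern 0 (GRing.linear_for _ (fun x => tpure x _)) => exact: tpure_linl : lin.
#[export] Hint Extern 0 (GRing.linear_for _ id) => exact: lin_id : lin.

Ltac lin :=
  intros; cbv beta;
  try match goal with
  | |- GRing.linear_for ?s (fun x => ?f x) => change (GRing.linear_for s f)
  end;
  first
  [ assumption | solve [auto 2 with lin nocore]
  | lazymatch goal with
    | |- GRing.linear_for _ (fun x => @?a x + @?b x) =>
        apply (@lin_add _ _ _ a b); lin
    | |- GRing.linear_for _ (fun x => - @?a x) =>
        apply (@lin_opp _ _ _ a); lin
    | |- GRing.linear_for _ (fun x => ?c *: @?a x) =>
        apply (@lin_scale _ _ _ c a); lin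
    | |- GRing.linear_for _ (fun x => @?c x *: ?w) =>
        apply (@lin_scalel _ _ _ c w); lin
    | |- GRing.linear_for _ (fun x => bigop _ _ _) => apply: lin_sum; lin
    end
  | match goal with |- GRing.linear_for _ (fun x => ?f (@?g x)) =>
        apply (@lin_comp _ _ _ _ f g); [lin | lin]
    end
  | match goal with |- GRing.linear_for _ (fun x => ?f (@?g x) ?y) =>
        apply (@lin_comp _ _ _ _ (fun z => f z y) g); [lin | lin]
    end
  | solve [apply: lin_if; lin]
  ].

(* Every Koszul sign below is a product of values of sg, i.e. depends on       *)
(* degrees through their parity only.                                          *)
Definition par (p : int) : bool := odd `|p|.

Lemma parD p q : par (p + q) = par p (+) par q.
Proof. rewrite /par; lia. Qed.

Lemma parN p : par (- p) = par p.
Proof. by rewrite /par abszN. Qed.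

Lemma parM p q : par (p * q) = par p && par q.
Proof. by rewrite /par abszM oddM. Qed.

Lemma par0 : par 0 = false. Proof. by []. Qed.
Lemma par1 : par 1 = true. Proof. by []. Qed.
Lemma par2 : par 2 = false. Proof. by []. Qed.
Lemma par_nat n : par n%:Z = odd n. Proof. by []. Qed.

Lemma sgE (k : comNzRingType) p : sg p = (-1) ^+ par p :> k.
Proof. by rewrite /sg /par signr_odd. Qed.

Definition parE := (parD, parN, parM, par0, par1, par2, par_nat).

Ltac sgn :=
  rewrite ?sgE ?parE;
  repeat match goal with |- context [par ?x] => case: (par x) end;
  rewrite /= ?(expr0, expr1, mulN1r, mulrN1, mulr1, mul1r, opprK, mulrNN) //.

Lemma sg0 (k : comNzRingType) : sg 0 = 1 :> k. Proof. by []. Qed.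
Lemma sgD (k : comNzRingType) p q : sg (p + q) = sg p * sg q :> k.
Proof. by sgn. Qed.
Lemma sgsq (k : comNzRingType) p : sg p * sg p = 1 :> k.
Proof. by sgn. Qed.

(** * Homogeneous components and parity operators *)

Section HomogeneousLemmas.
Variables (k : comNzRingType) (A : adga k).

Lemma apr_lin p : linear (@apr k A p).
Proof. exact: gr_linear (cx_grading (adga_complex A)) p. Qed.

Lemma adiff_lin : linear (@adiff k A).
Proof. exact: cx_linear (adga_complex A). Qed.

Lemma aug_lin : linear (aug : A -> k^o).
Proof. by move=> c x y; rewrite linearP. Qed.

Lemma apr_apr p q (a : A) : apr p (apr q a) = if p == q then apr q a else 0.
Proof. exact: gr_proj (cx_grading (adga_complex A)) p q a. Qed.

Lemma apr_hel p (x : hel A) : apr p (hval x) = if p == hdeg x then hval x else 0.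
Proof. by have := apr_apr p (hdeg x) (hval x); rewrite (hvalP x). Qed.

Lemma support_sum (a : A) : uniq (Defs.support a) /\ a = \sum_(p <- Defs.support a) apr p a.
Proof. by rewrite /Defs.support; case: cid2. Qed.

Lemma support_out p (a : A) : p \notin Defs.support a -> apr p a = 0.
Proof.
move=> pa; rewrite (support_sum a).2 (lin_sumE (apr_lin p)) big_seq big1 // => q qa.
by rewrite apr_apr; case: eqP => // pq; rewrite pq qa in pa.
Qed.

Variables (M : lmodType k) (f : hel A -> M).

(** The element 0 lies in every degree, so f may depend on the degree carried along with a value;
    linearity makes sense within one degree only. *)
Definition hmulti := forall (x y z : hel A) c,
  hdeg x = hdeg y -> hdeg x = hdeg z -> hval x = c *: hval y + hval z ->
  f x = c *: f y + f z.

Definition comp_at (p : int) (a : A) : hel A := Helt (apr_homog p a).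

(** Supports are chosen, so sums over different ones must be made comparable. Enlarging the set of
    degrees only adds components z = 0, and z = -1 z + z gives f z = - f z + f z = 0. *)
Lemma hext_sum (a : A) (s : seq int) : hmulti -> uniq s ->
  {subset Defs.support a <= s} -> hext f a = \sum_(p <- s) f (comp_at p a).
Proof.
move=> fm us sub; rewrite /hext /components big_map [RHS](bigID (mem (Defs.support a))) /=.
rewrite [X in _ + X]big1 ?addr0 => [|p pa].
  rewrite -[RHS]big_filter; apply: perm_big; apply: uniq_perm.
  - exact: (support_sum a).1.
  - exact: filter_uniq.
  by move=> p; rewrite mem_filter andb_idr // => /sub.
have p0 : apr p a = 0 by exact: support_out.
have := fm (comp_at p a) (comp_at p a) (comp_at p a) 0 erefl erefl.
by rewrite /= scale0r add0r => /(_ erefl); have := fm (comp_at p a) (comp_at p a) (comp_at p a)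
  (-1) erefl erefl; rewrite /= p0 addr0 scaler0 scaleN1r addNr => /(_ erefl).
Qed.

Lemma hext_lin : hmulti -> linear (hext f).
Proof.
move=> fm c x y.
pose s := undup (Defs.support x ++ Defs.support y ++ Defs.support (c *: x + y)).
have us : uniq s by apply: undup_uniq.
have sub z : (forall p, p \in Defs.support z -> p \in s) -> hext f z = \sum_(p <- s) f
  (comp_at p z).
  by move=> H; apply: hext_sum.
rewrite !sub; try by move=> p pz; rewrite mem_undup !mem_cat pz ?orbT.
rewrite scaler_sumr -big_split; apply: eq_bigr => p _.
by apply: fm => //=; rewrite apr_lin.
Qed.

Lemma hmulti_eq (x y : hel A) : hmulti -> hdeg x = hdeg y -> hval x = hval y ->
  f x = f y.
Proof.
by move=> fm dxy vxy; rewrite (fm x x y 0 erefl dxy) scale0r add0r ?vxy.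
Qed.

Lemma hextE (x : hel A) : hmulti -> hext f (hval x) = f x.
Proof.
move=> fm; pose s := undup (hdeg x :: Defs.support (hval x)).
rewrite (@hext_sum _ s) ?undup_uniq //; last first.
  by move=> p px; rewrite mem_undup inE px orbT.
have xs : hdeg x \in s by rewrite mem_undup inE eqxx.
rewrite (bigD1_seq (hdeg x)) ?undup_uniq //= big1 ?addr0 => [|p px].
  by apply: hmulti_eq => //=; rewrite (hvalP x).
have := fm (comp_at p (hval x)) (comp_at p (hval x)) (comp_at p (hval x)) (-1) erefl erefl.
by rewrite /= apr_hel (negPf px) addr0 scaler0 scaleN1r addNr; apply.
Qed.

End HomogeneousLemmas.

#[export] Hint Extern 1 (GRing.linear_for _ (apr _)) => exact: apr_lin : lin.
#[export] Hint Extern 1 (GRing.linear_for _ adiff) => exact: adiff_lin : lin.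
#[export] Hint Extern 1 (GRing.linear_for _ (fun x => aug x)) => exact: aug_lin : lin.
#[export] Hint Extern 1 (GRing.linear_for _ aug) => exact: aug_lin : lin.

Lemma mull_lin (k : comNzRingType) (A : algType k) (c : A) :
  linear (fun x : A => c * x).
Proof. by move=> d x y; rewrite mulrDr scalerAr. Qed.

Lemma mulr_lin (k : comNzRingType) (A : algType k) (c : A) :
  linear (fun x : A => x * c).
Proof. by move=> d x y; rewrite mulrDl scalerAl. Qed.

Lemma amor_lin (k : comNzRingType) (A B : adga k) (f : adga_mor A B) : linear f.
Proof. by move=> c x y; rewrite linearP. Qed.

#[export] Hint Extern 1 (GRing.linear_for _ (fun x => _ * x)) => exact: mull_lin : lin.
#[export] Hint Extern 1 (GRing.linear_for _ (GRing.mul _)) => exact: mull_lin : lin.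
#[export] Hint Extern 1 (GRing.linear_for _ (fun x => x * _)) => exact: mulr_lin : lin.
#[export] Hint Extern 1 (GRing.linear_for _ _) => exact: amor_lin : lin.

Section HextExt.
Variables (k : comNzRingType) (A : adga k) (M : lmodType k).

Lemma hext_ext (f : hel A -> M) (G : A -> M) : linear G ->
  (forall x, f x = G (hval x)) -> forall a, hext f a = G a.
Proof.
move=> lG fG a; rewrite {2}(support_sum a).2 (lin_sumE lG) /hext /components big_map.
by apply: eq_bigr => p _; rewrite fG.
Qed.

Lemma hel_ext (F G : A -> M) : linear F -> linear G ->
  (forall x : hel A, F (hval x) = G (hval x)) -> forall a, F a = G a.
Proof.
move=> lF lG FG a; rewrite (support_sum a).2 (lin_sumE lF) (lin_sumE lG).
by apply: eq_bigr => p _; apply: (FG (comp_at p a)).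
Qed.

End HextExt.

#[global] Opaque hext.

Section Parity.
Variables (k : comNzRingType) (A : adga k).

(* pA, pC, pR, pQ and pV are the operators v |-> (-1)^|v| v; composing with    *)
(* them turns Koszul signs into identities between maps.                       *)
Definition pA : A -> A := hext (fun x => sg (hdeg x) *: hval x).

Lemma pA_multi : hmulti (fun x : hel A => sg (hdeg x) *: hval x).
Proof. by move=> x y z c dy dz ->; rewrite -dy -dz scalerDr !scalerA mulrC. Qed.

Lemma pA_lin : linear pA.
Proof. exact: hext_lin pA_multi. Qed.

Lemma pA_hel (x : hel A) : pA (hval x) = sg (hdeg x) *: hval x.
Proof. exact: hextE pA_multi. Qed.

Lemma pA_homog p (a : A) : homog apr p a -> pA a = sg p *: a.
Proof. by move=> ha; apply: (pA_hel (Helt ha)). Qed.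

Lemma pAK a : pA (pA a) = a.
Proof.
move: a; apply: hel_ext => [||x]; [by apply: lin_comp; apply: pA_lin|by []|].
by rewrite pA_hel (linZ pA_lin) pA_hel scalerA sgsq scale1r.
Qed.

Lemma pA1 : pA 1 = 1.
Proof. by rewrite (pA_homog (adga_one A)) scale1r. Qed.

Lemma pA_mul a b : pA (a * b) = pA a * pA b.
Proof.
move: a; apply: hel_ext => [||x].
- exact: (lin_comp pA_lin (mulr_lin b)).
- exact: (lin_comp (mulr_lin (pA b)) pA_lin).
move: b; apply: hel_ext => [||y].
- exact: (lin_comp pA_lin (mull_lin (hval x))).
- exact: (lin_comp (mull_lin (pA (hval x))) pA_lin).
rewrite !pA_hel (pA_homog (adga_mul (hvalP x) (hvalP y))) sgD.
by rewrite -scalerAl -scalerAr scalerA.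
Qed.

Lemma adiff_pA a : adiff (pA a) = - pA (adiff a).
Proof.
move: a; apply: hel_ext => [||x].
- exact: (lin_comp (@adiff_lin k A) pA_lin).
- exact: (lin_opp (lin_comp pA_lin (@adiff_lin k A))).
rewrite pA_hel (linZ (@adiff_lin k A)).
rewrite (pA_homog (cx_degree (adga_complex A) (hvalP x))) -scaleNr.
by congr (_ *: _); sgn.
Qed.

Lemma aug_pA a : aug (pA a) = aug a.
Proof.
move: a; apply: (@hel_ext k A k^o) => [||x].
- exact: (lin_comp (@aug_lin k A) pA_lin).
- exact: aug_lin.
rewrite pA_hel linearZ /=; have [->|d0] := eqVneq (hdeg x) 0.
  by rewrite sg0 mul1r.
by rewrite (adga_aug_deg (hvalP x) d0) mulr0.
Qed.

Lemma adiff_mul a b : adiff (a * b) = adiff a * b + pA a * adiff b.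
Proof.
move: a; apply: hel_ext => [||x].
- exact: (lin_comp (@adiff_lin k A) (mulr_lin b)).
- exact: (lin_add (lin_comp (mulr_lin b) (@adiff_lin k A)) (lin_comp (mulr_lin _) pA_lin)).
by rewrite (adga_leibniz b (hvalP x)) pA_hel scalerAl.
Qed.

Lemma adiff1 : adiff (1 : A) = 0.
Proof.
have := adiff_mul 1 1; rewrite !mulr1 pA1 mul1r => /eqP.
by rewrite -subr_eq subrr eq_sym => /eqP.
Qed.

End Parity.
#[export] Hint Extern 1 (GRing.linear_for _ (pA (A:=_))) => exact: pA_lin : lin.

Lemma amor_pA (k : comNzRingType) (A B : adga k) (f : adga_mor A B) a :
  f (pA a) = pA (f a).
Proof.
move: a; apply: hel_ext => [||x]; [lin|lin|].
rewrite pA_hel linearZ /= (@pA_homog _ _ (hdeg x)) //.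
by rewrite /homog -amor_pr (hvalP x).
Qed.

(** * The bar construction *)

Section Cuts.
Variable T : Type.
Implicit Types (w : seq T) (V : nmodType).

(** Deconcatenations are listed as pairs rather than indexed by positions, which suits induction on
    the word; [locked] keeps simplification from exposing [take] and [drop]. *)
Definition cuts w :=
  locked [seq (take i w, drop i w) | i <- iota 0 (size w).+1].

Lemma cuts_nil : cuts [::] = [:: ([::], [::])].
Proof. by rewrite /cuts -lock. Qed.

Lemma cuts_cons x w :
  cuts (x :: w) = ([::], x :: w) :: [seq (x :: p.1, p.2) | p <- cuts w].
Proof.
rewrite /cuts -!lock -[iota 0 (size (x :: w)).+1]/(0%N :: iota (1 + 0) (size w).+1).
by rewrite iotaDl map_cons -!map_comp.
Qed.

Lemma cuts_cat_cons w1 x w2 : cuts (w1 ++ x :: w2) =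
  [seq (p.1, p.2 ++ x :: w2) | p <- cuts w1]
  ++ [seq (w1 ++ x :: p.1, p.2) | p <- cuts w2].
Proof.
elim: w1 => [|y w1 IH]; first by rewrite cuts_cons cuts_nil.
rewrite cat_cons cuts_cons IH cuts_cons map_cat -!map_comp /=; congr (_ :: _).
by rewrite -map_comp.
Qed.

Lemma sum_cuts V w (F : seq T -> seq T -> V) :
  \sum_(i < (size w).+1) F (take i w) (drop i w) = \sum_(p <- cuts w) F p.1 p.2.
Proof.
by rewrite /cuts -lock big_map -/(index_iota 0 (size w).+1) big_mkord.
Qed.

(** Coassociativity of deconcatenation: both sides run over all ways to cut w into three pieces. *)
Lemma sum_cuts3 V w (F : seq T -> seq T -> seq T -> V) :
  \sum_(p <- cuts w) \sum_(q <- cuts p.1) F q.1 q.2 p.2 =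
  \sum_(p <- cuts w) \sum_(q <- cuts p.2) F p.1 q.1 q.2.
Proof.
elim: w F => [|x w IH] F; first by rewrite !(cuts_nil, big_seq1).
rewrite cuts_cons !big_cons !big_map /= cuts_nil big_seq1 /=.
rewrite -(IH (fun a => F (x :: a))) /= cuts_cons !big_cons big_map /= -!addrA.
congr (_ + _).
rewrite -big_split; apply: eq_bigr => p _.
by rewrite cuts_cons big_cons big_map.
Qed.

Lemma cuts_cat p w : List.In p (cuts w) -> p.1 ++ p.2 = w.
Proof.
elim: w p => [|x w IH] p; first by rewrite cuts_nil => -[<-|[]].
rewrite cuts_cons => -[<- //|/List.in_map_iff [q [<- /IH /= ->]]] //.
Qed.

(** Makes [p.1 ++ p.2 = w] available under the sum, which is how the degree of w is split in sign
    computations. The letters form a bare type, hence [List.In] in [cuts_cat]. *)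
Lemma eq_cuts V w (F G : seq T * seq T -> V) :
  (forall p, p.1 ++ p.2 = w -> F p = G p) ->
  \sum_(p <- cuts w) F p = \sum_(p <- cuts w) G p.
Proof.
move=> FG; have := @cuts_cat^~ w.
elim: (cuts w) => [|p s IH] H; first by rewrite !big_nil.
rewrite !big_cons FG ?IH // => [q qs|]; last by apply: H; left.
by apply: H; right.
Qed.

(** The counit law in the form needed for summands with a factor such as [bar_eps] or [br 1] on the
    first piece. *)
Lemma sum_cuts_nil V w (F : seq T -> seq T -> V) :
  (forall x w1 w2, F (x :: w1) w2 = 0) ->
  \sum_(p <- cuts w) F p.1 p.2 = F [::] w.
Proof.
move=> F0; case: w => [|x w]; first by rewrite cuts_nil big_seq1.
rewrite cuts_cons big_cons big_map big1 ?addr0 // => p _; exact: F0.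
Qed.

Lemma sum_cuts_last V w (F : seq T -> seq T -> V) :
  (forall x w1 w2, F w1 (x :: w2) = 0) ->
  \sum_(p <- cuts w) F p.1 p.2 = F w [::].
Proof.
elim: w F => [|x w IH] F F0; first by rewrite cuts_nil big_seq1.
rewrite cuts_cons big_cons big_map /= F0 add0r.
by rewrite (IH (fun a => F (x :: a))).
Qed.

End Cuts.

Lemma cuts_map T U (f : T -> U) w :
  cuts (map f w) = [seq (map f p.1, map f p.2) | p <- cuts w].
Proof.
elim: w => [|x w IH]; first by rewrite !cuts_nil.
rewrite /= !cuts_cons /= IH -!map_comp.
by congr (_ :: _).
Qed.

Section BarWords.
Variables (k : comNzRingType) (A : adga k).
Implicit Types (w : word A) (l : letter A).

Lemma wdeg_nil : wdeg ([::] : word A) = 0.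
Proof. exact: big_nil. Qed.

Lemma wdeg_cons l w : wdeg (l :: w) = ldeg l - 1 + wdeg w.
Proof. exact: big_cons. Qed.

Lemma wdeg_cat w1 w2 : wdeg (w1 ++ w2) = wdeg w1 + wdeg w2.
Proof. exact: big_cat. Qed.

Section Multilinear.
Variable M : lmodType k.

Definition wmulti (f : word A -> M) := forall w1 w2 (l l1 l2 : letter A) c,
  ldeg l = ldeg l1 -> ldeg l = ldeg l2 -> lval l = c *: lval l1 + lval l2 ->
  f (w1 ++ l :: w2) = c *: f (w1 ++ l1 :: w2) + f (w1 ++ l2 :: w2).

Lemma wmulti_respects f : wmulti f -> respects (@bar_rel k A) f.
Proof.
move=> fm _ _ [w1 w2 l l1 l2 c d1 d2 vl].
by rewrite /feval !big_cons big_nil addr0 /= scale1r; apply: fm.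
Qed.

Lemma wlift_lin f : wmulti f -> linear (plift f : bar A -> M).
Proof. by move=> fm; apply: plift_linear (wmulti_respects fm). Qed.

Lemma wliftE f w : wmulti f -> plift f (bw w) = f w.
Proof. by move=> fm; apply: plift_gen (wmulti_respects fm) w. Qed.

Lemma wlift_ext (f : word A -> M) (G : bar A -> M) : linear G ->
  (forall w, f w = G (bw w)) -> forall x, plift f x = G x.
Proof. exact: plift_ext. Qed.

Lemma bar_ext (F G : bar A -> M) : linear F -> linear G ->
  (forall w, F (bw w) = G (bw w)) -> forall x, F x = G x.
Proof. exact: pmod_ext. Qed.

End Multilinear.

Lemma bw_multi : wmulti (@bw k A).
Proof.
move=> w1 w2 l l1 l2 c d1 d2 vl; rewrite /bw (pgen_rel (BarRel w1 w2 d1 d2 vl)).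
by rewrite /feval !big_cons big_nil addr0 scale1r.
Qed.

Lemma wdeg_multi w1 w2 l l1 : ldeg l = ldeg l1 ->
  wdeg (w1 ++ l :: w2) = wdeg (w1 ++ l1 :: w2).
Proof. by move=> d1; rewrite !wdeg_cat !wdeg_cons d1. Qed.

(** A dependence on the degree is compatible with the relations because they only involve words of
    one and the same degree. *)
Lemma deg_multi (M : lmodType k) (phi : int -> bar A -> M) :
  (forall n, linear (phi n)) -> wmulti (fun w => phi (wdeg w) (bw w)).
Proof.
move=> lphi w1 w2 l l1 l2 c d1 d2 vl.
by rewrite -(wdeg_multi w1 w2 d1) -(wdeg_multi w1 w2 d2) (bw_multi w1 w2 d1 d2 vl) lphi.
Qed.

(** A given letter lies in exactly one of the two pieces of each cut, so linearity in that letter is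
    linearity of [phi] in one argument. *)
Lemma cuts_multi (M : lmodType k) (phi : int -> int -> bar A -> bar A -> M) :
  (forall m n y, linear (fun x => phi m n x y)) ->
  (forall m n x, linear (phi m n x)) ->
  wmulti (fun w => \sum_(p <- cuts w) phi (wdeg p.1) (wdeg p.2) (bw p.1) (bw p.2)).
Proof.
move=> phil phir w1 w2 l l1 l2 c d1 d2 vl.
rewrite !cuts_cat_cons !big_cat !big_map /= scalerDr addrACA !scaler_sumr -!big_split.
congr (_ + _); apply: eq_bigr => p _ /=.
  exact: (deg_multi (fun n => phir _ n _)).
exact: (deg_multi (fun m => phil m _ _)).
Qed.

End BarWords.

Section Bracket.
Variables (k : comNzRingType) (A : hga k).
Implicit Types (w : word A) (l : letter A) (a : A) (c : bar A).

Definition abar a : A := a - (aug a)%:A.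

Lemma abar_lin : linear abar.
Proof.
apply: lin_add; first exact: lin_id.
by apply: lin_opp; apply: lin_scalel; apply: aug_lin.
Qed.

Lemma abar_letter l : abar (lval l) = lval l.
Proof. by rewrite /abar laug scale0r subr0. Qed.

Lemma abar1 : abar 1 = 0.
Proof. by rewrite /abar rmorph1 scale1r subrr. Qed.

Lemma aug_abar a : aug (abar a) = 0.
Proof. exact: aug_bar. Qed.

Lemma abar_id a : aug a = 0 -> abar a = a.
Proof. by move=> a0; rewrite /abar a0 scale0r subr0. Qed.

Lemma abar_pA a : abar (pA a) = pA (abar a).
Proof.
rewrite /abar aug_pA (linB (@pA_lin k A)) (linZ (@pA_lin k A)) pA1 //.
Qed.

Lemma abar_diff a : abar (adiff a) = adiff a.
Proof. by rewrite abar_id ?adga_aug_diff. Qed.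

Lemma adiff_abar a : adiff (abar a) = adiff a.
Proof.
by rewrite /abar (linB (@adiff_lin k A)) (linZ (@adiff_lin k A)) adiff1 scaler0 subr0.
Qed.

(* brk a c is [abar|c_1|...|c_k].                                              *)
Definition brk a c : bar A := SS (tpure a c).

Let brk0 (a : A) (u : bar A) : bar A :=
  hext (fun x => plift (R := @bar_rel k A) (fun w => bw (lbar x :: w)) u) a.

Let lbar_multi (x : hel A) : wmulti (fun w => bw (lbar x :: w)).
Proof. by move=> w1 w2 l l1 l2 c d1 d2 vl; apply: (bw_multi (_ :: w1)). Qed.

Let lbar_hmulti u : hmulti (fun x : hel A => plift (R := @bar_rel k A) (fun w => bw (lbar x :: w))
  u).
Proof.
move=> x y z c dy dz vx; move: u; apply: bar_ext => [||w].
- exact: wlift_lin.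
- by apply: lin_add; [apply: lin_scale|]; apply: wlift_lin.
rewrite !wliftE //; apply: (bw_multi [::]) => //.
exact: (etrans (congr1 abar vx) (abar_lin _ _ _)).
Qed.

Let brk0_linl u : linear (fun a => brk0 a u).
Proof. exact: hext_lin. Qed.

Let brk0_linr a : linear (brk0 a).
Proof. by apply: lin_sum => x; apply: wlift_lin. Qed.

Lemma SS_lin : linear (@SS k A).
Proof. exact: tlift_lin brk0_linl brk0_linr. Qed.

Lemma brk_hel (x : hel A) w : brk (hval x) (bw w) = bw (lbar x :: w).
Proof. by rewrite /brk /SS (tliftE brk0_linl brk0_linr) /brk0 hextE ?wliftE. Qed.

Lemma brk_linl c : linear (fun a => brk a c).
Proof. exact: lin_comp SS_lin (tpure_linl _). Qed.

Lemma brk_linr a : linear (brk a).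
Proof. exact: lin_comp SS_lin (tpure_linr _). Qed.

Lemma bw_cons l w : bw (l :: w) = brk (lval l) (bw w).
Proof.
(* The letter [l] and the barred letter have equal degrees and values but are different records; the
   multilinearity relation with coefficient 0 identifies their words. *)
rewrite brk_hel -[RHS]add0r -(scale0r (bw (l :: w))).
apply: (bw_multi [::]) => //; rewrite scale0r add0r.
by rewrite [RHS](abar_letter l).
Qed.

Lemma brk_abar a c : brk (abar a) c = brk a c.
Proof.
move: a; apply: hel_ext => [||x].
- exact: lin_comp (brk_linl c) abar_lin.
- exact: brk_linl.
move: c; apply: bar_ext => [||w]; try exact: brk_linr.
by rewrite brk_hel bw_cons.
Qed.

Lemma brk1 c : brk 1 c = 0.
Proof. by rewrite -brk_abar abar1 (lin0 (brk_linl c)). Qed.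

Lemma brk_ind (P : bar A -> Prop) :
  P (bw [::]) -> (forall l w, P (bw w) -> P (brk (lval l) (bw w))) ->
  forall w, P (bw w).
Proof. by move=> P0 P1; elim=> [|l w IH] //; rewrite bw_cons; apply: P1. Qed.

Lemma word_ext (M : lmodType k) (F G : bar A -> M) : linear F -> linear G ->
  F (bw [::]) = G (bw [::]) ->
  (forall l w, F (bw w) = G (bw w) ->
    F (brk (lval l) (bw w)) = G (brk (lval l) (bw w))) ->
  forall c, F c = G c.
Proof.
move=> lF lG FG0 FG1; apply: bar_ext => // w.
exact: (@brk_ind (fun c => F c = G c)).
Qed.

End Bracket.

#[export] Hint Extern 1 (GRing.linear_for _ (abar (A:=_))) => exact: abar_lin : lin.
#[export] Hint Extern 1 (GRing.linear_for _ (SS (A:=_))) => exact: SS_lin : lin.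
#[export] Hint Extern 1 (GRing.linear_for _ (brk _)) => exact: brk_linr : lin.
#[export] Hint Extern 1 (GRing.linear_for _ (fun x => brk x _)) => exact: brk_linl : lin.

Section LeftAction.
Variables (k : comNzRingType) (A : algType k) (M : lmodType k).

Definition lact (x : A) : tens A M -> tens A M :=
  tlift (fun (a : A) m => tpure (x * a) m).

Let lact_linl x (m : M) : linear (fun a : A => tpure (x * a) m).
Proof. lin. Qed.
Let lact_linr x a : linear (fun m : M => tpure (x * a : A) m).
Proof. lin. Qed.

Lemma lact_linr_ x : linear (lact x).
Proof. exact: tlift_lin (lact_linl x) (lact_linr x). Qed.

Lemma lactE x a (m : M) : lact x (tpure a m) = tpure (x * a) m.
Proof. exact: tliftE (lact_linl x) (lact_linr x) a m. Qed.

Lemma lact_linl_ v : linear (fun x => lact x v).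
Proof.
move=> c x y; move: v; apply: tens_ext => [||a m].
- exact: lact_linr_.
- by apply: lin_add; [apply: lin_scale|]; apply: lact_linr_.
rewrite !lactE mulrDl -scalerAl; exact: tpure_linl.
Qed.

Lemma lact1 v : lact 1 v = v.
Proof.
move: v; apply: tens_ext => [||a m]; [exact: lact_linr_|by []|].
by rewrite lactE mul1r.
Qed.

Lemma lactA x y v : lact x (lact y v) = lact (x * y) v.
Proof.
move: v; apply: tens_ext => [||a m].
- by apply: lin_comp; apply: lact_linr_.
- exact: lact_linr_.
by rewrite !lactE mulrA.
Qed.

End LeftAction.

#[export] Hint Extern 1 (GRing.linear_for _ (lact _)) => exact: lact_linr_ : lin.
#[export] Hint Extern 1 (GRing.linear_for _ (fun x => lact x _)) => exact: lact_linl_ : lin.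

Section BarCoalgebra.
Variables (k : comNzRingType) (A : hga k).
Implicit Types (w : word A) (l : letter A) (a : A) (c : bar A).

Let eps_multi : @wmulti k A k^o (fun w => if w is [::] then 1 else 0).
Proof. by move=> [|x w1] w2 l l1 l2 c d1 d2 vl; rewrite /= scaler0 addr0. Qed.

Lemma bar_eps_lin : linear (@bar_eps k A : bar A -> k^o).
Proof. exact: wlift_lin eps_multi. Qed.

Lemma bar_eps_bw w : bar_eps (bw w) = if w is [::] then 1 else 0.
Proof. exact: wliftE eps_multi. Qed.

Lemma bar_eps1 : bar_eps (bw ([::] : word A)) = 1.
Proof. exact: bar_eps_bw. Qed.

Lemma bar_eps_brk a c : bar_eps (brk a c) = 0.
Proof.
move: a; apply: (@hel_ext k A k^o) => [||x]; [|exact: lin_zero|].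
  exact: lin_comp bar_eps_lin (brk_linl _).
move: c; apply: (@bar_ext k A k^o) => [||w]; [|exact: lin_zero|].
  exact: lin_comp bar_eps_lin (brk_linr _).
by rewrite brk_hel bar_eps_bw.
Qed.

Let uncons_multi : @wmulti k A (tens A (bar A))
  (fun w => if w is l :: w2 then tpure (lval l) (bw w2) else 0).
Proof.
move=> [|x w1] w2 l l1 l2 c d1 d2 vl /=.
  by rewrite vl; apply: tpure_linl.
by rewrite (bw_multi w1 w2 d1 d2 vl); apply: tpure_linr.
Qed.

(** Inverse to the bracket on words of positive length; by [uncons_delta] it is (t (x) 1) Delta. *)
Definition uncons : bar A -> tens A (bar A) :=
  plift (R := @bar_rel k A) (fun w => if w is l :: w2 then tpure (lval l) (bw w2) else 0).

Lemma uncons_lin : linear uncons.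
Proof. exact: wlift_lin uncons_multi. Qed.

Lemma uncons1 : uncons (bw [::]) = 0.
Proof. exact: wliftE uncons_multi. Qed.

Lemma uncons_brk a c : uncons (brk a c) = tpure (abar a) c.
Proof.
move: a; apply: hel_ext => [||x].
- exact: lin_comp uncons_lin (brk_linl _).
- exact: lin_comp (tpure_linl _) (@abar_lin _ _).
move: c; apply: bar_ext => [||w]; [|exact: tpure_linr|].
  exact: lin_comp uncons_lin (brk_linr _).
by rewrite brk_hel; apply: wliftE uncons_multi.
Qed.

(** Splits off the part of length 0. With [uncons_delta] this reads c = eps(c) [ ] + [t(c') | c''],
    so the counit and (t (x) 1) Delta together determine c. *)
Lemma bar_decomp c : c = bar_eps c *: bw [::] + SS (uncons c).
Proof.
apply: (word_ext (F := id) (G := fun c => bar_eps c *: bw [::] + SS (uncons c))).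
- by [].
- apply: lin_add; first by apply: lin_scalel; apply: bar_eps_lin.
  by apply: lin_comp; [lin|apply: uncons_lin].
- by rewrite bar_eps1 scale1r uncons1 (lin0 (@SS_lin k A)) addr0.
move=> l w _; rewrite bar_eps_brk scale0r add0r uncons_brk abar_letter //.
Qed.

Let t_multi : @wmulti k A A (fun w => if w is [:: l] then lval l else 0).
Proof.
move=> [|x [|y w1]] [|z w2] l l1 l2 c d1 d2 vl //=; rewrite ?scaler0 ?addr0 //.
Qed.

Lemma bar_t_lin : linear (@bar_t k A).
Proof. exact: wlift_lin t_multi. Qed.

Lemma bar_t_bw w : bar_t (bw w) = if w is [:: l] then lval l else 0.
Proof. exact: wliftE t_multi. Qed.

Lemma bar_t1 : bar_t (bw ([::] : word A)) = 0.
Proof. exact: bar_t_bw. Qed.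

Lemma bar_t_brk a c : bar_t (brk a c) = bar_eps c *: abar a.
Proof.
move: a; apply: hel_ext => [||x].
- exact: lin_comp bar_t_lin (brk_linl _).
- exact: lin_scale (@abar_lin _ _).
move: c; apply: bar_ext => [||w].
- exact: lin_comp bar_t_lin (brk_linr _).
- by apply: lin_scalel; apply: bar_eps_lin.
rewrite brk_hel bar_t_bw bar_eps_bw.
by case: w => [|l w]; rewrite ?scale1r ?scale0r.
Qed.

Lemma aug_bar_t c : aug (bar_t c) = 0.
Proof.
move: c; apply: (@word_ext k A k^o) => [||| l w _].
- exact: lin_comp (@aug_lin k A) bar_t_lin.
- exact: lin_zero.
- by rewrite bar_t1 rmorph0.
by rewrite bar_t_brk linearZ /= aug_abar mulr0.
Qed.

Lemma bar_pr_lin p : linear (@bar_pr k A p).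
Proof.
apply: wlift_lin; apply: (@deg_multi _ _ _ (fun n x => if n == p then x else 0)).
by move=> n; apply: lin_if; lin.
Qed.

Lemma bar_pr_bw p w : bar_pr p (bw w) = if wdeg w == p then bw w else 0.
Proof.
apply: (@wliftE _ _ _ (fun w => if wdeg w == p then bw w else 0)).
apply: (@deg_multi _ _ _ (fun n x => if n == p then x else 0)).
by move=> n; apply: lin_if; lin.
Qed.

Let pC_multi : wmulti (fun w => sg (wdeg w) *: bw w).
Proof. by apply: (@deg_multi _ _ _ (fun n x => sg n *: x)) => n; apply: lin_scale. Qed.

Definition pC : bar A -> bar A := plift (R := @bar_rel k A) (fun w => sg (wdeg w) *: bw w).

Lemma pC_lin : linear pC.
Proof. exact: wlift_lin. Qed.

Lemma pC_bw w : pC (bw w) = sg (wdeg w) *: bw w.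
Proof. exact: wliftE. Qed.

Lemma pC_homog p c : homog (@bar_pr k A) p c -> pC c = sg p *: c.
Proof.
rewrite /homog => <-; move: c; apply: bar_ext => [||w].
- exact: lin_comp pC_lin (bar_pr_lin p).
- exact: lin_scale (bar_pr_lin p).
rewrite bar_pr_bw; case: eqP => [<-|_]; first exact: pC_bw.
by rewrite (lin0 pC_lin) scaler0.
Qed.

Lemma pC1 : pC (bw [::]) = bw [::].
Proof. by rewrite pC_bw wdeg_nil scale1r. Qed.

Lemma pC_brk a c : pC (brk a c) = - brk (pA a) (pC c).
Proof.
move: a; apply: hel_ext => [||x].
- exact: lin_comp pC_lin (brk_linl _).
- exact: lin_opp (lin_comp (brk_linl _) (@pA_lin _ _)).
move: c; apply: bar_ext => [||w].
- exact: lin_comp pC_lin (brk_linr _).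
- exact: lin_opp (lin_comp (brk_linr _) pC_lin).
rewrite brk_hel !pC_bw wdeg_cons pA_hel (linZ (brk_linr _)) (linZ (brk_linl _)).
by rewrite brk_hel scalerA -scaleNr; congr (_ *: _); rewrite /ldeg /=; sgn.
Qed.

Lemma homog_bw w : homog (@bar_pr k A) (wdeg w) (bw w).
Proof. by rewrite /homog bar_pr_bw eqxx. Qed.

Lemma delta_sum_multi :
  wmulti (fun w => \sum_(p <- cuts w) tpure (bw p.1) (bw p.2)).
Proof. by apply: (@cuts_multi _ _ _ (fun _ _ x y => tpure x y)) => *; lin. Qed.

Let bar_deltaE c : bar_delta c =
  plift (R := @bar_rel k A) (fun w => \sum_(p <- cuts w) tpure (bw p.1) (bw p.2)) c.
Proof.
apply: wlift_ext; first exact: wlift_lin delta_sum_multi.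
move=> w; rewrite (wliftE _ delta_sum_multi).
exact: (sum_cuts w (fun w1 w2 => tpure (bw w1) (bw w2))).
Qed.

Lemma bar_delta_lin : linear (@bar_delta k A).
Proof.
move=> c x y; rewrite !bar_deltaE; exact: (wlift_lin delta_sum_multi).
Qed.

Lemma bar_delta_bw w :
  bar_delta (bw w) = \sum_(p <- cuts w) tpure (bw p.1) (bw p.2).
Proof. by rewrite bar_deltaE (wliftE _ delta_sum_multi). Qed.

End BarCoalgebra.

#[export] Hint Extern 1 (GRing.linear_for _ bar_eps) => exact: bar_eps_lin : lin.
#[export] Hint Extern 1 (GRing.linear_for _ (uncons (A:=_))) => exact: uncons_lin : lin.
#[export] Hint Extern 1 (GRing.linear_for _ (bar_t (A:=_))) => exact: bar_t_lin : lin.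
#[export] Hint Extern 1 (GRing.linear_for _ (bar_pr _)) => exact: bar_pr_lin : lin.
#[export] Hint Extern 1 (GRing.linear_for _ (pC (A:=_))) => exact: pC_lin : lin.
#[export] Hint Extern 1 (GRing.linear_for _ (bar_delta (A:=_))) => exact: bar_delta_lin : lin.

Section BarDifferential.
Variables (k : comNzRingType) (A : hga k).
Implicit Types (w : word A) (l : letter A) (a : A) (c : bar A).

(** Replaces the sums over positions by a recursion on the first letter. In the last term [uncons]
    supplies the second letter, which is merged with the first. *)
Lemma word_diff_cons l w : word_diff (l :: w) =
  - brk (adiff (lval l)) (bw w) - brk (pA (lval l)) (word_diff w)
  - SS (lact (pA (lval l)) (uncons (bw w))).
Proof.
have pl : pA (lval l) = sg (ldeg l) *: lval l by exact: pA_hel.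
have sl : sg (ldeg l - 1) = - sg (ldeg l) :> k by sgn.
rewrite pl (linZ (brk_linl _)) (linZ (lact_linl_ _)) (linZ (@SS_lin k A)).
rewrite /word_diff big_ord_recl [X in _ + X = _]big_ord_recl /=.
rewrite wdeg_nil sg0 scale1r bw_cons (linD (brk_linr _)) scalerDr opprD.
rewrite [X in _ + _ + X = _]addrC !addrA; congr (_ + _ + _ + _).
- rewrite (lin_sumE (brk_linr _)) scaler_sumr -sumrN; apply: eq_bigr => i _.
  rewrite /= add0n; case: (drop i w) => [|l0 w2]; first by rewrite (lin0 (brk_linr _)) scaler0
    oppr0.
  rewrite (linN (brk_linr _)) (linZ (brk_linr _)) -bw_cons wdeg_cons sgD sl.
  by rewrite scalerN opprK scalerA mulNr scaleNr opprK.
- rewrite (lin_sumE (brk_linr _)) scaler_sumr -sumrN; apply: eq_bigr => i _.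
  rewrite /= /bump /= add0n; case: (drop i w) => [|l0 [|l1 w2]].
  + by rewrite (lin0 (brk_linr _)) scaler0 oppr0.
  + by rewrite (lin0 (brk_linr _)) scaler0 oppr0.
  rewrite (linZ (brk_linr _)) -bw_cons wdeg_cons sgD sl.
  by rewrite scalerA mulNr scaleNr.
case: w => [|l2 w2]; first by rewrite uncons1 !(lin0 (lact_linr_ _), lin0 (@SS_lin k A)) scaler0
  oppr0.
rewrite [bw (l2 :: w2)]bw_cons uncons_brk lactE abar_letter bw_cons.
by rewrite wdeg_cons wdeg_nil addr0 sl scaleNr.
Qed.

Let word_diff_multi : wmulti (@word_diff k A).
Proof.
elim=> [|x w1 IH] w2 l l1 l2 c d1 d2 vl.
  rewrite !cat0s !word_diff_cons vl.
  have L : linear (fun a : A => - brk (adiff a) (bw w2) - brk (pA a) (word_diff w2)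
    - SS (lact (pA a) (uncons (bw w2)))) by lin.
  exact: L.
rewrite !cat_cons !word_diff_cons (IH w2 l l1 l2 c d1 d2 vl) (bw_multi w1 w2 d1 d2 vl).
rewrite (brk_linr (adiff _)) (brk_linr (pA _)) (uncons_lin _ _) (lact_linr_ _ _) (SS_lin _).
by rewrite !opprD !scalerDr !scalerN; rewrite [RHS]addrACA; congr (_ + _); rewrite addrACA.
Qed.

Lemma bar_diff_lin : linear (@bar_diff k A).
Proof. exact: wlift_lin word_diff_multi. Qed.

Lemma bar_diff1 : bar_diff (bw ([::] : word A)) = 0.
Proof. by rewrite /bar_diff (wliftE _ word_diff_multi) /word_diff !big_ord0 addr0. Qed.

(** The first two brackets ignore multiples of 1, but in the last term a is multiplied with the next
    letter before the bracket is formed; hence [abar a] there. *)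
Lemma bar_diff_brk a c : bar_diff (brk a c) = - brk (adiff a) c
  - brk (pA a) (bar_diff c) - SS (lact (pA (abar a)) (uncons c)).
Proof.
have ld := bar_diff_lin.
move: a; apply: hel_ext => [||x].
- exact: lin_comp ld (brk_linl _).
- lin.
move: c; apply: bar_ext => [||w].
- exact: lin_comp ld (brk_linr _).
- lin.
rewrite brk_hel /bar_diff !(wliftE _ word_diff_multi) word_diff_cons.
rewrite -[lval (lbar x)]/(abar (hval x)) adiff_abar.
by rewrite -[in X in _ - X - _ = _]abar_pA brk_abar.
Qed.

End BarDifferential.
#[export] Hint Extern 1 (GRing.linear_for _ (bar_diff (A:=_))) => exact: bar_diff_lin : lin.

Section TensorMap.
Variables (k : comNzRingType) (V V' W W' : lmodType k).

Definition tmap (f : V -> V') (g : W -> W') : tens V W -> tens V' W' :=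
  tlift (fun x y => tpure (f x) (g y)).

Lemma tmap_lin f g : linear f -> linear g -> linear (tmap f g).
Proof. by move=> lf lg; apply: tlift_lin => z; lin. Qed.

Lemma tmapE f g x y : linear f -> linear g ->
  tmap f g (tpure x y) = tpure (f x) (g y).
Proof. by move=> lf lg; apply: (@tliftE _ _ _ _ (fun x y => tpure (f x) (g y))) => z; lin. Qed.

End TensorMap.

#[export] Hint Extern 1 (GRing.linear_for _ (tmap _ _)) => (apply: tmap_lin; lin) : lin.

Section HomogClosure.
Variables (k : comNzRingType) (V : lmodType k) (pr : int -> V -> V) (p : int).
Hypothesis lpr : linear (pr p).

Lemma homog0 : homog pr p 0.
Proof. exact: (lin0 lpr). Qed.

Lemma homogD x y : homog pr p x -> homog pr p y -> homog pr p (x + y).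
Proof. by rewrite /homog (linD lpr) => -> ->. Qed.

Lemma homogZ c x : homog pr p x -> homog pr p (c *: x).
Proof. by rewrite /homog (linZ lpr) => ->. Qed.

Lemma homogN x : homog pr p x -> homog pr p (- x).
Proof. by rewrite /homog (linN lpr) => ->. Qed.

End HomogClosure.

Section BarDifferentialFacts.
Variables (k : comNzRingType) (A : hga k).
Implicit Types (w : word A) (l : letter A) (a : A) (c : bar A).

Lemma homog_bar_diff w : homog (@bar_pr k A) (wdeg w + 1) (bar_diff (bw w)).
Proof.
have lp := @bar_pr_lin k A; elim: w => [|l w IH].
  by rewrite bar_diff1; apply: homog0.
rewrite bw_cons bar_diff_brk abar_letter.
have -> : pA (lval l) = sg (ldeg l) *: lval l by exact: pA_hel.
rewrite !(linZ (brk_linl _)) (linZ (lact_linl_ _)) (linZ (@SS_lin k A)).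
have hl : homog (@bar_pr k A) (wdeg (l :: w) + 1) (brk (lval l) (bar_diff (bw w))).
  move: IH; set x := bar_diff _; rewrite /homog => <-; move: x; apply: bar_ext => [||v]; try lin.
  rewrite bar_pr_bw; case: eqP => [e|_].
    by rewrite -bw_cons bar_pr_bw !wdeg_cons e addrA eqxx.
  by rewrite (lin0 (brk_linr _)) (lin0 (lp _)).
rewrite -[brk (adiff (lval l)) _](bw_cons (ldiff l) w).
apply: homogD => //; last apply: homogN => //; last apply: homogZ => //.
  apply: homogD => //; apply: homogN => //; last exact: homogZ.
  have -> : wdeg (l :: w) + 1 = wdeg (ldiff l :: w).
    rewrite !wdeg_cons -[ldeg (ldiff l)]/(ldeg l + 1); lia.
  exact: homog_bw.
case: w {IH hl} => [|m w].
  by rewrite uncons1 (lin0 (lact_linr_ _)) (lin0 (@SS_lin k A)); apply: homog0.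
rewrite bw_cons uncons_brk abar_letter lactE -[SS _](bw_cons (lmul l m) w).
have -> : wdeg [:: l, m & w] + 1 = wdeg (lmul l m :: w).
  rewrite !wdeg_cons -[ldeg (lmul l m)]/(ldeg l + ldeg m); lia.
exact: homog_bw.
Qed.

Lemma bar_diff_pC c : bar_diff (pC c) = - pC (bar_diff c).
Proof.
move: c; apply: bar_ext => [||w]; try lin.
rewrite pC_bw (linZ (@bar_diff_lin k A)) (pC_homog (homog_bar_diff w)) -scaleNr.
by congr (_ *: _); sgn.
Qed.

Lemma bar_eps_SS v : bar_eps (SS v : bar A) = 0.
Proof.
move: v; apply: (@tens_ext k _ _ k^o) => [||a c]; last exact: (bar_eps_brk a c).
- exact: lin_comp (@bar_eps_lin k A) (@SS_lin k A).
- exact: lin_zero.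
Qed.

Lemma bar_eps_diff c : bar_eps (bar_diff c) = 0.
Proof.
move: c; apply: (@word_ext k A k^o) => [|||l w _].
- exact: lin_comp (@bar_eps_lin k A) (@bar_diff_lin k A).
- exact: lin_zero.
- by rewrite bar_diff1 (lin0 (@bar_eps_lin k A)).
rewrite bar_diff_brk !(linB (@bar_eps_lin k A)) (linN (@bar_eps_lin k A)).
by rewrite !bar_eps_brk bar_eps_SS !subr0 oppr0.
Qed.

Lemma uncons_SS_lact a v : aug a = 0 -> uncons (SS (lact a v) : bar A) = lact a v.
Proof.
move=> a0; move: v; apply: tens_ext => [||b c]; try lin.
by rewrite lactE uncons_brk abar_id // rmorphM /= a0 mul0r.
Qed.

(* The differential of B(A, A, k).                                             *)
Definition diffP : tens A (bar A) -> tens A (bar A) :=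
  tlift (fun a c => tpure (adiff a) c + tpure (pA a) (bar_diff c)
                    + lact (pA a) (uncons c)).

Let diffP_linl c : linear (fun a : A => tpure (adiff a) c + tpure (pA a) (bar_diff c)
                    + lact (pA a) (uncons c)).
Proof. lin. Qed.
Let diffP_linr a : linear (fun c => tpure (adiff a) c + tpure (pA a) (bar_diff c)
                    + lact (pA a) (uncons c)).
Proof. lin. Qed.

Lemma diffP_lin : linear diffP.
Proof. exact: tlift_lin. Qed.

Lemma diffPE a c : diffP (tpure a c) =
  tpure (adiff a) c + tpure (pA a) (bar_diff c) + lact (pA a) (uncons c).
Proof. exact: tliftE. Qed.

Lemma diffP_lact a v : diffP (lact a v) = lact (adiff a) v + lact (pA a) (diffP v).
Proof.
move: v; apply: tens_ext => [||b c].
- exact: lin_comp diffP_lin (lact_linr_ _).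
- by apply: lin_add; [lin|exact: lin_comp (lact_linr_ _) diffP_lin].
rewrite !lactE !diffPE !(linD (lact_linr_ _)) !lactE adiff_mul pA_mul.
by rewrite (linD (tpure_linl _)) lactA !addrA.
Qed.

Lemma uncons_diff c : uncons (bar_diff c) = - diffP (uncons c).
Proof.
have lP := diffP_lin.
move: c; apply: (@word_ext k A) => [|||l w _]; try lin.
  by rewrite bar_diff1 uncons1 (lin0 (@uncons_lin k A)) (lin0 lP) oppr0.
rewrite bar_diff_brk uncons_brk diffPE abar_letter !(linB (@uncons_lin k A)).
rewrite (linN (@uncons_lin k A)) !uncons_brk uncons_SS_lact ?aug_pA ?laug //.
by rewrite abar_diff abar_pA abar_letter !opprD.
Qed.

(** The defect by which S fails to anticommute with the differentials, see [bar_diff_SS]; it stems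
    from the bar on the first letter. *)
Definition cancel : tens A (bar A) -> bar A :=
  tlift (fun a c => aug a *: (c - bar_eps c *: bw [::])).

Let cancel_linl c : linear (fun a : A => aug a *: (c - bar_eps c *: bw [::])).
Proof. by apply: lin_scalel; apply: aug_lin. Qed.
Let cancel_linr (a : A) : linear (fun c => aug a *: (c - bar_eps c *: bw [::])).
Proof.
apply: lin_scale; apply: lin_add; first exact: lin_id.
by apply: lin_opp; apply: lin_scalel; apply: bar_eps_lin.
Qed.

Lemma cancel_lin : linear cancel.
Proof. exact: tlift_lin. Qed.

Lemma cancelE a c : cancel (tpure a c) = aug a *: (c - bar_eps c *: bw [::]).
Proof. exact: tliftE. Qed.

Lemma cancel_lact a v : aug a = 0 -> cancel (lact a v) = 0.
Proof.
have lc := cancel_lin.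
move=> a0; move: v; apply: tens_ext => [||b c]; try lin.
by rewrite lactE cancelE rmorphM /= a0 mul0r scale0r.
Qed.

Lemma bar_diff_SS v : bar_diff (SS v) = - SS (diffP v) + cancel v.
Proof.
have lP := diffP_lin; have lc := cancel_lin.
move: v; apply: tens_ext => [||a c]; try lin.
rewrite diffPE cancelE -[SS (tpure a c)]/(brk a c) bar_diff_brk.
rewrite !(linD (@SS_lin k A)) -!/(brk _ _).
have E : SS (uncons c) = c - bar_eps c *: bw [::].
  by rewrite {2}[c]bar_decomp addrC addKr.
rewrite -E /abar (linB (@pA_lin k A)) (linZ (@pA_lin k A)) pA1.
rewrite (linB (lact_linl_ _)) (linZ (lact_linl_ _)) lact1.
by rewrite (linB (@SS_lin k A)) (linZ (@SS_lin k A)) !opprD opprK !addrA.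
Qed.

(** Since [l|w] is S(l (x) w) and S anticommutes with the differentials up to [cancel], the square
    of [diffP] on l (x) w is what matters; it reduces to d^2 = 0 on A and, by induction, on w. The
    defect vanishes because l, d l and their multiples have augmentation 0. *)
Lemma bar_diff2 c : bar_diff (bar_diff c) = 0.
Proof.
have lP := diffP_lin; have ld := @bar_diff_lin k A; have lc := cancel_lin.
move: c; apply: (@word_ext k A) => [|||l w IH]; try lin.
  by rewrite bar_diff1 (lin0 ld).
have -> : bar_diff (brk (lval l) (bw w)) = - SS (diffP (tpure (lval l) (bw w))).
  rewrite bar_diff_brk diffPE abar_letter !(linD (@SS_lin k A)) -!/(brk _ _).
  by rewrite !opprD.
rewrite (linN ld) bar_diff_SS.
have -> : diffP (diffP (tpure (lval l) (bw w))) = 0.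
  rewrite diffPE !(linD lP) !diffPE diffP_lact (cx_square (adga_complex A)) IH.
  rewrite adiff_pA pAK uncons_diff (lin0 (tpure_linl _)) (lin0 (tpure_linr _)).
  rewrite !(linN (lact_linr_ _)) (linN (tpure_linl _)) (linN (lact_linl_ _)) add0r addr0.
  abel.
rewrite (lin0 (@SS_lin k A)) diffPE !(linD lc) !cancelE cancel_lact ?aug_pA ?laug //.
by rewrite adga_aug_diff ?aug_pA ?laug !scale0r !addr0 !oppr0 ?addr0.
Qed.

End BarDifferentialFacts.

Section DeltaFacts.
Variables (k : comNzRingType) (A : hga k).
Implicit Types (w : word A) (l : letter A) (a : A) (c : bar A).

Lemma bar_delta1 : bar_delta (bw [::] : bar A) = tpure (bw [::]) (bw [::]).
Proof. by rewrite bar_delta_bw cuts_nil big_seq1. Qed.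

Lemma bar_delta_brk a c :
  bar_delta (brk a c) = tpure (bw [::]) (brk a c) + tmap (brk a) id (bar_delta c).
Proof.
move: a; apply: hel_ext => [||x].
- by lin.
- apply: lin_add; first lin.
  move=> d x y; move: (bar_delta c); apply: tens_ext => [||p q]; try lin.
  rewrite !tmapE; try lin; rewrite brk_linl; exact: tpure_linl.
move: c; apply: bar_ext => [||w]; try lin.
rewrite brk_hel !bar_delta_bw cuts_cons big_cons big_map /=; congr (_ + _).
rewrite (lin_sumE (tmap_lin _ _)); try lin.
by apply: eq_bigr => p _; rewrite tmapE; try lin; rewrite brk_hel.
Qed.

(** Only the cut after the first letter survives t. *)
Lemma uncons_delta c : uncons c = tmap (@bar_t k A) id (bar_delta c).
Proof.
move: c; apply: bar_ext => [||[|l w]]; try lin.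
  by rewrite uncons1 bar_delta1 tmapE; try lin; rewrite bar_t1 (lin0 (tpure_linl _)).
rewrite bw_cons bar_delta_brk (linD (tmap_lin _ _)); try lin.
rewrite uncons_brk tmapE; try lin; rewrite bar_t1 (lin0 (tpure_linl _)) add0r.
have lt : linear (fun D => tmap (@bar_t k A) id (tmap (brk (lval l)) id D)) by lin.
rewrite bar_delta_bw (lin_sumE (lt _)).
have /= -> := @sum_cuts_nil _ _ w (fun v1 v2 =>
  tmap (@bar_t k A) id (tmap (brk (lval l)) id (tpure (bw v1) (bw v2)))).
  by rewrite !tmapE; try lin; rewrite bar_t_brk bar_eps1 scale1r.
move=> x v1 v2; rewrite !tmapE; try lin.
by rewrite bar_t_brk bar_eps_bw scale0r (lin0 (tpure_linl _)).
Qed.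

(** Multiplying the first letter of c by a does not affect the cuts behind that letter, and the
    empty prefix of c drops out because [uncons] vanishes on it. *)
Lemma delta_SS_uncons (a : A) c :
  bar_delta (SS (lact a (uncons c)) : bar A) = tpure (bw [::]) (SS (lact a (uncons c)))
    + tmap (fun p => SS (lact a (uncons p))) id (bar_delta c).
Proof.
move: c; apply: (@word_ext k A) => [|||l w _]; try lin.
  rewrite uncons1 !(lin0 (@lact_linr_ _ _ _ a), lin0 (@SS_lin k A)) bar_delta1.
  rewrite tmapE; try lin; rewrite uncons1 !(lin0 (@lact_linr_ _ _ _ a), lin0 (@SS_lin k A)).
  by rewrite (lin0 (@bar_delta_lin k A)) (lin0 (tpure_linr _)) (lin0 (tpure_linl _)) addr0.
rewrite uncons_brk lactE abar_letter -[SS _]/(brk _ _) !bar_delta_brk; congr (_ + _).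
rewrite (linD (tmap_lin _ _)); try lin; rewrite tmapE; try lin.
rewrite uncons1 !(lin0 (@lact_linr_ _ _ _ a), lin0 (@SS_lin k A)) (lin0 (tpure_linl _)) add0r.
move: (bar_delta _); apply: tens_ext => [||p q]; try lin.
by rewrite !tmapE; try lin; rewrite uncons_brk lactE abar_letter.
Qed.

Lemma bar_delta_diff c : bar_delta (bar_diff c) =
  tmap (@bar_diff k A) id (bar_delta c) + tmap (@pC k A) (@bar_diff k A) (bar_delta c).
Proof.
move: c; apply: (@word_ext k A) => [|||l w IH]; try lin.
  rewrite bar_diff1 bar_delta1 !tmapE; try lin.
  by rewrite bar_diff1 (lin0 (@bar_delta_lin k A)) (lin0 (tpure_linl _)) (lin0 (tpure_linr _))
    addr0.
rewrite {1}bar_diff_brk !(linB (@bar_delta_lin k A)) (linN (@bar_delta_lin k A)).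
rewrite abar_letter delta_SS_uncons !bar_delta_brk IH !(linD (tmap_lin _ _)); try lin.
rewrite !tmapE; try lin; rewrite bar_diff1 pC1 (lin0 (tpure_linl _)) bar_diff_brk abar_letter.
rewrite !(linB (tpure_linr _)) (linN (tpure_linr _)).
move: (bar_delta (bw w)) => D.
have -> : tmap (@bar_diff k A) id (tmap (brk (lval l)) id D) =
    - tmap (brk (adiff (lval l))) id D
    - tmap (brk (pA (lval l))) id (tmap (@bar_diff k A) id D)
    - tmap (fun p => SS (lact (pA (lval l)) (uncons p))) id D.
  move: D; apply: tens_ext => [||p q]; try lin.
  rewrite !tmapE; try lin; rewrite bar_diff_brk abar_letter.
  by rewrite !(linB (tpure_linl _)) (linN (tpure_linl _)).
have -> : tmap (@pC k A) (@bar_diff k A) (tmap (brk (lval l)) id D) =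
    - tmap (brk (pA (lval l))) id (tmap (@pC k A) (@bar_diff k A) D).
  move: D; apply: tens_ext => [||p q]; try lin.
  by rewrite !tmapE; try lin; rewrite pC_brk (linN (tpure_linl _)).
abel.
Qed.

Lemma bar_t_pC c : bar_t (pC c) = - pA (bar_t c).
Proof.
move: c; apply: (@word_ext k A) => [|||l w _]; try lin.
  by rewrite pC1 !bar_t1 (lin0 (@pA_lin k A)) oppr0.
rewrite pC_brk (linN (@bar_t_lin k A)) !bar_t_brk (linZ (@pA_lin k A)) abar_pA.
congr (- (_ *: _)); rewrite pC_bw (linZ (@bar_eps_lin k A)) bar_eps_bw.
by case: w => [|x w]; rewrite ?wdeg_nil ?scale1r ?scaler0.
Qed.

(** The cup square of t before composition with the diagonal; [pC] is the Koszul sign of moving the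
    second t past the first factor. *)
Definition cup : tens (bar A) (bar A) -> A :=
  tlift (fun p q => bar_t (pC p) * bar_t q).

Let cup_linl q : linear (fun p => bar_t (pC p) * bar_t q : A).
Proof. lin. Qed.
Let cup_linr p : linear (fun q => bar_t (pC p) * bar_t q : A).
Proof. lin. Qed.

Lemma cup_lin : linear cup.
Proof. exact: tlift_lin. Qed.

Lemma cupE p q : cup (tpure p q) = bar_t (pC p) * bar_t q.
Proof. exact: tliftE. Qed.

Lemma cup_uncons c : cup (bar_delta c) =
  - tlift (fun (a : A) c => pA a * bar_t c) (uncons c).
Proof.
have lc := cup_lin.
have ll q : linear (fun a : A => pA a * bar_t q) by lin.
have lr a : linear (fun q : bar A => pA a * bar_t q) by lin.
have lt := tlift_lin ll lr.
rewrite uncons_delta; move: (bar_delta c); apply: tens_ext => [||p q]; try lin.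
by rewrite cupE tmapE; try lin; rewrite tliftE // bar_t_pC mulNr.
Qed.

(** The twisting cochain equation. On [l] the two terms with d l cancel, on [l|m] both sides are the
    signed product of l and m, and all other words give 0. Applied to products in BA it yields the
    rules for braces below. *)
Lemma bar_t_twisting c : adiff (bar_t c) + bar_t (bar_diff c) = cup (bar_delta c).
Proof.
rewrite cup_uncons.
have ll q : linear (fun a : A => pA a * bar_t q) by lin.
have lr a : linear (fun q : bar A => pA a * bar_t q) by lin.
have lt := tlift_lin ll lr.
move: c; apply: (@word_ext k A) => [|||l w _]; try lin.
  rewrite bar_t1 bar_diff1 uncons1 (lin0 (@bar_t_lin k A)) (lin0 lt).
  by rewrite (lin0 (@adiff_lin k A)) addr0 oppr0.
rewrite bar_diff_brk !(linB (@bar_t_lin k A)) (linN (@bar_t_lin k A)) uncons_brk.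
rewrite tliftE // !bar_t_brk bar_eps_diff scale0r subr0 abar_diff abar_letter.
rewrite (linZ (@adiff_lin k A)) addrA addrN sub0r; congr (- _).
case: w => [|m w]; first by rewrite uncons1 bar_t1 (lin0 (lact_linr_ _)) (lin0 (@SS_lin k A))
  mulr0 (lin0 (@bar_t_lin k A)).
rewrite bw_cons uncons_brk lactE -[SS _]/(brk _ _) !bar_t_brk abar_letter -scalerAr.
by rewrite abar_id // rmorphM /= aug_pA laug mul0r.
Qed.

End DeltaFacts.

(** * Braces *)

Section HgaProduct.
Variables (k : comNzRingType) (A : hga k).
Implicit Types (w v : word A) (l : letter A) (a : A) (x y : bar A).

Lemma bmul_linl y : linear (fun x : bar A => bmul x y).
Proof. exact: hga_linl (hgaP A) y. Qed.

Lemma bmul_linr x : linear (bmul x : bar A -> bar A).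
Proof. exact: hga_linr (hgaP A) x. Qed.

Lemma bmulA : associative (@bmul k A).
Proof. exact: hga_assoc (hgaP A). Qed.

Lemma bmul1x x : bmul (bw [::]) x = x.
Proof. exact: hga_unitl (hgaP A) x. Qed.

Lemma bmulx1 x : bmul x (bw [::]) = x.
Proof. exact: hga_unitr (hgaP A) x. Qed.

Lemma bar_eps_mul x y : bar_eps (bmul x y) = bar_eps x * bar_eps y.
Proof. exact: hga_eps (hgaP A) x y. Qed.

Lemma homog_bmul v w : homog (@bar_pr k A) (wdeg v + wdeg w) (bmul (bw v) (bw w)).
Proof. exact: hga_deg (hgaP A) v w. Qed.

End HgaProduct.

#[export] Hint Extern 1 (GRing.linear_for _ (bmul _)) => exact: bmul_linr : lin.
#[export] Hint Extern 1 (GRing.linear_for _ (fun x => bmul x _)) => exact: bmul_linl : lin.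

Section Brace.
Variables (k : comNzRingType) (A : hga k).
Implicit Types (w v : word A) (l : letter A) (a : A) (x y : bar A).

Lemma pC_mul x y : pC (bmul x y) = bmul (pC x) (pC y).
Proof.
move: x; apply: bar_ext => [||v]; try lin.
move: y; apply: bar_ext => [||w]; try lin.
rewrite (pC_homog (homog_bmul v w)) !pC_bw (linZ (bmul_linl _)) (linZ (bmul_linr _)).
by rewrite scalerA sgD.
Qed.

Lemma bar_diff_mul x y :
  bar_diff (bmul x y) = bmul (bar_diff x) y + bmul (pC x) (bar_diff y).
Proof.
move: x; apply: bar_ext => [||v]; try lin.
move: y; apply: bar_ext => [||w]; try lin.
by rewrite pC_bw (linZ (bmul_linl _)); apply: hga_diff (hgaP A) v w.
Qed.

Lemma bar_delta_mul v w : bar_delta (bmul (bw v) (bw w)) =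
  \sum_(p <- cuts v) \sum_(q <- cuts w) sg (wdeg p.2 * wdeg q.1) *:
    tpure (bmul (bw p.1) (bw q.1)) (bmul (bw p.2) (bw q.2)).
Proof.
rewrite (hga_delta (hgaP A)).
rewrite (sum_cuts v (fun v1 v2 => \sum_(j < (size w).+1)
  sg (wdeg v2 * wdeg (take j w)) *: tpure (bmul (bw v1) (bw (take j w)))
     (bmul (bw v2) (bw (drop j w))))).
apply: eq_bigr => p _.
exact: (sum_cuts w (fun w1 w2 => sg (wdeg p.2 * wdeg w1) *:
  tpure (bmul (bw p.1) (bw w1)) (bmul (bw p.2) (bw w2)))).
Qed.

Lemma E_long a b x y : bar_t (bmul (brk a (brk b x)) y) = 0.
Proof.
move: a; apply: (@hel_ext k A A) => [||a']; try lin.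
move: b; apply: (@hel_ext k A A) => [||b']; try lin.
move: x; apply: (@bar_ext k A A) => [||v]; try lin.
move: y; apply: (@bar_ext k A A) => [||w]; try lin.
by rewrite !brk_hel; apply: hga_E (hgaP A) _ _ _.
Qed.

(* The brace E([abar], y) + eps(a) eps(y), for which br_mul makes A a right    *)
(* module over the algebra BA.                                                 *)
Definition br a y : A :=
  locked (bar_t (bmul (brk a (bw [::])) y) + (bar_eps y * aug a) *: 1).

Lemma brE a y :
  br a y = bar_t (bmul (brk a (bw [::])) y) + (bar_eps y * aug a) *: 1.
Proof. by rewrite /br -lock. Qed.

Lemma br_linl y : linear (fun a => br a y).
Proof.
move=> c a b; rewrite !brE; move: c a b; apply: lin_add; first lin.
apply: lin_scalel => c a b; rewrite linearP mulrDr; congr (_ + _).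
exact: mulrCA.
Qed.

Lemma br_linr a : linear (br a).
Proof.
move=> c x y; rewrite !brE; move: c x y; apply: lin_add; first lin.
apply: lin_scalel => c x y.
rewrite (bar_eps_lin c x y : bar_eps _ = c * bar_eps x + bar_eps y) mulrDl; congr (_ + _).
exact: esym (mulrA _ _ _).
Qed.

Lemma br1 y : br 1 y = bar_eps y *: 1.
Proof.
by rewrite brE brk1 (lin0 (bmul_linl _)) (lin0 (@bar_t_lin k A)) rmorph1 add0r mulr1.
Qed.

Lemma br_unit a : br a (bw [::]) = a.
Proof.
by rewrite brE bmulx1 bar_t_brk bar_eps1 scale1r mul1r /abar subrK.
Qed.

Lemma br_aug0 a y : aug a = 0 -> br a y = bar_t (bmul (brk a (bw [::])) y).
Proof. by move=> a0; rewrite brE a0 mulr0 scale0r addr0. Qed.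

(** As E vanishes on first arguments of length at least 2, t(xy) depends on x only through its parts
    of length 1 and 0, which give the two summands. *)
Lemma bar_t_mul x y : bar_t (bmul x y) = br (bar_t x) y + bar_eps x *: bar_t y.
Proof.
have lb := br_linl y.
have ls : linear (fun x => bar_eps x *: bar_t y).
  by apply: lin_scalel; apply: bar_eps_lin.
move: x; apply: (@word_ext k A) => [|||l w _].
- lin.
- by apply: lin_add => //; exact: (lin_comp lb (@bar_t_lin k A)).
- by rewrite bmul1x bar_t1 (lin0 lb) bar_eps1 scale1r add0r.
rewrite bar_eps_brk scale0r addr0 br_aug0 ?aug_bar_t // bar_t_brk abar_letter.
case: w => [|m w]; first by rewrite bar_eps1 scale1r.
rewrite bw_cons bar_eps_brk scale0r E_long (lin0 (brk_linl _)) (lin0 (bmul_linl _)).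
by rewrite (lin0 (@bar_t_lin k A)).
Qed.

Lemma aug_br a y : aug (br a y) = aug a * bar_eps y.
Proof. by rewrite brE rmorphD /= aug_bar_t add0r linearZ /= rmorph1 mulr1 mulrC. Qed.

(** Associativity ([a] x) y = [a] (x y) under t: by [bar_t_mul] only t([a] x) and the counit of [a]
    x enter the left side. This replaces the usual brace relations. *)
Lemma br_mul a x y : br (br a x) y = br a (bmul x y).
Proof.
rewrite [br a x]brE (linD (br_linl _)) (linZ (br_linl _)) br1 [RHS]brE bmulA.
rewrite [in RHS]bar_t_mul !bar_eps_mul bar_eps_brk mul0r scale0r addr0.
by congr (_ + _); rewrite scalerA mulrC mulrA [bar_eps y * _]mulrC.
Qed.

Lemma homog_bar_t p x : homog (@bar_pr k A) p x -> homog apr (p + 1) (bar_t x).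
Proof.
rewrite /homog => <-; move: x; apply: bar_ext => [||w]; try lin.
rewrite bar_pr_bw; case: eqP => [<-|_]; last by rewrite (lin0 (@bar_t_lin k A)) (lin0 (apr_lin _)).
rewrite bar_t_bw; case: w => [|l [|m w]]; rewrite ?(lin0 (apr_lin _)) //.
by rewrite wdeg_cons wdeg_nil addr0 subrK; apply: hvalP.
Qed.

Lemma homog_br_letter l w : homog apr (ldeg l + wdeg w) (br (lval l) (bw w)).
Proof.
rewrite br_aug0 ?laug // -bw_cons.
have := homog_bar_t (homog_bmul [:: l] w); rewrite wdeg_cons wdeg_nil addr0.
by congr homog; lia.
Qed.

(* Splits off the multiple of 1, which can be nonzero in degree 0 only.        *)
Lemma hel_split (P : int -> A -> Prop) :
  (forall p c a b, P p a -> P p b -> P p (c *: a + b)) -> P 0 1 ->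
  (forall l, P (ldeg l) (lval l)) -> forall a : hel A, P (hdeg a) (hval a).
Proof.
move=> PD P1 Pl a.
have E : hval a = aug (hval a) *: 1 + abar (hval a) by rewrite addrC subrK.
have Pb : P (hdeg a) (abar (hval a)) by apply: (Pl (lbar a)).
have [a0|a0] := eqVneq (hdeg a) 0; first by rewrite E; apply: PD => //; rewrite a0.
by move: Pb; rewrite /abar (adga_aug_deg (hvalP a) a0) scale0r subr0.
Qed.

Lemma homog_br (a : hel A) w : homog apr (hdeg a + wdeg w) (br (hval a) (bw w)).
Proof.
move: a; apply: (hel_split (P := fun q a => homog apr (q + wdeg w) (br a (bw w))))
  => [p c a b ha hb||l].
- by rewrite (br_linl _); apply: homogD; [lin|apply: homogZ; [lin|]|].
- rewrite br1 bar_eps_bw; case: w => [|m w]; last by rewrite scale0r; apply: homog0; lin.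
  by rewrite scale1r wdeg_nil; apply: adga_one.
exact: homog_br_letter.
Qed.

(** The twisting equation for [m|l] w. All terms in which t meets a product with first factor of
    length 2 vanish; the merged letter in d[m|l] gives the left side, and in the cup square only the
    cut between m and l survives. Multiples of 1 are treated separately. *)
Lemma br_prod a (b : hel A) w : br (a * hval b) (bw w) =
  \sum_(p <- cuts w) sg (hdeg b * wdeg p.1) *: (br a (bw p.1) * br (hval b) (bw p.2)).
Proof.
have lb := br_linl.
have L q (b' : A) : linear (fun a => \sum_(p <- cuts w)
    sg (q * wdeg p.1) *: (br a (bw p.1) * br b' (bw p.2))).
  by apply: lin_sum => p; apply: lin_scale; apply: (lin_comp (@mulr_lin _ _ _)).
move: b; apply: (hel_split (P := fun q b => br (a * b) (bw w) =
  \sum_(p <- cuts w) sg (q * wdeg p.1) *: (br a (bw p.1) * br b (bw p.2)))).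
- move=> q c b b' hb hb'; rewrite mulrDr -scalerAr (lb _) hb hb'.
  rewrite scaler_sumr -big_split; apply: eq_bigr => p _ /=.
  by rewrite (lb _) mulrDr scalerDr -scalerAr !scalerA [c * _]mulrC.
- rewrite mulr1.
  have /= -> := @sum_cuts_last _ _ w (fun w1 w2 => sg (0 * wdeg w1) *:
    (br a (bw w1) * br 1 (bw w2))).
    by rewrite mul0r scale1r br_unit mulr1.
  by move=> m w1 w2; rewrite br1 bar_eps_bw scale0r mulr0 scaler0.
move=> l; move: a; apply: hel_ext => [||a]; [exact: (lin_comp (lb _) (@mulr_lin _ _ _))|exact: L|].
move: a; apply: (hel_split (P := fun q a => br (a * lval l) (bw w) =
  \sum_(p <- cuts w) sg (ldeg l * wdeg p.1) *: (br a (bw p.1) * br (lval l) (bw p.2)))).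
- move=> q c a a' ha ha'.
  by rewrite L mulrDl -scalerAl (lb _) ha ha'.
- rewrite mul1r.
  have /= -> := @sum_cuts_nil _ _ w (fun w1 w2 => sg (ldeg l * wdeg w1) *:
    (br 1 (bw w1) * br (lval l) (bw w2))).
    by rewrite wdeg_nil mulr0 scale1r br_unit mul1r.
  by move=> m w1 w2; rewrite br1 bar_eps_bw scale0r mul0r scaler0.
move=> m; have := bar_t_twisting (bmul (bw [:: m; l]) (bw w)).
have lt := @bar_t_lin k A; have ld := @adiff_lin k A.
rewrite bar_delta_mul bar_diff_mul (linD lt) !bw_cons pC_brk (linN (bmul_linl _)).
rewrite pC_brk (linN (brk_linr _)) (linN (bmul_linl _)) opprK !E_long (lin0 ld) addr0 add0r.
rewrite bar_diff_brk !(linB (bmul_linl _)) (linN (bmul_linl _)) !(linB lt) (linN lt) E_long oppr0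
  add0r.
rewrite bar_diff_brk !(linB (brk_linr _)) (linN (brk_linr _)) !(linB (bmul_linl _)).
rewrite (linN (bmul_linl _)) !(linB lt) (linN lt) !E_long uncons1.
rewrite (lin0 (lact_linr_ _)) (lin0 (@SS_lin k A)) (lin0 (brk_linr _)) (lin0 (bmul_linl _))
  (lin0 lt).
rewrite !(subr0, oppr0) sub0r uncons_brk lactE !abar_letter -[SS _]/(brk _ _).
rewrite -br_aug0; last by rewrite rmorphM /= aug_pA laug mul0r.
have -> : pA (lval m) = sg (ldeg m) *: lval m by exact: pA_hel.
rewrite -scalerAl (linZ (br_linl _)) => H.
apply: (@can_inj _ _ (fun z : A => - (sg (ldeg m) *: z)) (fun z => - (sg (ldeg m) *: z))).
  by move=> z; rewrite scalerN opprK scalerA sgsq scale1r.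
rewrite {}H (lin_sumE (@cup_lin k A)) cuts_cons cuts_cons cuts_nil !big_cons big_nil /=.
rewrite addr0 !(lin_sumE (@cup_lin k A)).
have lc := @cup_lin k A.
rewrite big1 ?add0r => [|p _]; last first.
  by rewrite (linZ lc) cupE !bw_cons E_long mulr0 scaler0.
rewrite addrC big1 ?add0r => [|p _]; last first.
  by rewrite (linZ lc) cupE !bw_cons pC_mul pC_brk pC_brk (linN (brk_linr _)) opprK E_long mul0r
    scaler0.
rewrite scaler_sumr -sumrN; apply: eq_bigr => p _.
rewrite (linZ lc) cupE (pC_homog (homog_bmul [:: m] p.1)) !bw_cons.
rewrite (linZ lt) -!br_aug0 ?laug // -scalerAl !scalerA -scaleNr; congr (_ *: _).
by rewrite !wdeg_cons wdeg_nil !addr0; sgn.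
Qed.

(** The twisting equation for [l] w. The two cuts of [l] produce the two families of quadratic
    terms, with a letter of w multiplied from the left or from the right; for a = 1 these families
    cancel. *)
Lemma adiff_br (a : hel A) w : adiff (br (hval a) (bw w)) =
  br (adiff (hval a)) (bw w) + sg (hdeg a) *: br (hval a) (bar_diff (bw w))
  + \sum_(p <- cuts w) (sg (hdeg a * wdeg p.1) *: (bar_t (bw p.1) * br (hval a) (bw p.2))
     - sg (hdeg a + wdeg p.1) *: (br (hval a) (bw p.1) * bar_t (bw p.2))).
Proof.
have lb := br_linl; have lt := @bar_t_lin k A; have ld := @adiff_lin k A.
have lc := @cup_lin k A.
move: a; apply: (hel_split (P := fun q a => adiff (br a (bw w)) =
  br (adiff a) (bw w) + sg q *: br a (bar_diff (bw w))
  + \sum_(p <- cuts w) (sg (q * wdeg p.1) *: (bar_t (bw p.1) * br a (bw p.2))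
     - sg (q + wdeg p.1) *: (br a (bw p.1) * bar_t (bw p.2))))).
- move=> q c a b ha hb.
  have L : linear (fun a => br (adiff a) (bw w) + sg q *: br a (bar_diff (bw w))
      + \sum_(p <- cuts w) (sg (q * wdeg p.1) *: (bar_t (bw p.1) * br a (bw p.2))
         - sg (q + wdeg p.1) *: (br a (bw p.1) * bar_t (bw p.2)))).
    apply: lin_add; first apply: lin_add.
    + exact: (lin_comp (lb _) ld).
    + exact: lin_scale (lb _).
    apply: lin_sum => p; apply: lin_add.
      by apply: lin_scale; apply: (lin_comp (@mull_lin _ _ _)).
    by apply: lin_opp; apply: lin_scale; apply: (lin_comp (@mulr_lin _ _ _)).
  by rewrite L (lb _) ld ha hb.
- rewrite adiff1 (lin0 (lb _)) !br1 bar_eps_diff scale0r scaler0 (linZ ld) adiff1 scaler0 !add0r.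
  rewrite big_split /= sumrN.
  have /= -> := @sum_cuts_last _ _ w (fun w1 w2 => sg (0 * wdeg w1) *:
    (bar_t (bw w1) * br 1 (bw w2))).
    have /= -> := @sum_cuts_nil _ _ w (fun w1 w2 => sg (0 + wdeg w1) *:
      (br 1 (bw w1) * bar_t (bw w2))).
      by rewrite !br_unit mul1r mulr1 mul0r wdeg_nil subrr.
    by move=> m w1 w2; rewrite br1 bar_eps_bw scale0r mul0r scaler0.
  by move=> m w1 w2; rewrite br1 bar_eps_bw scale0r mulr0 scaler0.
move=> l; have := bar_t_twisting (bmul (bw [:: l]) (bw w)).
rewrite bar_delta_mul bar_diff_mul (linD lt) !bw_cons -br_aug0 ?laug //.
rewrite bar_diff_brk bar_diff1 uncons1 (lin0 (brk_linr _)) (lin0 (lact_linr_ _))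
  (lin0 (@SS_lin k A)).
rewrite !subr0 (linN (bmul_linl _)) (linN lt) -br_aug0 ?adga_aug_diff //.
rewrite pC_brk pC1 (linN (bmul_linl _)) (linN lt).
have -> : pA (lval l) = sg (ldeg l) *: lval l by exact: pA_hel.
rewrite (linZ (brk_linl _)) (linZ (bmul_linl _)) (linZ lt) -br_aug0 ?laug // -opprD.
move/eqP; rewrite subr_eq => /eqP ->; rewrite addrC; congr (_ + _).
rewrite (lin_sumE lc) cuts_cons cuts_nil !big_cons big_nil addr0 /= !(lin_sumE lc).
rewrite -big_split; apply: eq_bigr => p _ /=.
rewrite !(linZ lc) !cupE (pC_homog (homog_bmul [::] p.1)) (pC_homog (homog_bmul [:: l] p.1)).
rewrite !bw_cons !bmul1x !(linZ lt) -!br_aug0 ?laug // -!scalerAl !scalerA -scaleNr.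
by congr (_ *: _ + _ *: _); rewrite !(wdeg_cons, wdeg_nil); sgn.
Qed.

End Brace.

#[export] Hint Extern 1 (GRing.linear_for _ (br _)) => exact: br_linr : lin.
#[export] Hint Extern 1 (GRing.linear_for _ (fun x => br x _)) => exact: br_linl : lin.

(** How E determines the product: [bar_decomp] for vw, with the diagonal of the product expanded,
    gives each first letter by E and leaves the product of the remaining pieces. *)
Lemma bmul_decomp (k : comNzRingType) (A : hga k) (v w : word A) :
  bmul (bw v) (bw w) = (bar_eps (bw v) * bar_eps (bw w)) *: bw [::] +
  \sum_(p <- cuts v) \sum_(q <- cuts w) sg (wdeg p.2 * wdeg q.1) *:
     brk (bar_t (bmul (bw p.1) (bw q.1))) (bmul (bw p.2) (bw q.2)).
Proof.
rewrite [LHS]bar_decomp bar_eps_mul uncons_delta bar_delta_mul; congr (_ + _).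
have L : linear (fun D => SS (tmap (@bar_t k A) id D) : bar A) by lin.
rewrite (lin_sumE L); apply: eq_bigr => p _; rewrite (lin_sumE L).
apply: eq_bigr => q _; rewrite (linZ L) tmapE //; lin.
Qed.

(** * Functoriality of the bar construction *)

Section BarMap.
Variables (k : comNzRingType) (A B : hga k) (f : hga_mor A B).
Implicit Types (w v : word A) (l : letter A) (a : A) (x y : bar A).

Lemma wdeg_wmap w : wdeg (wmap f w) = wdeg w.
Proof. by elim: w => [|l w IH]; rewrite ?wdeg_nil //= !wdeg_cons IH. Qed.

Let wmap_multi : wmulti (fun w => bw (wmap f w)).
Proof.
move=> w1 w2 l l1 l2 c d1 d2 vl; rewrite /wmap !map_cat !map_cons.
apply: bw_multi => //; rewrite /lval /= -/(lval l) -/(lval l1) -/(lval l2) vl linearP //.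
Qed.

Definition bmap : bar A -> bar B :=
  plift (R := @bar_rel k A) (fun w => bw (wmap f w)).

Lemma bmap_lin : linear bmap.
Proof. exact: wlift_lin. Qed.

Lemma bmap_bw w : bmap (bw w) = bw (wmap f w).
Proof. exact: wliftE. Qed.

Lemma aug_f a : aug (f a) = aug a.
Proof. exact: amor_aug. Qed.

Lemma abar_f a : abar (f a) = f (abar a).
Proof.
have lf := @amor_lin k A B f.
by rewrite /abar aug_f (linB lf) (linZ lf) (rmorph1 (amor f)).
Qed.

Lemma bmap_brk a x : bmap (brk a x) = brk (f a) (bmap x).
Proof.
have lb := bmap_lin; have lf := @amor_lin k A B f.
move: a; apply: hel_ext => [||a].
- exact: (lin_comp lb (brk_linl _)).
- exact: (lin_comp (brk_linl _) lf).
move: x; apply: bar_ext => [||w].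
- exact: (lin_comp lb (brk_linr _)).
- exact: (lin_comp (brk_linr _) lb).
rewrite brk_hel !bmap_bw bw_cons -[RHS]brk_abar; congr (brk _ _).
exact: esym (abar_f _).
Qed.

Lemma bar_t_bmap x : bar_t (bmap x) = f (bar_t x).
Proof.
have lb := bmap_lin; have lf := @amor_lin k A B f.
move: x; apply: bar_ext => [||w].
- exact: lin_comp (@bar_t_lin k B) lb.
- exact: lin_comp lf (@bar_t_lin k A).
by rewrite bmap_bw !bar_t_bw; case: w => [|l [|m w]]; rewrite ?(lin0 lf).
Qed.

Lemma bar_eps_bmap x : bar_eps (bmap x) = bar_eps x.
Proof.
move: x; apply: (@bar_ext k A k^o) => [||w].
- exact: lin_comp (@bar_eps_lin k B) bmap_lin.
- exact: bar_eps_lin.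
by rewrite bmap_bw !bar_eps_bw; case: w.
Qed.

Lemma pC_bmap x : pC (bmap x) = bmap (pC x).
Proof.
have lb := bmap_lin; move: x; apply: bar_ext => [||w].
- exact: lin_comp (@pC_lin k B) lb.
- exact: lin_comp lb (@pC_lin k A).
by rewrite bmap_bw !pC_bw wdeg_wmap (linZ lb) bmap_bw.
Qed.

Lemma uncons_bmap x : uncons (bmap x) = tmap f bmap (uncons x).
Proof.
have lb := bmap_lin; have lf := @amor_lin k A B f.
have lt := tmap_lin lf lb.
move: x; apply: (@word_ext k A) => [|||l w _].
- exact: lin_comp (@uncons_lin k B) lb.
- exact: lin_comp lt (@uncons_lin k A).
- by rewrite bmap_bw !uncons1 (lin0 lt).
by rewrite bmap_brk !uncons_brk tmapE // abar_f.
Qed.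

Lemma bar_diff_bmap x : bar_diff (bmap x) = bmap (bar_diff x).
Proof.
have lb := bmap_lin; have lf := @amor_lin k A B f.
have lt := tmap_lin lf lb.
move: x; apply: (@word_ext k A) => [|||l w IH].
- exact: lin_comp (@bar_diff_lin k B) lb.
- exact: lin_comp lb (@bar_diff_lin k A).
- by rewrite bmap_bw !bar_diff1 (lin0 lb).
rewrite bmap_brk !bar_diff_brk IH uncons_bmap !(linB lb) (linN lb) !bmap_brk.
rewrite amor_diff amor_pA abar_f -[pA (f _)]amor_pA; congr (_ - _).
move: (uncons _); apply: tens_ext => [||a x].
- exact: lin_comp (@SS_lin k B) (lin_comp (lact_linr_ _) lt).
- exact: lin_comp lb (lin_comp (@SS_lin k A) (lact_linr_ _)).
by rewrite tmapE // !lactE -!/(brk _ _) bmap_brk (rmorphM (amor f)) -amor_pA.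
Qed.

(** A morphism is only assumed to respect E; compatibility with the product follows from
    [bmul_decomp] by induction on the total length of the two words. *)
Lemma bmap_mul x y : bmap (bmul x y) = bmul (bmap x) (bmap y).
Proof.
have lb := bmap_lin; have lf := @amor_lin k A B f.
move: x; apply: bar_ext => [||v].
- exact: lin_comp lb (bmul_linl _).
- exact: lin_comp (bmul_linl _) lb.
move: y; apply: bar_ext => [||w].
- exact: lin_comp lb (bmul_linr _).
- exact: lin_comp (bmul_linr _) lb.
rewrite !bmap_bw; move: {2}(size v + size w)%N (leqnn (size v + size w)) => n.
elim: n v w => [|n IH] v w.
  rewrite leqn0 addn_eq0 => /andP [/nilP -> /nilP ->].
  by rewrite !bmul1x bmap_bw.
move=> vwn; rewrite !bmul_decomp (linD lb) (linZ lb) bmap_bw -!bmap_bw !bar_eps_bmap.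
congr (_ + _); rewrite (lin_sumE lb) /wmap !cuts_map big_map.
apply: eq_cuts => -[v1 v2] /= vE; rewrite (lin_sumE lb) big_map.
apply: eq_cuts => -[w1 w2] /= wE; rewrite (linZ lb) bmap_brk -!/(wmap f _) !wdeg_wmap; congr
  (_ *: _).
rewrite -[bar_t (bmul (bw (wmap f v1)) _)]/(EE _ _) hmor_E.
(* If both prefixes are empty, the first letter is t([ ]) = 0; otherwise the remaining words are
   shorter and the induction hypothesis applies. *)
have [/nilP v10|v10] := boolP (nilp v1).
  have [/nilP w10|w10] := boolP (nilp w1).
    by rewrite v10 w10 /EE bmul1x bar_t1 (lin0 lf) !(lin0 (brk_linl _)).
  congr (brk _ _); rewrite IH //; move: vwn w10; rewrite -vE -wE !size_cat /nilp; lia.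
congr (brk _ _); rewrite IH //; move: vwn v10; rewrite -vE -wE !size_cat /nilp; lia.
Qed.

Lemma br_bmap a x : br (f a) (bmap x) = f (br a x).
Proof.
have lf := @amor_lin k A B f; have b1 : bmap (bw [::]) = bw [::] by exact: bmap_bw.
rewrite !brE -b1 -bmap_brk -bmap_mul bar_t_bmap bar_eps_bmap aug_f.
by rewrite (linD lf) (linZ lf) (rmorph1 (amor f)).
Qed.

End BarMap.

#[export] Hint Extern 1 (GRing.linear_for _ (bmap _)) => exact: bmap_lin : lin.

Lemma hmulti_lin (k : comNzRingType) (A : adga k) (M : lmodType k)
  (phi : int -> A -> M) : (forall p, linear (phi p)) ->
  hmulti (fun x : hel A => phi (hdeg x) (hval x)).
Proof. by move=> lphi x y z c dy dz vx; rewrite -dy -dz vx lphi. Qed.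

Lemma eq_hmulti (k : comNzRingType) (A : adga k) (M : lmodType k)
  (f g : hel A -> M) : f =1 g -> hmulti g -> hmulti f.
Proof. by move=> fg gm x y z c dy dz vx; rewrite !fg; apply: gm. Qed.

Lemma eq_wmulti (k : comNzRingType) (A : adga k) (M : lmodType k)
  (f g : word A -> M) : f =1 g -> wmulti g -> wmulti f.
Proof. by move=> fg gm w1 w2 l l1 l2 c d1 d2 vl; rewrite !fg; apply: gm. Qed.

(** * The right bar construction *)

Section RightBar.
Variables (k : comNzRingType) (A A'' : hga k).
Notation R := (rbarc A A'').

Lemma rbar_ext (M : lmodType k) (F G : R -> M) : linear F -> linear G ->
  (forall g : rgen A A'', F (rg g) = G (rg g)) -> forall x, F x = G x.
Proof.
move=> lF lG FG; apply: tens_ext => // u a.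
move: a; apply: hel_ext => [||a].
- exact: lin_comp lF (tpure_linr _).
- exact: lin_comp lG (tpure_linr _).
move: u; apply: bar_ext => [||w].
- exact: lin_comp lF (tpure_linl _).
- exact: lin_comp lG (tpure_linl _).
exact: FG (w, a).
Qed.

Section Lift.
Variables (M : lmodType k) (f : rgen A A'' -> M).
Hypothesis fw : forall a, wmulti (fun w => f (w, a)).
Hypothesis fa : forall w, hmulti (fun a => f (w, a)).

Let f0 (u : bar A) (a : A'') : M :=
  plift (R := @bar_rel k A) (fun w => hext (fun x => f (w, x)) a) u.

Let f0_multi (a : A'') : wmulti (fun w => hext (fun x => f (w, x)) a).
Proof.
move=> w1 w2 l l1 l2 c d1 d2 vl; move: a; apply: hel_ext => [||a].
- exact: hext_lin.
- by apply: lin_add; [apply: lin_scale|]; apply: hext_lin.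
by rewrite !hextE //; apply: fw.
Qed.

Let f0_linl a : linear (fun u => f0 u a).
Proof. exact: wlift_lin. Qed.

Let f0_linr u : linear (f0 u).
Proof.
move=> c x y; move: u; apply: bar_ext => [||w].
- exact: wlift_lin.
- by apply: lin_add; [apply: lin_scale|]; apply: wlift_lin.
by rewrite /f0 !wliftE //; apply: hext_lin.
Qed.

Lemma rlift_lin : linear (rlift f).
Proof. exact: tlift_lin f0_linl f0_linr. Qed.

Lemma rliftE g : rlift f (rg g) = f g.
Proof.
case: g => w a; rewrite /rlift /rg (tliftE f0_linl f0_linr) /f0.
by rewrite wliftE // hextE.
Qed.

End Lift.

Lemma rlift_ext (M : lmodType k) (f : rgen A A'' -> M) (G : R -> M) :
  linear G -> (forall g, f g = G (rg g)) -> forall x, rlift f x = G x.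
Proof.
move=> lG fG; apply: tlift_ext => // u a; apply: (wlift_ext (G := fun u => G (tpure u a))) => [|w].
  exact: lin_comp lG (tpure_linl _).
apply: (hext_ext (G := fun a => G (tpure (bw w) a))) => [|x].
  exact: lin_comp lG (tpure_linr _).
exact: fG.
Qed.

End RightBar.

Section RightProduct.
Variables (k : comNzRingType) (A A'' : hga k) (f : hga_mor A A'').
Notation R := (rbarc A A'').
Implicit Types (u v w : word A) (a b c : A'') (x y : bar A).

Definition brr (a : A'') (x : bar A) : A'' := br a (bmap f x).

Lemma brr_linl x : linear (fun a => brr a x).
Proof. exact: br_linl. Qed.

Lemma brr_linr a : linear (brr a).
Proof. exact: lin_comp (br_linr _) (bmap_lin f). Qed.

Lemma brr_unit a : brr a (bw [::]) = a.
Proof. by rewrite /brr bmap_bw br_unit. Qed.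

Lemma brr1 x : brr 1 x = bar_eps x *: 1.
Proof. by rewrite /brr br1 bar_eps_bmap. Qed.

Lemma brr_mul a x y : brr (brr a x) y = brr a (bmul x y).
Proof. by rewrite /brr bmap_mul br_mul. Qed.

Lemma homog_brr (a : hel A'') w : homog apr (hdeg a + wdeg w) (brr (hval a) (bw w)).
Proof. by rewrite /brr bmap_bw -(wdeg_wmap f w); apply: homog_br. Qed.

Lemma aug_brr a x : aug (brr a x) = aug a * bar_eps x.
Proof. by rewrite aug_br bar_eps_bmap. Qed.

Lemma brr_prod a (b : hel A'') w : brr (a * hval b) (bw w) =
  \sum_(p <- cuts w) sg (hdeg b * wdeg p.1) *:
     (brr a (bw p.1) * brr (hval b) (bw p.2)).
Proof.
rewrite /brr bmap_bw br_prod /wmap cuts_map big_map; apply: eq_bigr => p _ /=.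
by rewrite !bmap_bw -(wdeg_wmap f).
Qed.

(** A smash product: x v' (x) (a . v'') b for the right action [brr] of BA on A'', with p standing
    for the degree of a. *)
Definition rterm p (x : bar A) (a b : A'') v : R :=
  \sum_(q <- cuts v) sg (p * wdeg q.1) *: tpure (bmul x (bw q.1)) (brr a (bw q.2) * b).

Lemma rgen_mulE u (a : hel A'') v (b : hel A'') :
  rgen_mul f (u, a) (v, b) = rterm (hdeg a) (bw u) (hval a) (hval b) v.
Proof.
have bl := brr_linl; have br_ := brr_linr.
rewrite /rgen_mul /rterm (sum_cuts v (fun v1 v2 => sg (hdeg a * wdeg v1) *:
  tpure (bmul (bw u) (bw v1)) (EE (bw [:: lbar a]) (bw (wmap f v2)) * hval b))).
(* The augmentation summand belongs to the cut of v with empty second piece; its sign is trivial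
   because eps(a) vanishes unless a has degree 0. *)
have Ea : tpure (bmul (bw u) (bw v)) (aug (hval a) *: hval b) =
   \sum_(q <- cuts v) sg (hdeg a * wdeg q.1) *: tpure (bmul (bw u) (bw q.1))
      ((bar_eps (bw q.2) * aug (hval a)) *: hval b).
  have /= -> := @sum_cuts_last _ _ v (fun v1 v2 => sg (hdeg a * wdeg v1) *:
    tpure (bmul (bw u) (bw v1)) ((bar_eps (bw v2) * aug (hval a)) *: hval b)).
    rewrite bar_eps1 mul1r; have [a0|a0] := eqVneq (hdeg a) 0.
      by rewrite a0 mul0r scale1r.
    by rewrite (adga_aug_deg (hvalP a) a0) scale0r !(lin0 (tpure_linr _)) scaler0.
  by move=> l w1 w2; rewrite bar_eps_bw mul0r scale0r (lin0 (tpure_linr _)) scaler0.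
rewrite Ea -big_split; apply: eq_bigr => q _ /=.
rewrite -scalerDr -(linD (tpure_linr _)); congr (_ *: tpure _ _).
rewrite /brr brE mulrDl bmap_bw -scalerAl mul1r bar_eps_bw; congr (_ * _ + _).
  by rewrite /EE bw_cons -[lval _]/(abar (hval a)) brk_abar.
by rewrite bar_eps_bw; case: (q.2).
Qed.

Lemma rterm_multi p x a b : wmulti (rterm p x a b).
Proof.
have bl := brr_linr.
apply: (@cuts_multi _ _ _ (fun m n y z => sg (p * m) *: tpure (bmul x y) (brr a z * b))).
  by move=> m n y; lin.
move=> m n y; apply: lin_scale; apply: (lin_comp (tpure_linr _)).
exact: lin_comp (@mulr_lin _ _ _) (bl _).
Qed.

Lemma rterm_linx p a b v : linear (fun x => rterm p x a b v).
Proof. by apply: lin_sum => q; lin. Qed.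

Lemma rterm_lina p x b v : linear (fun a => rterm p x a b v).
Proof.
have bl := brr_linl; apply: lin_sum => q; apply: lin_scale.
by apply: (lin_comp (tpure_linr _)); exact: lin_comp (@mulr_lin _ _ _) (bl _).
Qed.

Lemma rterm_linb p x a v : linear (fun b => rterm p x a b v).
Proof. by apply: lin_sum => q; lin. Qed.

Let in2_multi (x : rgen A A'') : (forall b : hel A'', wmulti (fun v => rgen_mul f x (v, b))) *
  (forall v, hmulti (fun b : hel A'' => rgen_mul f x (v, b))).
Proof.
case: x => u a; split=> [b|v].
  exact: (eq_wmulti (fun v => rgen_mulE u a v b) (rterm_multi _ _ _ _)).
apply: (eq_hmulti (g := fun b : hel A'' =>
  rterm (hdeg a) (bw u) (hval a) (hval b) v)) => [b|]; first exact: rgen_mulE.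
apply: (hmulti_lin (phi := fun _ b => rterm (hdeg a) (bw u) (hval a) b v)) => _.
exact: rterm_linb.
Qed.

Let in1_multi (y : R) : (forall a : hel A'', wmulti (fun u => rlift (rgen_mul f (u, a)) y)) *
  (forall u, hmulti (fun a : hel A'' => rlift (rgen_mul f (u, a)) y)).
Proof.
have lr (x : rgen A A'') := rlift_lin (in2_multi x).1 (in2_multi x).2.
have rE (x : rgen A A'') := rliftE (in2_multi x).1 (in2_multi x).2.
split=> [a|u].
  move=> w1 w2 l l1 l2 c d1 d2 vl; move: y; apply: rbar_ext => [//||[v b]].
    by apply: lin_add; [apply: lin_scale|].
  rewrite !rE !rgen_mulE (bw_multi w1 w2 d1 d2 vl); exact: rterm_linx.
move=> a1 a2 a3 c d1 d2 va; move: y; apply: rbar_ext => [//||[v b]].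
  by apply: lin_add; [apply: lin_scale|].
rewrite !rE !rgen_mulE -d1 -d2 va; exact: rterm_lina.
Qed.

Lemma rmul_linr (x : R) : linear (rmul f x).
Proof.
move=> c y z; move: x.
have L (y' : R) : linear (fun x : R => rmul f x y').
  exact: rlift_lin (in1_multi y').1 (in1_multi y').2.
apply: rbar_ext => [//||x]; first by apply: lin_add; [apply: lin_scale|].
rewrite /rmul !(rliftE (in1_multi _).1 (in1_multi _).2); case: x => u a.
exact: rlift_lin (in2_multi (u, a)).1 (in2_multi (u, a)).2 _ _ _.
Qed.

Lemma rmul_linl (y : R) : linear (fun x : R => rmul f x y).
Proof. exact: rlift_lin (in1_multi y).1 (in1_multi y).2. Qed.

Lemma rmul_gen u (a : hel A'') v (b : hel A'') : rmul f (rg (u, a)) (rg (v, b)) =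
  rterm (hdeg a) (bw u) (hval a) (hval b) v.
Proof.
rewrite /rmul (rliftE (in1_multi _).1 (in1_multi _).2).
by rewrite (rliftE (in2_multi (u, a)).1 (in2_multi (u, a)).2) rgen_mulE.
Qed.

Lemma rmul_word p x (a : A'') v (b : A'') : homog apr p a ->
  rmul f (tpure x a) (tpure (bw v) b) = rterm p x a b v.
Proof.
move=> ha; move: b; apply: hel_ext => [||b].
- exact: lin_comp (rmul_linr _) (tpure_linr _).
- exact: rterm_linb.
move: x; apply: bar_ext => [||u].
- exact: lin_comp (rmul_linl _) (tpure_linl _).
- exact: rterm_linx.
exact: (rmul_gen u (Helt ha) v b).
Qed.

(** The p-th power of [pC]: the Koszul sign of moving an element of degree p across BA, as a linear
    map. *)
Definition pCn (p : int) : bar A -> bar A := if par p then @pC k A else id.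

Lemma pCn_lin p : linear (pCn p).
Proof. by rewrite /pCn; case: par; lin. Qed.

Lemma pCn_homog p q x : homog (@bar_pr k A) q x -> pCn p x = sg (p * q) *: x.
Proof.
move=> hx; rewrite /pCn sgE parM; case: par => /=.
  by rewrite (pC_homog hx) sgE.
by rewrite scale1r.
Qed.

Lemma rmul_delta p x (a : A'') y (b : A'') : homog apr p a ->
  rmul f (tpure x a) (tpure y b) =
  tmap (fun y1 => bmul x (pCn p y1)) (fun y2 => brr a y2 * b) (bar_delta y).
Proof.
have l1 : linear (fun y1 => bmul x (pCn p y1)).
  exact: lin_comp (bmul_linr _) (pCn_lin p).
have l2 : linear (fun y2 => brr a y2 * b).
  exact: lin_comp (@mulr_lin _ _ _) (brr_linr a).
have lt := tmap_lin l1 l2.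
move=> ha; move: y; apply: bar_ext => [||v].
- exact: lin_comp (rmul_linr _) (tpure_linl _).
- exact: lin_comp lt (@bar_delta_lin k A).
rewrite (rmul_word _ _ _ ha) bar_delta_bw (lin_sumE lt); apply: eq_bigr => q _.
by rewrite tmapE // (pCn_homog p (homog_bw q.1)) (linZ (bmul_linr _)) (linZ (tpure_linl _)).
Qed.

(** Associativity of a smash product: it uses that A'' is a module ([brr_mul]), that the action
    distributes over products ([brr_prod]) and that the diagonal is multiplicative. Both sides
    become sums over cuts of v into two and of w into three pieces. *)
Lemma rmulA : associative (rmul f).
Proof.
have rl := rmul_linl; have rr := rmul_linr.
move=> x y z; move: x; apply: rbar_ext => [||[u a]].
- exact: rl.
- exact: lin_comp (rl _) (rl _).
move: y; apply: rbar_ext => [||[v b]].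
- exact: lin_comp (rr _) (rl _).
- exact: lin_comp (rl _) (rr _).
move: z; apply: rbar_ext => [||[w c]].
- exact: lin_comp (rr _) (rr _).
- exact: rr.
pose FF w1 w2 w3 : R := \sum_(r <- cuts v)
  sg (hdeg b * (wdeg w1 + wdeg w2) + wdeg r.2 * wdeg w1 + hdeg a * (wdeg r.1 + wdeg w1)) *:
  tpure (bmul (bw u) (bmul (bw r.1) (bw w1)))
        (brr (hval a) (bmul (bw r.2) (bw w2)) * (brr (hval b) (bw w3) * hval c)).
transitivity (\sum_(p <- cuts w) \sum_(q <- cuts p.1) FF q.1 q.2 p.2).
  rewrite !rmul_gen /rterm (lin_sumE (rr _)); apply: eq_bigr => p _.
  have l1 : linear (fun y1 => bmul (bw u) (pCn (hdeg a) y1)).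
    exact: lin_comp (bmul_linr _) (pCn_lin _).
  have l2 d : linear (fun y2 => brr (hval a) y2 * d).
    exact: lin_comp (@mulr_lin _ _ _) (brr_linr _).
  have lt d := tmap_lin l1 (l2 d).
  rewrite (linZ (rr _)) /rg /= (rmul_delta _ _ _ (hvalP a)) bar_delta_mul.
  rewrite exchange_big (lin_sumE (lt _)) scaler_sumr; apply: eq_cuts => q qE.
  rewrite (lin_sumE (lt _)) scaler_sumr; apply: eq_bigr => r _.
  rewrite (linZ (lt _)) tmapE // (pCn_homog _ (homog_bmul r.1 q.1)).
  rewrite (linZ (bmul_linr _)) (linZ (tpure_linl _)) !scalerA -qE wdeg_cat.
  by congr (_ *: _); sgn.
rewrite sum_cuts3 !rmul_gen /rterm (lin_sumE (rl _)).
under [RHS]eq_bigr => r _.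
  rewrite (linZ (rl _)) /rg /=.
  have h : homog apr (hdeg a + wdeg r.2 + hdeg b) (brr (hval a) (bw r.2) * hval b).
    by apply: adga_mul; [apply: homog_brr|apply: hvalP].
  rewrite (rmul_word _ _ _ h) /rterm scaler_sumr; over.
rewrite exchange_big; apply: eq_bigr => p _ /=.
rewrite /FF exchange_big; apply: eq_bigr => r _ /=.
rewrite brr_prod [X in _ = _ *: (_ *: tpure _ X)]mulr_suml (lin_sumE (tpure_linr _)) !scaler_sumr.
apply: eq_cuts => q qE; rewrite brr_mul -bmulA -scalerAl -mulrA.
rewrite (linZ (tpure_linr _)) !scalerA; congr (_ *: _); sgn.
Qed.

Lemma rmul_unitl (x : R) : rmul f (tpure (bw [::]) 1) x = x.
Proof.
move: x; apply: rbar_ext => [||[v b]]; [exact: rmul_linr|by []|].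
rewrite (rmul_word _ _ _ (adga_one A'')) /rterm.
have /= -> := @sum_cuts_last _ _ v (fun v1 v2 => sg (0 * wdeg v1) *:
   tpure (bmul (bw [::]) (bw v1)) (brr 1 (bw v2) * hval b)).
  by rewrite mul0r scale1r brr_unit mul1r bmul1x.
move=> l v1 v2; rewrite brr1 bar_eps_bw scale0r !mul0r.
by rewrite (lin0 (tpure_linr _)) scaler0.
Qed.

Lemma rmul_unitr (x : R) : rmul f x (tpure (bw [::]) 1) = x.
Proof.
move: x; apply: rbar_ext => [||[v b]]; [exact: rmul_linl|by []|].
rewrite (rmul_word _ _ _ (hvalP b)) /rterm cuts_nil big_seq1 /= wdeg_nil mulr0 scale1r.
by rewrite bmulx1 brr_unit mulr1.
Qed.

End RightProduct.

#[export] Hint Extern 1 (GRing.linear_for _ (brr _ _)) => exact: brr_linr : lin.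
#[export] Hint Extern 1 (GRing.linear_for _ (fun x => brr _ x _)) => exact: brr_linl : lin.
#[export] Hint Extern 1 (GRing.linear_for _ (rmul _ _)) => exact: rmul_linr : lin.
#[export] Hint Extern 1 (GRing.linear_for _ (fun x => rmul _ x _)) => exact: rmul_linl : lin.

(** * The differential of the right bar construction *)

Section RightDifferential.
Variables (k : comNzRingType) (A A'' : hga k) (f : hga_mor A A'').
Notation R := (rbarc A A'').
Implicit Types (u v w : word A) (a b c : A'') (x y : bar A).

Definition ft (x : bar A) : A'' := f (bar_t x).

Lemma ft_lin : linear ft.
Proof. exact: lin_comp (@amor_lin k A A'' f) (@bar_t_lin k A). Qed.

Lemma homog_ft w : homog apr (wdeg w + 1) (ft (bw w)).
Proof.
by rewrite /homog /ft -amor_pr; congr (f _); apply: homog_bar_t (homog_bw w).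
Qed.

Lemma ft_mul x y : ft (bmul x y) = brr f (ft x) y + bar_eps x *: ft y.
Proof.
have lf := @amor_lin k A A'' f.
by rewrite /ft bar_t_mul (linD lf) (linZ lf) /brr br_bmap.
Qed.

Lemma adiff_brr (a : hel A'') w : adiff (brr f (hval a) (bw w)) =
  brr f (adiff (hval a)) (bw w) + sg (hdeg a) *: brr f (hval a) (bar_diff (bw w))
  + \sum_(p <- cuts w) (sg (hdeg a * wdeg p.1) *: (ft (bw p.1) * brr f (hval a) (bw p.2))
     - sg (hdeg a + wdeg p.1) *: (brr f (hval a) (bw p.1) * ft (bw p.2))).
Proof.
rewrite /brr bmap_bw adiff_br -bar_diff_bmap bmap_bw; congr (_ + _).
rewrite /wmap cuts_map big_map; apply: eq_bigr => p _ /=.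
by rewrite -!/(wmap f _) !wdeg_wmap /ft -!(bar_t_bmap f) !bmap_bw.
Qed.

(* The twisting term of the differential of B(k, A, A'').                      *)
Definition kap : R -> R :=
  tlift (fun x a => tmap (@pC k A) (fun y => ft y * a) (bar_delta x)).

Let kap_linl a : linear (fun x => tmap (@pC k A) (fun y => ft y * a) (bar_delta x)).
Proof.
have lf := ft_lin; apply: (lin_comp (tmap_lin (@pC_lin k A) _)); last by lin.
exact: (lin_comp (@mulr_lin _ _ _) lf).
Qed.

Let kap_linr x : linear (fun a => tmap (@pC k A) (fun y => ft y * a) (bar_delta x)).
Proof.
have lf := ft_lin; have lp := @pC_lin k A.
have lm d : linear (fun y => ft y * d) by exact: (lin_comp (@mulr_lin _ _ _) lf).
have lt d := tmap_lin lp (lm d).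
move=> c a b; move: (bar_delta x); apply: tens_ext => [||p q]; try lin.
rewrite !tmapE //.
have -> : ft q * (c *: a + b) = c *: (ft q * a) + ft q * b by exact: mull_lin.
exact: tpure_linr.
Qed.

Lemma kap_lin : linear kap.
Proof. exact: tlift_lin kap_linl kap_linr. Qed.

Lemma kapE x a : kap (tpure x a) = tmap (@pC k A) (fun y => ft y * a) (bar_delta x).
Proof. exact: tliftE kap_linl kap_linr x a. Qed.

Lemma kap_word w a : kap (tpure (bw w) a) =
  \sum_(p <- cuts w) sg (wdeg p.1) *: tpure (bw p.1) (ft (bw p.2) * a).
Proof.
have lf := ft_lin; have lp := @pC_lin k A.
have lm d : linear (fun y => ft y * d) by exact: (lin_comp (@mulr_lin _ _ _) lf).
have lt d := tmap_lin lp (lm d).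
rewrite kapE bar_delta_bw (lin_sumE (lt _)); apply: eq_bigr => p _.
by rewrite tmapE // pC_bw (linZ (tpure_linl _)).
Qed.

Lemma kap_mul v w a : kap (tpure (bmul (bw v) (bw w)) a) =
  \sum_(p <- cuts v) \sum_(q <- cuts w)
    sg (wdeg p.1 + (wdeg p.2 + 1) * wdeg q.1) *:
    tpure (bmul (bw p.1) (bw q.1)) (brr f (ft (bw p.2)) (bw q.2) * a)
  + \sum_(q <- cuts w) sg (wdeg v + wdeg q.1) *:
    tpure (bmul (bw v) (bw q.1)) (ft (bw q.2) * a).
Proof.
have lf := ft_lin; have lp := @pC_lin k A.
have lm d : linear (fun y => ft y * d) by exact: (lin_comp (@mulr_lin _ _ _) lf).
have lt d := tmap_lin lp (lm d).
rewrite kapE bar_delta_mul (lin_sumE (lt _)).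
pose H v1 v2 : R := \sum_(q <- cuts w) (sg (wdeg v1 + (wdeg v2 + 1) * wdeg q.1) * bar_eps (bw v2))
  *:
    tpure (bmul (bw v1) (bw q.1)) (ft (bw q.2) * a).
have -> : \sum_(q <- cuts w) sg (wdeg v + wdeg q.1) *:
    tpure (bmul (bw v) (bw q.1)) (ft (bw q.2) * a) = \sum_(p <- cuts v) H p.1 p.2.
  rewrite sum_cuts_last /H.
    apply: eq_bigr => q _; rewrite bar_eps1 mulr1 wdeg_nil; congr (_ *: _); sgn.
  move=> l w1 w2; rewrite big1 // => q _; rewrite bar_eps_bw mulr0 scale0r //.
rewrite -big_split; apply: eq_bigr => p _ /=.
rewrite (lin_sumE (lt _)) -big_split; apply: eq_bigr => q _ /=.
rewrite (linZ (lt _)) tmapE // (pC_homog (homog_bmul p.1 q.1)) ft_mul mulrDl.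
rewrite (linZ (tpure_linl _)) (linD (tpure_linr _)) -scalerAl (linZ (tpure_linr _)).
rewrite !scalerDr !scalerA; congr (_ *: _ + (_ * _) *: _); sgn.
Qed.

Definition diffR : R -> R := fun x : R =>
  tmap (@bar_diff k A) id x + tmap (@pC k A) adiff x - kap x.

Lemma diffR_lin : linear diffR.
Proof. by have lk := kap_lin; apply: lin_add; [apply: lin_add|apply: lin_opp]; lin. Qed.

Lemma diffRE x a : diffR (tpure x a) =
  tpure (bar_diff x) a + tpure (pC x) (adiff a) - kap (tpure x a).
Proof. by rewrite /diffR !tmapE //; lin. Qed.

Definition pR : R -> R := tmap (@pC k A) (@pA k A'').

Lemma pR_lin : linear pR.
Proof. by rewrite /pR; lin. Qed.

Lemma pRE x a : pR (tpure x a) = tpure (pC x) (pA a).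
Proof. by rewrite /pR tmapE //; lin. Qed.

Lemma pR_gen (g : rgen A A'') : pR (rg g) = sg (rgdeg g) *: rg g.
Proof.
rewrite /rg pRE pC_bw pA_hel (linZ (tpure_linl _)) (linZ (tpure_linr _)) scalerA.
by rewrite sgD.
Qed.

Lemma diffR_mul (x y : R) :
  diffR (rmul f x y) = rmul f (diffR x) y + rmul f (pR x) (diffR y).
Proof.
have ld := diffR_lin; have lp := pR_lin; have rl := rmul_linl f; have rr := rmul_linr f.
move: x; apply: rbar_ext => [||[u a]].
- exact: lin_comp ld (rl _).
- by apply: lin_add; [exact: lin_comp (rl _) ld|exact: lin_comp (rl _) lp].
move: y; apply: rbar_ext => [||[v b]].
- exact: lin_comp ld (rr _).
- by apply: lin_add; [exact: rr|exact: lin_comp (rr _) ld].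
rewrite rmul_gen pR_gen (linZ (rl _)) /rterm /rg /rgdeg /=.
pose B y := brr f (hval a) y.
(* By [adiff_brr], the differential of the brace contributes [G1] and [G2]; by [kap_mul], the
   twisting term contributes [G3] and once more [G1] with the opposite sign. The terms [G1] cancel
   by [sum_cuts3], while [G3] and [G2] are the twisting terms of the two factors. *)
pose G1 w1 w2 w3 : R := sg (hdeg a * wdeg w1 + wdeg u + wdeg w1 + hdeg a * wdeg w2) *:
  tpure (bmul (bw u) (bw w1)) (ft (bw w2) * (B (bw w3) * hval b)).
pose G2 w1 w2 w3 : R := sg (hdeg a * wdeg w1 + wdeg u + wdeg w1 + hdeg a + wdeg w2) *:
  tpure (bmul (bw u) (bw w1)) (B (bw w2) * (ft (bw w3) * hval b)).
pose G3 w1 w2 w3 : R := \sum_(s <- cuts u)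
  sg (wdeg s.1 + (wdeg s.2 + 1 + hdeg a) * wdeg w1 + hdeg a * wdeg w2) *:
  tpure (bmul (bw s.1) (bw w1)) (brr f (ft (bw s.2)) (bw w2) * (B (bw w3) * hval b)).
pose SA1 : R := \sum_(q <- cuts v) sg (hdeg a * wdeg q.1) *:
  tpure (bmul (bar_diff (bw u)) (bw q.1)) (B (bw q.2) * hval b).
pose SB1a : R := \sum_(q <- cuts v) sg (wdeg u + hdeg a * wdeg q.1) *:
  tpure (bmul (bw u) (bar_diff (bw q.1))) (B (bw q.2) * hval b).
pose SA2 : R := \sum_(q <- cuts v) sg (hdeg a * wdeg q.1 + wdeg u + wdeg q.1) *:
  tpure (bmul (bw u) (bw q.1)) (brr f (adiff (hval a)) (bw q.2) * hval b).
pose SB1b : R := \sum_(q <- cuts v) sg (hdeg a * wdeg q.1 + wdeg u + wdeg q.1 + hdeg a) *: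
  tpure (bmul (bw u) (bw q.1)) (B (bar_diff (bw q.2)) * hval b).
pose SB2 : R := \sum_(q <- cuts v) sg (hdeg a * wdeg q.1 + wdeg u + wdeg v + hdeg a) *:
  tpure (bmul (bw u) (bw q.1)) (B (bw q.2) * adiff (hval b)).
have EL : diffR (\sum_(q <- cuts v) sg (hdeg a * wdeg q.1) *:
     tpure (bmul (bw u) (bw q.1)) (B (bw q.2) * hval b)) =
  SA1 + (SB1a + (SA2 + (SB1b + (SB2 +
   ((\sum_(q <- cuts v) \sum_(r <- cuts q.2) (G1 q.1 r.1 r.2 - G2 q.1 r.1 r.2)) +
    (- (\sum_(q <- cuts v) \sum_(r <- cuts q.1) G3 r.1 r.2 q.2)
     + - (\sum_(q <- cuts v) \sum_(r <- cuts q.1) G1 r.1 r.2 q.2))))))).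
  rewrite (lin_sumE ld) -!sumrN -!big_split; apply: eq_cuts => q qE /=.
  rewrite (linZ ld) diffRE bar_diff_mul (pC_homog (homog_bmul u q.1)) pC_bw.
  have hB : homog apr (hdeg a + wdeg q.2) (B (bw q.2)) by apply: homog_brr.
  rewrite (adga_leibniz _ hB) adiff_brr kap_mul.
  rewrite (linD (tpure_linl _)) (linZ (bmul_linl _)) !(linZ (tpure_linl _)).
  rewrite !mulrDl !(linD (tpure_linr _)) -!scalerAl !(linZ (tpure_linr _)) !scalerDr !scalerA.
  rewrite [X in _ + X = _]scalerDr.
  have arrange (V : zmodType) (x1 x2 x3 x4 x5 x6 y2 y3 y4 y5 y6 k1 k2 l1 l2 : V) :
    x2 = y2 -> x3 = y3 -> x4 = y4 -> x5 = y5 -> x6 = y6 -> k1 = - l1 -> k2 = - l2 ->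
    x1 + x2 + (x3 + x4 + x5 + x6) + (k1 + k2) =
    x1 + (y2 + (y3 + (y4 + (y6 + (y5 + (- l1 - l2)))))).
    by move=> -> -> -> -> -> -> ->; abel.
  apply: arrange.
  - by congr (_ *: _); sgn.
  - by congr (_ *: _); sgn.
  - by congr (_ *: _); sgn.
  - rewrite [X in tpure _ X]mulr_suml (lin_sumE (tpure_linr _)) scaler_sumr.
    apply: eq_bigr => r _; rewrite mulrBl (linB (tpure_linr _)) -!scalerAl.
    rewrite !(linZ (tpure_linr _)) scalerBr !scalerA -!mulrA.
    by congr (_ *: _ - _ *: _); sgn.
  - by rewrite -qE wdeg_cat; congr (_ *: _); sgn.
  - rewrite exchange_big scaler_sumr -sumrN; apply: eq_cuts => r rE /=.
    rewrite scaler_sumr -sumrN; apply: eq_bigr => s _; rewrite scalerA -scaleNr -rE wdeg_cat.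
    by congr (_ *: _); sgn.
  rewrite scaler_sumr -sumrN; apply: eq_cuts => r rE /=.
  by rewrite scalerA -scaleNr -rE wdeg_cat; congr (_ *: _); sgn.
have ER1 : rmul f (diffR (tpure (bw u) (hval a))) (tpure (bw v) (hval b)) =
  SA1 + SA2 - \sum_(q <- cuts v) \sum_(r <- cuts q.2) G3 q.1 r.1 r.2.
  rewrite diffRE (linB (rl _)) (linD (rl _)) kap_word (lin_sumE (rl _)); congr (_ + _ - _).
  - exact: rmul_word (hvalP a).
  - rewrite (rmul_word _ _ _ _ (cx_degree (adga_complex A'') (hvalP a))) /rterm.
    apply: eq_bigr => q _; rewrite pC_bw (linZ (bmul_linl _)) (linZ (tpure_linl _)) scalerA.
    by congr (_ *: _); sgn.
  under eq_bigr => s _.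
    have h : homog apr (wdeg s.2 + 1 + hdeg a) (ft (bw s.2) * hval a).
      by apply: adga_mul; [apply: homog_ft|apply: hvalP].
    rewrite (linZ (rl _)) (rmul_word _ _ _ _ h) /rterm scaler_sumr; over.
  rewrite exchange_big; apply: eq_bigr => q _ /=.
  rewrite /G3 exchange_big; apply: eq_bigr => s _ /=.
  rewrite brr_prod [X in tpure _ X]mulr_suml (lin_sumE (tpure_linr _)) !scaler_sumr.
  apply: eq_bigr => r _; rewrite -scalerAl (linZ (tpure_linr _)) !scalerA.
  by congr (_ *: tpure _ _); [sgn | rewrite mulrA].
have ER2 : sg (wdeg u + hdeg a) *: rmul f (tpure (bw u) (hval a)) (diffR (tpure (bw v) (hval b))) =
  SB1a + SB1b + SB2 - \sum_(q <- cuts v) \sum_(r <- cuts q.1) G2 r.1 r.2 q.2.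
  rewrite diffRE (linB (rr _)) (linD (rr _)) kap_word scalerBr scalerDr; congr (_ + _ - _).
  - have l1 : linear (fun y1 => bmul (bw u) (pCn (hdeg a) y1)).
      exact: lin_comp (bmul_linr _) (pCn_lin _).
    have l2 d : linear (fun y2 => brr f (hval a) y2 * d).
      exact: lin_comp (@mulr_lin _ _ _) (brr_linr _ _).
    have lt d := tmap_lin l1 (l2 d).
    have lbd := @bar_diff_lin k A; have lpc := @pC_lin k A; have lid : linear (@id (bar A)) by [].
    rewrite (rmul_delta _ _ _ _ (hvalP a)) bar_delta_diff bar_delta_bw.
    rewrite !(lin_sumE (tmap_lin _ _)) // -big_split (lin_sumE (lt _)) scaler_sumr -big_split.
    apply: eq_bigr => q _ /=; rewrite !tmapE // (linD (lt _)) !tmapE // scalerDr.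
    rewrite (pCn_homog _ (homog_bar_diff q.1)) pC_bw (linZ (pCn_lin _))
      (pCn_homog _ (homog_bw q.1)).
    rewrite !(linZ (bmul_linr _)) !(linZ (tpure_linl _)) !scalerA.
    by congr (_ *: _ + _ *: _); sgn.
  - rewrite pC_bw (linZ (tpure_linl _)) (linZ (rr _)) (rmul_word _ _ _ _ (hvalP a)) /rterm
    !scaler_sumr.
    by apply: eq_bigr => q _; rewrite !scalerA; congr (_ *: _); sgn.
  rewrite (lin_sumE (rr _)) scaler_sumr; apply: eq_bigr => q _.
  rewrite (linZ (rr _)) (rmul_word _ _ _ _ (hvalP a)) /rterm !scaler_sumr.
  apply: eq_cuts => r rE; rewrite !scalerA -rE wdeg_cat.
  by congr (_ *: _); sgn.
have E3 (G : word A -> word A -> word A -> R) :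
  \sum_(q <- cuts v) \sum_(r <- cuts q.1) G r.1 r.2 q.2 =
  \sum_(q <- cuts v) \sum_(r <- cuts q.2) G q.1 r.1 r.2 by exact: sum_cuts3.
have EB : \sum_(q <- cuts v) \sum_(r <- cuts q.2) (G1 q.1 r.1 r.2 - G2 q.1 r.1 r.2) =
   \sum_(q <- cuts v) \sum_(r <- cuts q.2) G1 q.1 r.1 r.2 -
   \sum_(q <- cuts v) \sum_(r <- cuts q.2) G2 q.1 r.1 r.2.
  by rewrite -sumrB; apply: eq_bigr => q _; rewrite sumrB.
rewrite EL ER1 ER2 (E3 G1) (E3 G2) (E3 G3) EB.
abel.
Qed.

End RightDifferential.

Section RightDifferentialSquare.
Variables (k : comNzRingType) (A A'' : hga k) (f : hga_mor A A'').
Notation R := (rbarc A A'').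

Lemma kap_diff w (a : A'') : kap f (tpure (bar_diff (bw w)) a) =
  \sum_(p <- cuts w) (sg (wdeg p.1 + 1) *: tpure (bar_diff (bw p.1)) (ft f (bw p.2) * a)
     + tpure (bw p.1) (ft f (bar_diff (bw p.2)) * a)).
Proof.
have lf := ft_lin f; have lp := @pC_lin k A; have ld := @bar_diff_lin k A.
have li : linear (@id (bar A)) by [].
have lm d : linear (fun y => ft f y * d) by exact: (lin_comp (@mulr_lin _ _ _) lf).
have lt d := tmap_lin lp (lm d).
rewrite kapE bar_delta_diff bar_delta_bw !(lin_sumE (tmap_lin _ _)) // -big_split.
rewrite (lin_sumE (lt _)); apply: eq_bigr => p _ /=.
rewrite !tmapE // (linD (lt _)) !tmapE // (pC_homog (homog_bar_diff p.1)).
rewrite !pC_bw (linZ lp) pC_bw scalerA sgsq scale1r.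
by rewrite (linZ (tpure_linl _)).
Qed.

Lemma adiff_ft w : adiff (ft f (bw w)) + ft f (bar_diff (bw w)) =
  \sum_(p <- cuts w) sg (wdeg p.1) *: (ft f (bw p.1) * ft f (bw p.2)).
Proof.
have lf := @amor_lin k A A'' f; have lc := @cup_lin k A.
rewrite /ft -amor_diff -(linD lf) bar_t_twisting bar_delta_bw (lin_sumE lc) (lin_sumE lf).
apply: eq_bigr => p _; rewrite cupE pC_bw (linZ (@bar_t_lin k A)) -scalerAl.
by rewrite (linZ lf) (rmorphM (amor f)).
Qed.

(** As for any twisted tensor product, applying [kap] twice gives the cup square of the twisting
    cochain f t, which cancels against the one that [adiff_ft] produces from d(f t). *)
Lemma diffR2 (x : R) : diffR f (diffR f x) = 0.
Proof.
have ld := diffR_lin f; have lk := kap_lin f.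
move: x; apply: rbar_ext => [||[w a]]; [exact: (lin_comp ld ld)|lin|].
rewrite /rg /=.
have hk : kap f (tpure (bw w) (hval a)) =
  \sum_(p <- cuts w) sg (wdeg p.1) *: tpure (bw p.1) (ft f (bw p.2) * hval a) by exact: kap_word.
rewrite {2}/diffR !tmapE; try lin.
rewrite (linB ld) (linD ld) !diffRE bar_diff2 (cx_square (adga_complex A'')).
rewrite pC_bw !(linZ (tpure_linl _)) (linZ (@bar_diff_lin k A)) (linZ lk).
rewrite (linZ (@pC_lin k A)).
rewrite (pC_homog (homog_bar_diff w)) (lin0 (tpure_linl _)) !(lin0 (tpure_linr _)).
rewrite !(linZ (tpure_linl _)).
pose TT w1 w2 w3 : R := sg (wdeg w2) *: tpure (bw w1) (ft f (bw w2) * (ft f (bw w3) * hval a)).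
have -> : diffR f (kap f (tpure (bw w) (hval a))) =
  (- kap f (tpure (bar_diff (bw w)) (hval a)) - sg (wdeg w) *: kap f
    (tpure (bw w) (adiff (hval a))))
  + (\sum_(p <- cuts w) \sum_(q <- cuts p.2) TT p.1 q.1 q.2
     - \sum_(p <- cuts w) \sum_(q <- cuts p.1) TT q.1 q.2 p.2).
  rewrite hk (lin_sumE ld) kap_diff kap_word scaler_sumr -!sumrN -!big_split.
  apply: eq_cuts => p pE /=.
  rewrite (linZ ld) diffRE (adga_leibniz _ (homog_ft f p.2)) kap_word pC_bw.
  have -> : adiff (ft f (bw p.2)) = \sum_(q <- cuts p.2) sg (wdeg q.1) *:
    (ft f (bw q.1) * ft f (bw q.2))
     - ft f (bar_diff (bw p.2)) by rewrite -adiff_ft addrK.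
  have arrange (x1 x2 x3 x4 x5 y1 y2 y3 y4 y5 : R) : x1 = - y1 -> x2 = y4 -> x3 = - y2 ->
     x4 = - y3 -> x5 = - y5 -> x1 + (x2 + x3 + x4) + x5 = - (y1 + y2) - y3 + (y4 - y5).
    by move=> -> -> -> -> ->; abel.
  rewrite scalerBr scalerDr (linD (tpure_linr _)) mulrBl (linB (tpure_linr _)).
  rewrite !(linZ (tpure_linl _)) !scalerDr; apply: arrange.
  - by rewrite -scaleNr; congr (_ *: _); sgn.
  - rewrite [X in tpure _ X]mulr_suml (lin_sumE (tpure_linr _)) !scaler_sumr.
    apply: eq_bigr => q _; rewrite -scalerAl (linZ (tpure_linr _)) !scalerA.
    by congr (_ *: tpure _ _); [sgn|rewrite mulrA].
  - by rewrite !scalerN !scalerA sgsq scale1r.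
  - rewrite (linZ (tpure_linr _)) !scalerA -scaleNr; congr (_ *: _).
    by rewrite -pE wdeg_cat; sgn.
  rewrite scaler_sumr; congr (- _); apply: eq_cuts => q qE /=.
  by rewrite scalerA -qE wdeg_cat /TT; congr (_ *: _); sgn.
have -> : \sum_(p <- cuts w) \sum_(q <- cuts p.1) TT q.1 q.2 p.2 =
   \sum_(p <- cuts w) \sum_(q <- cuts p.2) TT p.1 q.1 q.2 by exact: sum_cuts3.
have -> : sg (wdeg w + 1) = - sg (wdeg w) :> k by sgn.
rewrite scaleNr; abel.
Qed.

Lemma diffR1 : diffR f (tpure (bw [::]) 1) = 0.
Proof.
rewrite diffRE bar_diff1 (lin0 (tpure_linl _)) adiff1 (lin0 (tpure_linr _)) add0r.
by rewrite kap_word cuts_nil big_seq1 /ft bar_t1 (lin0 (@amor_lin _ _ _ f)) mul0r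
  (lin0 (tpure_linr _)) scaler0 subr0.
Qed.

End RightDifferentialSquare.

(** * The left coaction *)

Section LeftCoaction.
Variables (k : comNzRingType) (A A' A'' : hga k).
Variables (f' : hga_mor A A') (f : hga_mor A A'').
Notation R := (rbarc A A'').
Notation g := (bmap f').

Definition coact : R -> tens (bar A) R :=
  tlift (fun x a => tmap id (fun y : bar A => tpure y a) (bar_delta x)).

Let coact_linl (a : A'') : linear (fun x => tmap id (fun y : bar A => tpure y a) (bar_delta x)).
Proof. lin. Qed.

Let coact_linr x : linear (fun a : A'' => tmap id (fun y : bar A => tpure y a) (bar_delta x)).
Proof.
move=> c a b; move: (bar_delta x); apply: tens_ext => [||p q]; try lin.
rewrite !tmapE; try lin.
have -> : tpure q (c *: a + b) = c *: tpure q a + tpure q b by exact: tpure_linr.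
exact: tpure_linr.
Qed.

Lemma coact_lin : linear coact.
Proof. exact: tlift_lin coact_linl coact_linr. Qed.

Lemma coactE x (a : A'') : coact (tpure x a) =
  tmap id (fun y : bar A => tpure y a) (bar_delta x).
Proof. exact: tliftE coact_linl coact_linr x a. Qed.

Definition pRn (p : int) : R -> R := if par p then @pR k A A'' else id.

Lemma pRn_lin p : linear (pRn p).
Proof. by rewrite /pRn; case: par; [exact: pR_lin|lin]. Qed.

Section Generic.
Variables (X : lmodType k) (act : R -> X -> X).
Hypothesis act_linl : forall x, linear (fun r : R => act r x).
Hypothesis act_linr : forall r, linear (act r).
Notation CX := (tens (bar A') X).

(** Here n stands for the degree of c, which the R-factor has to pass. The module X is arbitrary
    because the construction is applied to R and then again to BA' (x) R, the target of the
    diagonal. *)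
Let Lam n (c : bar A') (x : X) : tens (bar A) R -> CX :=
  tmap (fun u => bmul (g u) c) (fun r => act (pRn n r) x).

Let Lam_lin n c x : linear (Lam n c x).
Proof.
have l1 : linear (fun u => bmul (g u) c) by lin.
exact: tmap_lin l1 (lin_comp (act_linl x) (pRn_lin n)).
Qed.

Let LamE n c x u r : Lam n c x (tpure u r) = tpure (bmul (g u) c) (act (pRn n r) x).
Proof.
have l1 : linear (fun u => bmul (g u) c) by lin.
by rewrite /Lam tmapE //; apply: (lin_comp (act_linl x) (pRn_lin n)).
Qed.

Let Lam_linc n x D : linear (fun c => Lam n c x D).
Proof.
move=> d c1 c2; move: D; apply: tens_ext => [||u r]; [exact: Lam_lin| |].
  by apply: lin_add; [apply: lin_scale|]; apply: Lam_lin.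
by rewrite !LamE (bmul_linr _) tpure_linl.
Qed.

Let Lam_linx n c D : linear (fun x => Lam n c x D).
Proof.
move=> d x y; move: D; apply: tens_ext => [||u r]; [exact: Lam_lin| |].
  by apply: lin_add; [apply: lin_scale|]; apply: Lam_lin.
by rewrite !LamE (act_linr _) tpure_linr.
Qed.

Let L0 (r : R) (c : bar A') (x : X) : CX :=
  plift (R := @bar_rel k A') (fun w => Lam (wdeg w) (bw w) x (coact r)) c.

Let L0_multi r x : wmulti (fun w => Lam (wdeg w) (bw w) x (coact r)).
Proof. exact: (deg_multi (fun n => @Lam_linc n x (coact r))). Qed.

Let L0_linc r x : linear (fun c => L0 r c x).
Proof. exact: wlift_lin. Qed.

Let L0_linx r c : linear (L0 r c).
Proof.
move=> d x y; move: c; apply: bar_ext => [||w]; [exact: L0_linc| |].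
  by apply: lin_add; [apply: lin_scale|]; apply: L0_linc.
by rewrite /L0 !wliftE //; apply: Lam_linx.
Qed.

(* The action through the left BA'-coaction of R = B(k, A, A''); see Lact_gen. *)
Definition Lact (r : R) : CX -> CX := tlift (L0 r).

Lemma Lact_linr r : linear (Lact r).
Proof. exact: tlift_lin (L0_linc r) (L0_linx r). Qed.

Let Lact_word r w x : Lact r (tpure (bw w) x) = Lam (wdeg w) (bw w) x (coact r).
Proof. by rewrite /Lact (tliftE (L0_linc r) (L0_linx r)) /L0 wliftE. Qed.

Lemma Lact_linl q : linear (fun r => Lact r q).
Proof.
move=> d r s; move: q; apply: tens_ext => [||c x]; [exact: Lact_linr| |].
  by apply: lin_add; [apply: lin_scale|]; apply: Lact_linr.
move: c; apply: bar_ext => [||w].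
- exact: (lin_comp (Lact_linr _) (tpure_linl _)).
- by apply: lin_add; [apply: lin_scale|]; apply: (lin_comp (Lact_linr _) (tpure_linl _)).
by rewrite !Lact_word coact_lin Lam_lin.
Qed.

Lemma Lact_homog n r (c : bar A') x : homog (@bar_pr k A') n c ->
  Lact r (tpure c x) =
  tmap (fun u => bmul (g u) c) (fun s => act (pRn n s) x) (coact r).
Proof.
rewrite /homog => <-; move: c; apply: bar_ext => [||w].
- exact: (lin_comp (Lact_linr _) (lin_comp (tpure_linl _) (@bar_pr_lin k A' n))).
- exact: (lin_comp (Lam_linc n x (coact r)) (@bar_pr_lin k A' n)).
rewrite bar_pr_bw; case: eqP => [<-|_]; first exact: Lact_word.
by rewrite (lin0 (tpure_linl _)) (lin0 (Lact_linr _)) [RHS](lin0 (Lam_linc n x (coact r))).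
Qed.

Lemma Lact_delta n u (a : A'') p (c : bar A') x : homog (@bar_pr k A') n c ->
  homog apr p a -> Lact (tpure u a) (tpure c x) =
  tmap (fun u1 => bmul (g u1) c)
       (fun u2 => act (tpure (pCn n u2) (sg (p * n) *: a)) x) (bar_delta u).
Proof.
move=> hc ha.
have l1 : linear (fun u => bmul (g u) c) by lin.
have l2 : linear (fun s => act (pRn n s) x) by apply: (lin_comp (act_linl x) (pRn_lin n)).
have l3 : linear (fun u2 => act (tpure (pCn n u2) (sg (p * n) *: a)) x).
  exact: (lin_comp (act_linl x) (lin_comp (tpure_linl _) (@pCn_lin k A n))).
rewrite (Lact_homog _ _ hc) coactE; move: (bar_delta u).
have lt := tmap_lin l1 l2; apply: tens_ext => [||u1 u2]; [|exact: tmap_lin|].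
  by apply: (lin_comp lt); lin.
have lid : linear (@id (bar A)) by [].
have lta : linear (fun y : bar A => tpure y a) by lin.
rewrite !tmapE //; congr (tpure _ (act _ x)).
rewrite /pRn /pCn sgE parM; case: par; rewrite ?andbT ?andbF ?scale1r //.
by rewrite pRE (pA_homog ha) sgE.
Qed.

Lemma Lact_gen n w (a : hel A'') (c : bar A') x : homog (@bar_pr k A') n c ->
  Lact (tpure (bw w) (hval a)) (tpure c x) =
  \sum_(p <- cuts w) sg ((wdeg p.2 + hdeg a) * n) *:
     tpure (bmul (g (bw p.1)) c) (act (tpure (bw p.2) (hval a)) x).
Proof.
move=> hc.
have l1 : linear (fun u => bmul (g u) c) by lin.
have l3 : linear (fun u2 => act (tpure (pCn n u2) (sg (hdeg a * n) *: hval a)) x).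
  exact: (lin_comp (act_linl x) (lin_comp (tpure_linl _) (@pCn_lin k A n))).
have lt := tmap_lin l1 l3.
rewrite (Lact_delta _ _ hc (hvalP a)) bar_delta_bw (lin_sumE lt); apply: eq_bigr => p _.
rewrite tmapE // (pCn_homog n (homog_bw p.2)) (linZ (tpure_linr _)) (linZ (tpure_linl _)).
rewrite !(linZ (act_linl _)) !(linZ (tpure_linr _)) !scalerA; congr (_ *: _); sgn.
Qed.

End Generic.

Section Composition.
Variables (X : lmodType k) (act : R -> X -> X).
Hypothesis act_linl : forall x, linear (fun r : R => act r x).
Hypothesis act_linr : forall r, linear (act r).
Hypothesis actA : forall r s x, act r (act s x) = act (rmul f r s) x.
Notation L := (Lact act).

(** The coaction of R is multiplicative because the diagonal of BA and the map to BA' are; so the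
    diagonal action inherits associativity from X. Both sides are sums over cuts of u into two and
    of v into three pieces. *)
Lemma LactA r s q : L r (L s q) = L (rmul f r s) q.
Proof.
have Ll := Lact_linl act_linl act_linr; have Lr := Lact_linr act_linl act_linr.
have rl := rmul_linl f; have rr := rmul_linr f.
move: q; apply: tens_ext => [||c x]; [exact: (lin_comp (Lr _) (Lr _))|exact: Lr|].
move: c; apply: bar_ext => [||c].
- exact: (lin_comp (Lr _) (lin_comp (Lr _) (tpure_linl _))).
- exact: (lin_comp (Lr _) (tpure_linl _)).
move: r; apply: rbar_ext => [||[u a]]; [exact: Ll|exact: (lin_comp (Ll _) (rl _))|].
move: s; apply: rbar_ext => [||[v b]].
- exact: (lin_comp (Lr _) (Ll _)).
- exact: (lin_comp (Ll _) (rr _)).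
have hc := homog_bw c; rewrite rmul_gen /rterm (lin_sumE (Ll _)) /rg /=.
rewrite (Lact_gen act_linl act_linr _ _ _ hc) (lin_sumE (Lr _)).
pose T w1 w2 w3 : tens (bar A') X := \sum_(r <- cuts u)
  sg ((wdeg w2 + wdeg w3 + hdeg b) * wdeg c + (wdeg r.2 + hdeg a) * (wdeg w1 + wdeg c)
     + hdeg a * wdeg w2) *:
  tpure (bmul (bmul (g (bw r.1)) (g (bw w1))) (bw c))
    (act (tpure (bmul (bw r.2) (bw w2)) (brr f (hval a) (bw w3) * hval b)) x).
transitivity (\sum_(p <- cuts v) \sum_(q <- cuts p.2) T p.1 q.1 q.2).
  apply: eq_bigr => p _; rewrite (linZ (Lr _)).
  have h1 : homog (@bar_pr k A') (wdeg p.1 + wdeg c) (bmul (g (bw p.1)) (bw c)).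
    by rewrite bmap_bw -(wdeg_wmap f'); apply: homog_bmul.
  rewrite (Lact_gen act_linl act_linr _ _ _ h1) /T exchange_big scaler_sumr.
  apply: eq_bigr => r _; rewrite scalerA actA (rmul_word _ _ _ _ (hvalP a)) /rterm.
  rewrite (lin_sumE (act_linl _)) (lin_sumE (tpure_linr _)) scaler_sumr.
  apply: eq_cuts => q qE; rewrite (linZ (act_linl _)) (linZ (tpure_linr _)) scalerA bmulA.
  by rewrite -qE wdeg_cat; congr (_ *: _); sgn.
have -> : \sum_(p <- cuts v) \sum_(q <- cuts p.2) T p.1 q.1 q.2 =
  \sum_(p <- cuts v) \sum_(q <- cuts p.1) T q.1 q.2 p.2 by exact: esym (sum_cuts3 _ _).
apply: eq_bigr => p _; rewrite (linZ (Ll _)).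
have h2 : homog apr (hdeg a + wdeg p.2 + hdeg b) (brr f (hval a) (bw p.2) * hval b).
  by apply: adga_mul; [apply: homog_brr|apply: hvalP].
have l1 : linear (fun u => bmul (g u) (bw c)) by lin.
have l3 : linear (fun u2 => act (tpure (pCn (wdeg c) u2) (sg ((hdeg a + wdeg p.2 + hdeg b) * wdeg c) *: (brr f (hval a) (bw p.2) * hval b))) x).
  exact: (lin_comp (act_linl x) (lin_comp (tpure_linl _) (@pCn_lin k A _))).
have lt := tmap_lin l1 l3.
rewrite (Lact_delta act_linl act_linr _ _ hc h2) bar_delta_mul exchange_big (lin_sumE lt).
rewrite scaler_sumr; apply: eq_bigr => r _.
rewrite (lin_sumE lt) scaler_sumr; apply: eq_cuts => q qE.
rewrite (linZ lt) tmapE //= (pCn_homog _ (homog_bmul r.2 q.2)) bmap_mul.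
rewrite (linZ (tpure_linr _)) (linZ (tpure_linl _)) !(linZ (act_linl _)) !(linZ (tpure_linr _))
  !scalerA.
by rewrite -qE wdeg_cat; congr (_ *: _); sgn.
Qed.

Lemma Lact_unit q : (forall x, act (tpure (bw [::]) 1) x = x) ->
  L (tpure (bw [::]) 1) q = q.
Proof.
move=> act1; have Lr := Lact_linr act_linl act_linr.
move: q; apply: tens_ext => [||c x]; [exact: Lr|by []|].
move: c; apply: bar_ext => [||c].
- exact: (lin_comp (Lr _) (tpure_linl _)).
- exact: tpure_linl.
rewrite (Lact_gen act_linl act_linr [::] (Helt (adga_one A'')) _ (homog_bw c)).
rewrite cuts_nil big_seq1 /= act1 bmap_bw bmul1x wdeg_nil add0r mul0r.
by rewrite scale1r.
Qed.

End Composition.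

End LeftCoaction.

Section LeftCoactionDifferential.
Variables (k : comNzRingType) (A A' A'' : hga k).
Variables (f' : hga_mor A A') (f : hga_mor A A'').
Notation R := (rbarc A A'').
Notation g := (bmap f').
Variables (X : lmodType k) (act : R -> X -> X) (dX : X -> X).
Hypothesis act_linl : forall x, linear (fun r : R => act r x).
Hypothesis act_linr : forall r, linear (act r).
Hypothesis dX_lin : linear dX.
Hypothesis dX_act : forall r x,
  dX (act r x) = act (diffR f r) x + act (@pR k A A'' r) (dX x).
Notation CX := (tens (bar A') X).
Notation L := (Lact f' act).

Definition dCX : CX -> CX := fun q : CX =>
  tmap (@bar_diff k A') id q + tmap (@pC k A') dX q.

Lemma dCX_lin : linear dCX.
Proof. by apply: lin_add; [lin|exact: tmap_lin (@pC_lin k A') dX_lin]. Qed.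

Lemma dCXE c x : dCX (tpure c x) = tpure (bar_diff c) x + tpure (pC c) (dX x).
Proof. by rewrite /dCX !tmapE //; lin. Qed.

(** Leibniz rule for the diagonal action. Only the terms of [kap] need rearranging: the coaction
    cuts u at the front, [kap] detaches its end, and [sum_cuts3] says that the order of these cuts
    is irrelevant. *)
Lemma dCX_act r q : dCX (L r q) = L (diffR f r) q + L (@pR k A A'' r) (dCX q).
Proof.
have Ll := Lact_linl f' act_linl act_linr; have Lr := Lact_linr f' act_linl act_linr.
have ld := diffR_lin f; have lp := @pR_lin k A A''; have ldc := dCX_lin.
have lg := bmap_lin f'; have lpc := @pC_lin k A'; have lbd := @bar_diff_lin k A'.
move: q; apply: tens_ext => [||c x].
- exact: (lin_comp ldc (Lr _)).
- by apply: lin_add; [exact: Lr|exact: (lin_comp (Lr _) ldc)].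
move: c; apply: bar_ext => [||c].
- exact: (lin_comp ldc (lin_comp (Lr _) (tpure_linl _))).
- apply: lin_add; [exact: (lin_comp (Lr _) (tpure_linl _))|].
  exact: (lin_comp (Lr _) (lin_comp ldc (tpure_linl _))).
move: r; apply: rbar_ext => [||[u a]].
- exact: (lin_comp ldc (Ll _)).
- by apply: lin_add; [exact: (lin_comp (Ll _) ld)|exact: (lin_comp (Ll _) lp)].
have hc := homog_bw c; rewrite pR_gen /rgdeg /rg /= (linZ (Ll _)).
have lgen := Lact_gen f' act_linl act_linr.
have pgen (w : word A) (b : hel A'') : pR (tpure (bw w) (hval b)) =
   sg (wdeg w + hdeg b) *: tpure (bw w) (hval b) by exact: (pR_gen (w, b)).
pose n := wdeg c.
pose T w1 w2 w3 : CX := sg ((wdeg w2 + wdeg w3 + hdeg a) * n + wdeg w1 + n + wdeg w2) *: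
  tpure (bmul (g (bw w1)) (bw c)) (act (tpure (bw w2) (ft f (bw w3) * hval a)) x).
pose S1 : CX := \sum_(p <- cuts u) sg ((wdeg p.2 + hdeg a) * n) *:
  tpure (bmul (g (bar_diff (bw p.1))) (bw c)) (act (tpure (bw p.2) (hval a)) x).
pose S2 : CX := \sum_(p <- cuts u) sg ((wdeg p.2 + hdeg a) * n + wdeg p.1) *:
  tpure (bmul (g (bw p.1)) (bar_diff (bw c))) (act (tpure (bw p.2) (hval a)) x).
pose S3 : CX := \sum_(p <- cuts u) sg ((wdeg p.2 + hdeg a) * n + wdeg p.1 + n) *:
  tpure (bmul (g (bw p.1)) (bw c)) (act (tpure (bar_diff (bw p.2)) (hval a)) x).
pose S4 : CX := \sum_(p <- cuts u) sg ((wdeg p.2 + hdeg a) * n + wdeg u + n) *: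
  tpure (bmul (g (bw p.1)) (bw c)) (act (tpure (bw p.2) (adiff (hval a))) x).
pose S5 : CX := \sum_(p <- cuts u) sg ((wdeg p.2 + hdeg a) * n + wdeg u + hdeg a + n) *:
  tpure (bmul (g (bw p.1)) (bw c)) (act (tpure (bw p.2) (hval a)) (dX x)).
have -> : dCX (L (tpure (bw u) (hval a)) (tpure (bw c) x)) =
  S1 + (S2 + (S3 + (S4 + (S5 + (- \sum_(p <- cuts u) \sum_(q <- cuts p.2) T p.1 q.1 q.2))))).
  rewrite (lgen _ _ _ _ _ hc) (lin_sumE ldc) -sumrN -!big_split; apply: eq_cuts => p pE /=.
  have hgc : homog (@bar_pr k A') (wdeg p.1 + n) (bmul (g (bw p.1)) (bw c)).
    by rewrite bmap_bw -(wdeg_wmap f'); apply: homog_bmul.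
  rewrite (linZ ldc) dCXE bar_diff_mul bar_diff_bmap pC_bmap pC_bw (linZ lg) (linZ (bmul_linl _)).
  rewrite (pC_homog hgc) dX_act diffRE kap_word pgen.
  rewrite (linZ (act_linl _)) (linB (act_linl _)) (linD (act_linl _)) pC_bw
    (linZ (tpure_linl (adiff (hval a)))).
  rewrite (linZ (act_linl _)) (lin_sumE (act_linl _)) !(linD (tpure_linr _)) (linD (tpure_linl _)).
  rewrite !(linZ (tpure_linl _)) (linN (tpure_linr _)) (lin_sumE (tpure_linr _))
    !(linZ (tpure_linr _)).
  rewrite !scalerDr !scalerN !scalerA !scaler_sumr.
  have arrange (V : zmodType) (x1 x2 x3 x4 x5 x6 y2 y3 y4 y5 y6 : V) : x2 = y2 -> x3 = y3 -> x4 =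
    y4 ->
    x5 = y5 -> x6 = y6 ->
    x1 + x2 + (x3 + x4 - x6 + x5) = x1 + (y2 + (y3 + (y4 + (y5 - y6)))).
    by move=> -> -> -> -> ->; abel.
  apply: arrange.
  - by congr (_ *: _); sgn.
  - by congr (_ *: _); sgn.
  - by rewrite -pE wdeg_cat; congr (_ *: _); sgn.
  - by rewrite -pE wdeg_cat; congr (_ *: _); sgn.
  apply: eq_cuts => q qE; rewrite (linZ (act_linl _)) (linZ (tpure_linr _)) scalerA.
  by rewrite -qE wdeg_cat /T; congr (_ *: _); sgn.
rewrite dCXE (linD (Lr _)) pC_bw (linZ (tpure_linl _)) (linZ (Lr _)) scalerDr scalerA.
rewrite (lgen _ _ _ _ _ hc) (lgen _ _ _ _ _ (homog_bar_diff c)).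
rewrite diffRE (linB (Ll _)) (linD (Ll _)) kap_word (lin_sumE (Ll _)) pC_bw (linZ (tpure_linl _))
  (linZ (Ll _)).
have -> : sg (wdeg u + hdeg a) *: (\sum_(p <- cuts u) sg ((wdeg p.2 + hdeg a) * (wdeg c + 1)) *:
     tpure (bmul (g (bw p.1)) (bar_diff (bw c))) (act (tpure (bw p.2) (hval a)) x)) = S2.
  rewrite scaler_sumr; apply: eq_cuts => p pE; rewrite scalerA -pE wdeg_cat.
  by congr (_ *: _); rewrite -/n; sgn.
have -> : (sg (wdeg u + hdeg a) * sg (wdeg c)) *:
  (\sum_(p <- cuts u) sg ((wdeg p.2 + hdeg a) * wdeg c) *:
     tpure (bmul (g (bw p.1)) (bw c)) (act (tpure (bw p.2) (hval a)) (dX x))) = S5.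
  rewrite scaler_sumr; apply: eq_cuts => p pE; rewrite scalerA.
  by congr (_ *: _); rewrite -/n; sgn.
have -> : sg (wdeg u) *: L (tpure (bw u) (adiff (hval a))) (tpure (bw c) x) = S4.
  have hda := cx_degree (adga_complex A'') (hvalP a).
  rewrite (lgen _ u (Helt hda) _ _ hc) scaler_sumr; apply: eq_bigr => p _; rewrite scalerA /=.
  by congr (_ *: _); rewrite -/n; sgn.
have -> : \sum_(p <- cuts u) L (sg (wdeg p.1) *: tpure (bw p.1) (ft f (bw p.2) * hval a))
  (tpure (bw c) x)
   = \sum_(p <- cuts u) \sum_(q <- cuts p.1) T q.1 q.2 p.2.
  apply: eq_bigr => p _; rewrite (linZ (Ll _)).
  have h : homog apr (wdeg p.2 + 1 + hdeg a) (ft f (bw p.2) * hval a).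
    by apply: adga_mul; [apply: homog_ft|apply: hvalP].
  rewrite (lgen _ p.1 (Helt h) _ _ hc) scaler_sumr; apply: eq_cuts => q qE /=.
  by rewrite scalerA -qE wdeg_cat /T; congr (_ *: _); rewrite -/n; sgn.
have -> : L (tpure (bar_diff (bw u)) (hval a)) (tpure (bw c) x) = S1 + S3.
  have l1 : linear (fun u => bmul (g u) (bw c)) by lin.
  have l3 : linear (fun u2 => act (tpure (pCn n u2) (sg (hdeg a * n) *: hval a)) x).
    exact: (lin_comp (act_linl x) (lin_comp (tpure_linl _) (@pCn_lin k A n))).
  have lt := tmap_lin l1 l3; have lid : linear (@id (bar A)) by [].
  have lpa := @pC_lin k A; have lda := @bar_diff_lin k A.
  rewrite (Lact_delta f' act_linl act_linr _ _ hc (hvalP a)) bar_delta_diff bar_delta_bw.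
  rewrite !(lin_sumE (tmap_lin _ _)) // -big_split (lin_sumE lt) -big_split.
  apply: eq_bigr => p _ /=; rewrite !tmapE // (linD lt) !tmapE //.
  rewrite (pCn_homog n (homog_bw p.2)) (pCn_homog n (homog_bar_diff p.2)) pC_bw (linZ lg)
    (linZ (bmul_linl _)).
  rewrite !(linZ (tpure_linl _)) !(linZ (tpure_linr _)) !(linZ (act_linl _))
    !(linZ (tpure_linr _)) !scalerA.
  by congr (_ *: _ + _ *: _); sgn.
have -> : \sum_(p <- cuts u) \sum_(q <- cuts p.1) T q.1 q.2 p.2 =
  \sum_(p <- cuts u) \sum_(q <- cuts p.2) T p.1 q.1 q.2 by exact: sum_cuts3.
abel.
Qed.

Definition epsX : CX -> X := tlift (fun c x => bar_eps c *: x).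

Let epsX_linl (x : X) : linear (fun c : bar A' => bar_eps c *: x).
Proof. by apply: lin_scalel; apply: bar_eps_lin. Qed.
Let epsX_linr (c : bar A') : linear (fun x : X => bar_eps c *: x).
Proof. by apply: lin_scale; apply: lin_id. Qed.

Lemma epsX_lin : linear epsX.
Proof. exact: tlift_lin epsX_linl epsX_linr. Qed.

Lemma epsXE c x : epsX (tpure c x) = bar_eps c *: x.
Proof. exact: tliftE epsX_linl epsX_linr c x. Qed.

Lemma epsX_act r q : epsX (L r q) = act r (epsX q).
Proof.
have Ll := Lact_linl f' act_linl act_linr; have Lr := Lact_linr f' act_linl act_linr.
have le := epsX_lin.
move: q; apply: tens_ext => [||c x].
- exact: (lin_comp le (Lr _)).
- exact: (lin_comp (act_linr _) le).
move: c; apply: bar_ext => [||c].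
- exact: (lin_comp le (lin_comp (Lr _) (tpure_linl _))).
- exact: (lin_comp (act_linr _) (lin_comp le (tpure_linl _))).
move: r; apply: rbar_ext => [||[u a]].
- exact: (lin_comp le (Ll _)).
- exact: act_linl.
rewrite /rg /= (Lact_gen f' act_linl act_linr _ _ _ (homog_bw c)) (lin_sumE le) epsXE.
have /= E := @sum_cuts_nil _ X u (fun u1 u2 => epsX (sg ((wdeg u2 + hdeg a) * wdeg c) *:
  tpure (bmul (g (bw u1)) (bw c)) (act (tpure (bw u2) (hval a)) x))).
rewrite {}E => [|l w1 w2]; last first.
  by rewrite (linZ le) epsXE bar_eps_mul bar_eps_bmap bar_eps_bw mul0r scale0r scaler0.
rewrite (linZ le) epsXE bar_eps_mul bar_eps_bmap bar_eps1 mul1r (linZ (act_linr _)).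
rewrite bar_eps_bw; case: c => [|m c]; last by rewrite !scale0r scaler0.
by rewrite wdeg_nil mulr0 sg0 !scale1r.
Qed.

Definition deltaX : CX -> tens (bar A') CX :=
  tlift (fun c x => tmap id (fun c2 : bar A' => tpure c2 x) (bar_delta c)).

Let deltaX_linl (x : X) : linear (fun c => tmap id (fun c2 : bar A' => tpure c2 x) (bar_delta c)).
Proof. lin. Qed.
Let deltaX_linr c : linear (fun x : X => tmap id (fun c2 : bar A' => tpure c2 x) (bar_delta c)).
Proof.
move=> d x y; move: (bar_delta c); apply: tens_ext => [||p q]; try lin.
rewrite !tmapE; try lin.
by rewrite tpure_linr; apply: tpure_linr.
Qed.

Lemma deltaX_lin : linear deltaX.
Proof. exact: tlift_lin deltaX_linl deltaX_linr. Qed.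

Lemma deltaXE c x : deltaX (tpure c x) =
  tmap id (fun c2 : bar A' => tpure c2 x) (bar_delta c).
Proof. exact: tliftE deltaX_linl deltaX_linr c x. Qed.

(** The diagonal of BA' is equivariant for the action iterated on BA' (x) (BA' (x) X): this combines
    coassociativity of the coaction with multiplicativity of the diagonal. *)
Lemma deltaX_act r q : deltaX (L r q) = Lact f' L r (deltaX q).
Proof.
have Ll := Lact_linl f' act_linl act_linr; have Lr := Lact_linr f' act_linl act_linr.
have L2l := Lact_linl f' Ll Lr; have L2r := Lact_linr f' Ll Lr.
have le := deltaX_lin; have lid : linear (@id (bar A')) by [].
have lx (x : X) : linear (fun c2 : bar A' => tpure c2 x) by lin.
have lix x := tmap_lin lid (lx x).
move: q; apply: tens_ext => [||c x].
- exact: (lin_comp le (Lr _)).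
- exact: (lin_comp (L2r _) le).
move: c; apply: bar_ext => [||c].
- exact: (lin_comp le (lin_comp (Lr _) (tpure_linl _))).
- exact: (lin_comp (L2r _) (lin_comp le (tpure_linl _))).
move: r; apply: rbar_ext => [||[u a]].
- exact: (lin_comp le (Ll _)).
- exact: L2l.
pose T w1 w2 w3 : tens (bar A') CX := \sum_(r <- cuts c)
   sg ((wdeg w3 + hdeg a) * wdeg c + wdeg w2 * wdeg r.1) *:
     tpure (bmul (g (bw w1)) (bw r.1)) (tpure (bmul (g (bw w2)) (bw r.2))
       (act (tpure (bw w3) (hval a)) x)).
rewrite /rg /= (Lact_gen f' act_linl act_linr _ _ _ (homog_bw c)) (lin_sumE le).
transitivity (\sum_(p <- cuts u) \sum_(q <- cuts p.1) T q.1 q.2 p.2).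
  apply: eq_bigr => p _; rewrite (linZ le) deltaXE bmap_bw bar_delta_mul.
  rewrite (lin_sumE (lix _)) /wmap cuts_map big_map scaler_sumr; apply: eq_bigr => q _.
  rewrite -!/(wmap f' _) /= (lin_sumE (lix _)) scaler_sumr; apply: eq_bigr => r _.
  rewrite (linZ (lix _)) tmapE // scalerA -!/(wmap f' _) !bmap_bw wdeg_wmap.
  by congr (_ *: _); sgn.
have -> : \sum_(p <- cuts u) \sum_(q <- cuts p.1) T q.1 q.2 p.2 =
  \sum_(p <- cuts u) \sum_(q <- cuts p.2) T p.1 q.1 q.2 by exact: sum_cuts3.
rewrite deltaXE bar_delta_bw (lin_sumE (lix _)) (lin_sumE (L2r _)).
under [RHS]eq_bigr => r _.
  rewrite tmapE // (Lact_gen f' Ll Lr _ _ _ (homog_bw r.1)).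
  under eq_bigr => p _ do rewrite (Lact_gen f' act_linl act_linr _ _ _ (homog_bw r.2))
    (lin_sumE (tpure_linr _)) scaler_sumr.
  over.
rewrite [RHS]exchange_big; apply: eq_bigr => p _ /=.
rewrite [RHS]exchange_big /=; apply: eq_cuts => q qE.
rewrite /T; apply: eq_cuts => r rE; rewrite (linZ (tpure_linr _)) scalerA -qE -rE !wdeg_cat.
by congr (_ *: _); sgn.
Qed.

End LeftCoactionDifferential.

#[export] Hint Extern 1 (GRing.linear_for _ (brr _ _)) => exact: brr_linr : lin.
#[export] Hint Extern 1 (GRing.linear_for _ (fun x => brr _ x _)) => exact: brr_linl : lin.
#[export] Hint Extern 1 (GRing.linear_for _ (rmul _ _)) => exact: rmul_linr : lin.
#[export] Hint Extern 1 (GRing.linear_for _ (fun x => rmul _ x _)) => exact: rmul_linl : lin.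
#[export] Hint Extern 1 (GRing.linear_for _ (diffR _)) => exact: diffR_lin : lin.
#[export] Hint Extern 1 (GRing.linear_for _ (pR (A:=_) (A'':=_))) => exact: pR_lin : lin.

Section Parity.
Variables (k : comNzRingType) (A A' A'' : hga k).
Variables (f' : hga_mor A A') (f : hga_mor A A'').
Notation R := (rbarc A A'').
Notation J := (@pR k A A'').

Lemma pRK (r : R) : J (J r) = r.
Proof.
move: r; apply: rbar_ext => [||g]; try lin.
by rewrite pR_gen (linZ (@pR_lin k A A'')) pR_gen scalerA sgsq scale1r.
Qed.

Lemma pR1 : J (tpure (bw [::]) 1) = tpure (bw [::]) 1.
Proof. by rewrite pRE pC1 pA1. Qed.

Lemma diffR_pR (r : R) : diffR f (J r) = - J (diffR f r).
Proof.
move: r; apply: rbar_ext => [||[u a]]; try lin.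
rewrite /rg /= pRE !diffRE (linB (@pR_lin k A A'')) (linD (@pR_lin k A A'')) !pRE.
rewrite bar_diff_pC adiff_pA kap_word (lin_sumE (@pR_lin k A A'')).
rewrite (linN (tpure_linl _)) (linN (tpure_linr _)).
have -> : kap f (tpure (pC (bw u)) (pA (hval a))) =
  - \sum_(p <- cuts u) J (sg (wdeg p.1) *: tpure (bw p.1) (ft f (bw p.2) * hval a)).
  rewrite pC_bw pA_hel (linZ (tpure_linl _)) (linZ (tpure_linr _)).
  rewrite !(linZ (kap_lin f)) kap_word scalerA scaler_sumr -sumrN; apply: eq_cuts => p pE.
  have h : homog apr (wdeg p.2 + 1 + hdeg a) (ft f (bw p.2) * hval a).
    by apply: adga_mul; [apply: homog_ft|apply: hvalP].
  rewrite (linZ (@pR_lin k A A'')) pRE (pA_homog h) pC_bw (linZ (tpure_linl _))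
    (linZ (tpure_linr _)).
  by rewrite !scalerA -pE wdeg_cat -scaleNr; congr (_ *: _); sgn.
abel.
Qed.

Lemma pR_mul (r s : R) : J (rmul f r s) = rmul f (J r) (J s).
Proof.
have lj := @pR_lin k A A''; have rl := rmul_linl f; have rr := rmul_linr f.
move: r; apply: rbar_ext => [||[u a]].
- exact: (lin_comp lj (rl _)).
- exact: (lin_comp (rl _) lj).
move: s; apply: rbar_ext => [||[v b]].
- exact: (lin_comp lj (rr _)).
- exact: (lin_comp (rr _) lj).
rewrite !pR_gen (linZ (rl _)) (linZ (rr _)) rmul_gen /rterm (lin_sumE lj) scalerA scaler_sumr.
apply: eq_cuts => q qE; rewrite (linZ lj) pRE (pC_homog (homog_bmul u q.1)).
have h : homog apr (hdeg a + wdeg q.2 + hdeg b) (brr f (hval a) (bw q.2) * hval b).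
  by apply: adga_mul; [apply: homog_brr|apply: hvalP].
rewrite (pA_homog h) (linZ (tpure_linl _)) (linZ (tpure_linr _)) !scalerA /rgdeg /= -qE wdeg_cat.
by congr (_ *: _); sgn.
Qed.

Notation Q := (tens (bar A') R).
Notation L := (Lact f' (rmul f)).

Definition pQ : Q -> Q := tmap (@pC k A') J.

Lemma pQ_lin : linear pQ.
Proof. by apply: tmap_lin; lin. Qed.

Lemma pQE c s : pQ (tpure c s) = tpure (pC c) (J s).
Proof. by rewrite /pQ tmapE //; lin. Qed.

Lemma L_linl q : linear (fun r => L r q).
Proof. exact: Lact_linl (rmul_linl f) (rmul_linr f) q. Qed.

Lemma L_linr r : linear (L r).
Proof. exact: Lact_linr (rmul_linl f) (rmul_linr f) r. Qed.

Lemma pQ_L r q : pQ (L r q) = L (J r) (pQ q).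
Proof.
have lj := @pR_lin k A A''; have Ll := L_linl; have Lr := L_linr; have lq := pQ_lin.
move: q; apply: tens_ext => [||c x].
- exact: (lin_comp lq (Lr _)).
- exact: (lin_comp (Lr _) lq).
move: c; apply: bar_ext => [||c].
- exact: (lin_comp lq (lin_comp (Lr _) (tpure_linl _))).
- exact: (lin_comp (Lr _) (lin_comp lq (tpure_linl _))).
move: r; apply: rbar_ext => [||[u a]].
- exact: (lin_comp lq (Ll _)).
- exact: (lin_comp (Ll _) lj).
have lgen := Lact_gen f' (rmul_linl f) (rmul_linr f).
have hc := homog_bw c.
rewrite pR_gen pQE pC_bw (linZ (tpure_linl _)) (linZ (Lr _)) (linZ (Ll _)) /rg /=
  !(lgen _ _ _ _ _ hc).
rewrite (lin_sumE lq) !scaler_sumr; apply: eq_cuts => p pE; rewrite (linZ lq) pQE pR_mul.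
have pgen (w : word A) (b : hel A'') : J (tpure (bw w) (hval b)) =
   sg (wdeg w + hdeg b) *: tpure (bw w) (hval b) by exact: (pR_gen (w, b)).
rewrite pgen (linZ (rmul_linl _ _)).
have hgc : homog (@bar_pr k A') (wdeg p.1 + wdeg c) (bmul (bmap f' (bw p.1)) (bw c)).
  by rewrite bmap_bw -(wdeg_wmap f'); apply: homog_bmul.
rewrite (pC_homog hgc) (linZ (tpure_linl _)) (linZ (tpure_linr _)) !scalerA /rgdeg /= -pE wdeg_cat.
by congr (_ *: _); sgn.
Qed.

End Parity.

#[export] Hint Extern 1 (GRing.linear_for _ (pQ (A:=_) (A':=_) (A'':=_))) => exact: pQ_lin : lin.

(** * The Stasheff identities in bar form *)

Section Chains.
Variables (k : comNzRingType) (A A' A'' : hga k).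
Variables (f' : hga_mor A A') (f : hga_mor A A'').
Notation R := (rbarc A A'').
Notation Q := (tens (bar A') R).
Notation V := (bar2 A A' A'').
Notation L := (Lact f' (rmul f)).
Notation dR := (diffR f).
Notation J := (@pR k A A'').
Implicit Types (a b : A') (r s : R) (q z : Q) (x y v : V).

Let Ll := L_linl f' f.
Let Lr := L_linr f' f.
Let rl := rmul_linl f.
Let rr := rmul_linr f.
Let ldR := diffR_lin f.

Definition oneR : R := tpure (bw [::]) 1.
Definition oneQ : Q := tpure (bw [::]) oneR.
Definition dQ : Q -> Q := dCX dR.
Definition epsQ : Q -> R := @epsX k A' R.
Definition deltaQ : Q -> tens (bar A') Q := @deltaX k A' R.
Definition tau : Q -> V := tmap (@bar_t k A') id.
Definition tauQ (q : Q) : tens A' Q := tmap (@bar_t k A') id (deltaQ q).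
Definition TQ a : Q -> Q := tmap (brk a) id.

Lemma dQ_lin : linear dQ. Proof. exact: dCX_lin. Qed.
Lemma epsQ_lin : linear epsQ. Proof. exact: epsX_lin. Qed.
Lemma deltaQ_lin : linear deltaQ. Proof. exact: deltaX_lin. Qed.
Lemma tau_lin : linear tau. Proof. by apply: tmap_lin; lin. Qed.
Lemma tauQ_lin : linear tauQ.
Proof. by apply: (lin_comp _ deltaQ_lin); apply: tmap_lin; lin. Qed.
Lemma TQ_linr a : linear (TQ a). Proof. by apply: tmap_lin; lin. Qed.

Lemma dQE c s : dQ (tpure c s) = tpure (bar_diff c) s + tpure (pC c) (dR s).
Proof. exact: dCXE. Qed.
Lemma epsQE c s : epsQ (tpure c s) = bar_eps c *: s.
Proof. exact: epsXE. Qed.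
Lemma tauE c s : tau (tpure c s) = tpure (bar_t c) s.
Proof. by rewrite /tau tmapE //; lin. Qed.
Lemma TQE a c s : TQ a (tpure c s) = tpure (brk a c) s.
Proof. by rewrite /TQ tmapE //; lin. Qed.
Lemma deltaQE c s : deltaQ (tpure c s) = tmap id (fun c2 : bar A' => tpure c2 s) (bar_delta c).
Proof. exact: deltaXE. Qed.

Lemma tauQE c s : tauQ (tpure c s) = tmap id (fun c2 : bar A' => tpure c2 s) (uncons c).
Proof.
have l1 : linear (fun c2 : bar A' => tpure c2 s) by lin.
have l2 : linear (@id (bar A')) by []; have l3 : linear (@id A') by [].
have l4 : linear (@id Q) by []; have l5 := @bar_t_lin k A'.
have t1 := tmap_lin l2 l1; have t2 := tmap_lin l3 l1; have t3 := tmap_lin l5 l4; have t4 :=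
  tmap_lin l5 l2.
rewrite /tauQ deltaQE uncons_delta; move: (bar_delta c).
apply: tens_ext => [||c1 c2]; [exact: (lin_comp t3 t1)|exact: (lin_comp t2 t4)|].
by rewrite !tmapE.
Qed.

Lemma TQ_linl q : linear (fun a => TQ a q).
Proof.
move=> d a b; move: q; apply: tens_ext => [||c s]; [exact: TQ_linr| |].
  by apply: lin_add; [apply: lin_scale|]; apply: TQ_linr.
by rewrite !TQE brk_linl; apply: tpure_linl.
Qed.

Definition tl : tens A' Q -> Q := tlift TQ.

Lemma tl_lin : linear tl. Proof. exact: tlift_lin TQ_linl TQ_linr. Qed.
Lemma tlE a q : tl (tpure a q) = TQ a q.
Proof. exact: tliftE TQ_linl TQ_linr a q. Qed.

(** Lets the R-factor act on a second chain z; this is the multiplication that joins the two parts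
    of a chain in [deltaQ_Fch]. *)
Definition rtri (M : lmodType k) z : tens M R -> tens M Q :=
  tmap id (fun s => L s z).

Lemma rtri_linr M z : linear (@rtri M z).
Proof. by apply: tmap_lin => //; exact: Ll. Qed.
Lemma rtriE (M : lmodType k) z (m : M) s : rtri z (tpure m s) = tpure m (L s z).
Proof. by rewrite /rtri tmapE //; exact: Ll. Qed.

Let Phi0_linl q r : linear (fun a : A' => TQ a (L r q)).
Proof. exact: TQ_linl. Qed.
Let Phi0_linr q a : linear (fun r : R => TQ a (L r q)).
Proof. exact: (lin_comp (TQ_linr _) (Ll _)). Qed.

Definition Phi x q : Q := tlift (fun a r => TQ a (L r q)) x.

Lemma Phi_linl q : linear (fun x => Phi x q).
Proof. exact: tlift_lin (Phi0_linl q) (Phi0_linr q). Qed.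
Lemma PhiE a r q : Phi (tpure a r) q = TQ a (L r q).
Proof. exact: tliftE (Phi0_linl q) (Phi0_linr q) a r. Qed.
Lemma Phi_linr x : linear (Phi x).
Proof.
move=> d q z; move: x; apply: tens_ext => [||a r]; [exact: Phi_linl| |].
  by apply: lin_add; [apply: lin_scale|]; apply: Phi_linl.
by rewrite !PhiE Lr TQ_linr.
Qed.

Let Theta0_linl q r : linear (fun a : A' => lact (pA a) (tau (L r q))).
Proof. by lin. Qed.
Let Theta0_linr q a : linear (fun r : R => lact (pA a) (tau (L r q))).
Proof. exact: (lin_comp (lact_linr_ _) (lin_comp tau_lin (Ll _))). Qed.

Definition Theta x q : V := tlift (fun a r => lact (pA a) (tau (L r q))) x.

Lemma Theta_linl q : linear (fun x => Theta x q).
Proof. exact: tlift_lin (Theta0_linl q) (Theta0_linr q). Qed.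
Lemma ThetaE a r q : Theta (tpure a r) q = lact (pA a) (tau (L r q)).
Proof. exact: tliftE (Theta0_linl q) (Theta0_linr q) a r. Qed.
Lemma Theta_linr x : linear (Theta x).
Proof.
move=> d q z; move: x; apply: tens_ext => [||a r]; [exact: Theta_linl| |].
  by apply: lin_add; [apply: lin_scale|]; apply: Theta_linl.
by rewrite !ThetaE Lr tau_lin lact_linr_.
Qed.

Definition d0 : V -> V := fun v : V => tmap adiff id v + tmap (@pA k A') dR v.
Lemma d0_lin : linear d0.
Proof. by apply: lin_add; apply: tmap_lin; lin. Qed.
Lemma d0E a r : d0 (tpure a r) = tpure (adiff a) r + tpure (pA a) (dR r).
Proof. by rewrite /d0 !tmapE //; lin. Qed.

Definition pV : V -> V := tmap (@pA k A') J.
Lemma pV_lin : linear pV. Proof. by apply: tmap_lin; lin. Qed.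
Lemma pVE a r : pV (tpure a r) = tpure (pA a) (J r).
Proof. by rewrite /pV tmapE //; lin. Qed.

(** The parity operator for degrees lowered by one: in a chain, x contributes |x| - 1 because of its
    bracket, see [pQ_Fch]. *)
Definition nu x : V := - pV x.
Lemma nu_lin : linear nu. Proof. exact: lin_opp pV_lin. Qed.

Let augV_linl r : linear (fun a : A' => aug a *: r).
Proof. by apply: lin_scalel; apply: aug_lin. Qed.
Let augV_linr a : linear (fun r : R => aug a *: r).
Proof. by apply: lin_scale; apply: lin_id. Qed.
Definition augV : V -> R := tlift (fun a r => aug a *: r).
Lemma augV_lin : linear augV. Proof. exact: tlift_lin augV_linl augV_linr. Qed.
Lemma augVE a r : augV (tpure a r) = aug a *: r.
Proof. exact: tliftE augV_linl augV_linr a r. Qed.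

Definition rmulX (M : lmodType k) (v : tens M R) s : tens M R := tmap id (fun r => rmul f r s) v.
Lemma rmulX_linl M s : linear (fun v : tens M R => @rmulX M v s).
Proof. by apply: tmap_lin => //; exact: rl. Qed.
Lemma rmulXE (M : lmodType k) (m : M) r s : rmulX (tpure m r) s = tpure m (rmul f r s).
Proof. by rewrite /rmulX tmapE //; exact: rl. Qed.
Lemma rmulX_linr M (v : tens M R) : linear (@rmulX M v).
Proof.
move=> d s1 s2; move: v; apply: tens_ext => [||m r]; [exact: rmulX_linl| |].
  by apply: lin_add; [apply: lin_scale|]; apply: rmulX_linl.
by rewrite !rmulXE rr; apply: tpure_linr.
Qed.

Definition xi x y : V := rmulX (pV x) (augV y).

Definition ftau : tens A' Q -> V := tlift (fun b z => lact (pA b) (tau z)).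
Let ftau_linl z : linear (fun b : A' => lact (pA b) (tau z)).
Proof. by lin. Qed.
Let ftau_linr b : linear (fun z => lact (pA b) (tau z)).
Proof. exact: (lin_comp (lact_linr_ _) tau_lin). Qed.
Lemma ftau_lin : linear ftau. Proof. exact: tlift_lin ftau_linl ftau_linr. Qed.
Lemma ftauE b z : ftau (tpure b z) = lact (pA b) (tau z).
Proof. exact: tliftE ftau_linl ftau_linr b z. Qed.

(** Rewriting [bar_diff_brk] with a in place of [abar a] in the quadratic term leaves the last
    summand, the source of the head and tail terms in [dQ_Fch]. *)
Lemma dQ_TQ a q : dQ (TQ a q) = - TQ (adiff a) q - TQ (pA a) (dQ q)
  - tl (lact (pA a) (tauQ q)) + aug a *: (q - tpure (bw [::]) (epsQ q)).
Proof.
have ltq := TQ_linr; have ldq := dQ_lin; have lt := tauQ_lin; have ltl := tl_lin; have le :=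
  epsQ_lin.
move: q; apply: tens_ext => [||c s].
- exact: (lin_comp ldq (ltq _)).
- apply: lin_add; last first.
    apply: lin_scale; apply: lin_add; first exact: lin_id.
    by apply: lin_opp; exact: (lin_comp (tpure_linr _) le).
  apply: lin_add; last by apply: lin_opp; exact: (lin_comp ltl (lin_comp (lact_linr_ _) lt)).
  by apply: lin_add; apply: lin_opp; [exact: ltq|exact: (lin_comp (ltq _) ldq)].
have l1 : linear (fun c2 : bar A' => tpure c2 s) by lin.
have l2 : linear (@id A') by []; have t1 := tmap_lin l2 l1.
have E b D : tl (lact b (tmap id (fun c2 : bar A' => tpure c2 s) D)) = tpure (SS (lact b D)) s.
  move: D; apply: tens_ext => [||a' c'].
  - exact: (lin_comp ltl (lin_comp (lact_linr_ _) t1)).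
  - exact: (lin_comp l1 (lin_comp (@SS_lin k A') (lact_linr_ _))).
  by rewrite tmapE // !lactE tlE TQE.
rewrite !TQE !dQE (linD (ltq _)) !TQE tauQE E epsQE.
have -> : SS (lact (pA a) (uncons c)) = SS (lact (pA (abar a)) (uncons c)) + aug a *:
  (c - bar_eps c *: bw [::]).
  have -> : pA a = pA (abar a) + aug a *: 1.
    by rewrite /abar (linB (@pA_lin k A')) (linZ (@pA_lin k A')) pA1 subrK.
  rewrite (linD (lact_linl_ _)) (linZ (lact_linl_ _)) lact1 (linD (@SS_lin k A'))
    (linZ (@SS_lin k A')).
  by congr (_ + _ *: _); rewrite {2}[c]bar_decomp addrC addKr.
rewrite bar_diff_brk pC_brk !(linD (tpure_linl _)) !(linN (tpure_linl _)) (linZ (tpure_linl _)).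
rewrite (linB (tpure_linl _)) (linZ (tpure_linl _)) -(linZ (tpure_linr _)).
abel.
Qed.

(** The twisting equation for t, tensored with R; [ftau] after [tauQ] is the quadratic term. *)
Lemma d0_tau q : d0 (tau q) = - tau (dQ q) - ftau (tauQ q).
Proof.
have lt := tau_lin; have ldq := dQ_lin; have ltq := tauQ_lin; have lf := ftau_lin; have ld :=
  d0_lin.
move: q; apply: tens_ext => [||c s].
- exact: (lin_comp ld lt).
- by apply: lin_add; apply: lin_opp; [exact: (lin_comp lt ldq)|exact: (lin_comp lf ltq)].
have l1 : linear (fun c2 : bar A' => tpure c2 s) by lin.
have l2 : linear (@id A') by []; have t1 := tmap_lin l2 l1.
have ll (d : bar A') : linear (fun a : A' => pA a * bar_t d) by lin.
have lr (a : A') : linear (fun d : bar A' => pA a * bar_t d) by lin.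
have lm := tlift_lin ll lr.
have -> : ftau (tauQ (tpure c s)) = tpure (tlift (fun (a : A') c => pA a * bar_t c) (uncons c)) s.
  rewrite tauQE; move: (uncons c); apply: tens_ext => [||a' c'].
  - exact: (lin_comp lf t1).
  - exact: (lin_comp (tpure_linl _) lm).
  by rewrite tmapE // ftauE tauE lactE tliftE.
rewrite tauE d0E dQE (linD lt) !tauE bar_t_pC (linN (tpure_linl _)).
have -> : adiff (bar_t c) = - bar_t (bar_diff c) - tlift (fun (a : A') c => pA a * bar_t c)
  (uncons c).
  by have := bar_t_twisting c; rewrite cup_uncons => <-; rewrite addrC addrK.
rewrite (linB (tpure_linl _)) (linN (tpure_linl _)); abel.
Qed.

End Chains.

Section BarStasheff.
Variables (k : comNzRingType) (A A' A'' : hga k).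
Variables (f' : hga_mor A A') (f : hga_mor A A'').
Notation R := (rbarc A A'').
Notation Q := (tens (bar A') R).
Notation V := (bar2 A A' A'').
Notation L := (Lact f' (rmul f)).
Notation dR := (diffR f).
Notation J := (@pR k A A'').
Notation oneQ := (@oneQ k A A' A'').
Notation oneR := (@oneR k A A'').
Notation Phi := (Phi f' f).
Notation Theta := (Theta f' f).
Notation d0 := (@d0 k A A' A'' f).
Notation nu := (@nu k A A' A'').
Notation augV := (@augV k A A' A'').
Notation tau := (@tau k A A' A'').
Notation dQ := (@dQ k A A' A'' f).
Notation deltaQ := (@deltaQ k A A' A'').
Notation tauQ := (@tauQ k A A' A'').
Notation xi := (@xi k A A' A'' f).
Implicit Types (a b : A') (r s : R) (q z : Q) (x y v : V) (xs : seq V).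

Let Ll := L_linl f' f.
Let Lr := L_linr f' f.
Let rl := rmul_linl f.
Let rr := rmul_linr f.
Let ldR := diffR_lin f.
Let ldQ : linear dQ := @dQ_lin k A A' A'' f.
Let lPhil := Phi_linl f' f.
Let lThl := Theta_linl f' f.
Let ltau : linear tau := @tau_lin k A A' A''.
Let lD : linear deltaQ := @deltaQ_lin k A A' A''.
Let ld0 : linear d0 := @d0_lin k A A' A'' f.
Let lnu : linear nu := @nu_lin k A A' A''.
Let laug : linear augV := @augV_lin k A A' A''.

(* By Fch_gens, the first factor of Fch (x_2, ..., x_n) is S h_(n-1) of the    *)
(* left parts and the second one the product of the right parts, up to signs.  *)
Definition Fch xs : Q := foldr Phi oneQ xs.

Lemma L_oneR q : L oneR q = q.
Proof. by apply: (Lact_unit f' (rmul_linl f) (rmul_linr f)) => x; apply: rmul_unitl. Qed.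

Lemma L_mul r s q : L r (L s q) = L (rmul f r s) q.
Proof. by apply: (LactA f' rl rr) => *; apply: rmulA. Qed.

Lemma dQ_L r q : dQ (L r q) = L (dR r) q + L (J r) (dQ q).
Proof. exact: (dCX_act f' rl rr ldR (diffR_mul f)). Qed.

Lemma epsQ_L r q : epsQ (L r q) = rmul f r (epsQ q).
Proof. exact: (epsX_act f' rl rr). Qed.

Lemma epsQ_TQ a q : epsQ (TQ a q) = 0.
Proof.
move: q; apply: tens_ext => [||c s]; [exact:
  (lin_comp (@epsQ_lin k A A' A'') (@TQ_linr k A A' A'' a))|lin|].
by rewrite TQE epsQE bar_eps_brk scale0r.
Qed.

Lemma epsQ_Fch xs : epsQ (Fch xs) = if xs is [::] then oneR else 0.
Proof.
case: xs => [|x xs]; first by rewrite epsQE bar_eps1 scale1r.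
have le := @epsQ_lin k A A' A''.
move: x; rewrite /Fch /= -/(Fch xs); apply: tens_ext => [||a r];
  [exact: (lin_comp le (lPhil _))|lin|].
by rewrite PhiE epsQ_TQ.
Qed.

Lemma deltaQ_L r q : deltaQ (L r q) = Lact f' L r (deltaQ q).
Proof. exact: (deltaX_act f' rl rr). Qed.

Lemma Lact_rtri r z q : Lact f' L r (rtri f' f z q) = rtri f' f z (L r q).
Proof.
have lt := rtri_linr f' f z; have L2l := Lact_linl f' Ll Lr; have L2r := Lact_linr f' Ll Lr.
move: q; apply: tens_ext => [||c s].
- exact: (lin_comp (L2r _) (lt _)).
- exact: (lin_comp (lt _) (Lr _)).
move: c; apply: bar_ext => [||c].
- exact: (lin_comp (L2r _) (lin_comp (lt _) (tpure_linl _))).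
- exact: (lin_comp (lt _) (lin_comp (Lr _) (tpure_linl _))).
move: r; apply: rbar_ext => [||[u a]]; [exact: L2l|exact: (lin_comp (lt _) (Ll _))|].
rewrite rtriE /rg /= (Lact_gen f' Ll Lr _ _ _ (homog_bw c)) (Lact_gen f' rl rr _ _ _ (homog_bw c)).
rewrite (lin_sumE (lt _)); apply: eq_bigr => p _.
by rewrite (linZ (lt _)) rtriE L_mul.
Qed.

Lemma deltaQ_TQ a q :
  deltaQ (TQ a q) = tpure (bw [::]) (TQ a q) + tmap (brk a) id (deltaQ q).
Proof.
have lT := @TQ_linr k A A' A'' a; have li : linear (@id Q) by [].
have lb := tmap_lin (@brk_linr k A' a) li.
move: q; apply: tens_ext => [||c s]; [exact: (lin_comp lD lT)| |].
  by apply: lin_add; [exact: (lin_comp (tpure_linr _) lT)|exact: (lin_comp lb lD)].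
have l1 : linear (fun c2 : bar A' => tpure c2 s) by lin.
have l2 : linear (@id (bar A')) by []; have t1 := tmap_lin l2 l1.
rewrite TQE !deltaQE bar_delta_brk (linD t1) tmapE //; congr (_ + _).
have lb2 := tmap_lin (@brk_linr k A' a) l2.
move: (bar_delta c); apply: tens_ext => [||c1 c2];
  [exact: (lin_comp t1 lb2)|exact: (lin_comp lb t1)|].
by rewrite !tmapE //; lin.
Qed.

(** By induction: a bracket in front is either cut off before x or kept with the first part, and the
    action of r passes to the first part of a smaller decomposition by [deltaQ_L] and
    [Lact_rtri]. *)
Lemma deltaQ_Fch xs : deltaQ (Fch xs) =
  \sum_(p <- cuts xs) rtri f' f (Fch p.2) (Fch p.1).
Proof.
have lt := rtri_linr f' f.
elim: xs => [|x xs IH].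
  by rewrite cuts_nil big_seq1 /= rtriE L_oneR deltaQE bar_delta1 tmapE //; lin.
rewrite cuts_cons big_cons big_map /= -/(Fch xs) rtriE L_oneR.
move: x; apply: tens_ext => [||a r].
- exact: (lin_comp lD (lPhil _)).
- apply: lin_add; first exact: (lin_comp (tpure_linr _) (lPhil _)).
  by apply: lin_sum => p; exact: (lin_comp (lt _ _) (lPhil _)).
rewrite PhiE deltaQ_TQ deltaQ_L IH; congr (_ + _).
have L2r := Lact_linr f' Ll Lr; have li : linear (@id Q) by [].
have lb := tmap_lin (@brk_linr k A' a) li.
rewrite (lin_sumE (L2r _)) (lin_sumE lb); apply: eq_bigr => p _.
rewrite Lact_rtri PhiE; move: (L r _); apply: tens_ext => [||c s].
- exact: (lin_comp lb (lt _ _)).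
- exact: (lin_comp (lt _ _) (@TQ_linr k A A' A'' a)).
by rewrite TQE !rtriE tmapE //; lin.
Qed.

Lemma tauQ_L_Fch r xs : tauQ (L r (Fch xs)) =
  \sum_(p <- cuts xs) rtri f' f (Fch p.2) (tau (L r (Fch p.1))).
Proof.
have lt := rtri_linr f' f; have L2r := Lact_linr f' Ll Lr; have li : linear (@id Q) by [].
have lb := tmap_lin (@bar_t_lin k A') li.
rewrite /tauQ deltaQ_L deltaQ_Fch (lin_sumE (L2r _)) (lin_sumE lb); apply: eq_bigr => p _.
rewrite Lact_rtri; move: (L r _); apply: tens_ext => [||c s].
- exact: (lin_comp lb (lt _ _)).
- exact: (lin_comp (lt _ _) ltau).
by rewrite tauE !rtriE tmapE //; lin.
Qed.

Lemma tl_rtri b z v : tl (lact b (rtri f' f z v)) = Phi (lact b v) z.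
Proof.
have lt := rtri_linr f' f; have ltl := @tl_lin k A A' A''.
move: v; apply: tens_ext => [||a s].
- exact: (lin_comp ltl (lin_comp (lact_linr_ _) (lt _ _))).
- exact: (lin_comp (lPhil _) (lact_linr_ _)).
by rewrite rtriE !lactE tlE PhiE.
Qed.

Lemma ftau_rtri z v : ftau (rtri f' f z v) = Theta v z.
Proof.
have lt := rtri_linr f' f; have ltl := @ftau_lin k A A' A''.
move: v; apply: tens_ext => [||a s].
- exact: (lin_comp ltl (lt _ _)).
- exact: lThl.
by rewrite rtriE ftauE ThetaE.
Qed.

(** The part of beta that involves t; [gam] contains the rest. On a single argument it is the left
    twisting term of the differential, see [Theta_g2_oneQ]. *)
Definition btl xs : V := if xs is x :: s then Theta x (Fch s) else 0.

Definition gam xs : V :=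
  match xs with
  | [:: x] => d0 x
  | [:: x; y] => xi x y
  | _ => 0
  end.

(* beta_1 is the differential of B(A', A, A''), and beta_n is m_n up to the    *)
(* signs absorbed by twist; see bar2_m_twist.                                  *)
Definition beta xs : V := btl xs + gam xs.

Lemma beta_nil : beta [::] = 0. Proof. exact: addr0. Qed.

Lemma lact_Theta b v z : Theta (lact b v) z = lact (pA b) (Theta v z).
Proof.
move: v; apply: tens_ext => [||a s]; [exact: (lin_comp (lThl _) (lact_linr_ _))|exact:
  (lin_comp (lact_linr_ _) (lThl _))|].
by rewrite lactE !ThetaE lactA pA_mul.
Qed.

Lemma d0_lact b v : d0 (lact b v) = lact (adiff b) v + lact (pA b) (d0 v).
Proof.
move: v; apply: tens_ext => [||a s].
- exact: (lin_comp ld0 (lact_linr_ _)).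
- by apply: lin_add; [exact: lact_linr_|exact: (lin_comp (lact_linr_ _) ld0)].
rewrite !lactE !d0E (linD (lact_linr_ _)) !lactE adiff_mul pA_mul (linD (tpure_linl _)).
by rewrite addrA.
Qed.

(** The quadratic term of [dQ_TQ] becomes, by [tauQ_L_Fch], the sum in which x absorbs an initial
    segment of xs. The counit term survives for empty xs only, as a nonempty chain starts with a
    bracket. *)
Lemma dQ_Phi x xs : dQ (Phi x (Fch xs)) = - Phi (d0 x) (Fch xs) + Phi (nu x) (dQ (Fch xs))
  - \sum_(p <- cuts xs) Phi (btl (x :: p.1)) (Fch p.2)
  + L (augV x) (Fch xs) - (if xs is [::] then tpure (bw [::]) (augV x) else 0).
Proof.
have lsum : linear (fun x => \sum_(p <- cuts xs) Phi (btl (x :: p.1)) (Fch p.2)).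
  by apply: lin_sum => p; exact: (lin_comp (lPhil _) (lThl _)).
have ltl := @tl_lin k A A' A''.
move: x; apply: tens_ext => [||a r].
- exact: (lin_comp ldQ (lPhil _)).
- apply: lin_add; first (apply: lin_add; last exact: (lin_comp (Ll _) laug)).
    apply: lin_add; last by apply: lin_opp; exact: lsum.
    by apply: lin_add; [apply: lin_opp; exact: (lin_comp (lPhil _) ld0)|exact:
      (lin_comp (lPhil _) lnu)].
  apply: lin_opp; case: (xs) => [|? ?]; last lin.
  exact: (lin_comp (tpure_linr _) laug).
rewrite PhiE dQ_TQ dQ_L epsQ_L epsQ_Fch tauQ_L_Fch.
rewrite (linD (@TQ_linr k A A' A'' _)) (lin_sumE (lact_linr_ _)) (lin_sumE ltl).
rewrite d0E /nu pVE (linD (lPhil _)) (linN (lPhil _)) !PhiE augVE (linZ (Ll _)) scalerBr.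
have -> : \sum_(p <- cuts xs) tl (lact (pA a) (rtri f' f (Fch p.2) (tau (L r (Fch p.1))))) =
  \sum_(p <- cuts xs) Phi (btl (tpure a r :: p.1)) (Fch p.2).
  by apply: eq_bigr => p _; rewrite tl_rtri /= ThetaE.
have -> : aug a *: tpure (bw [::]) (rmul f r (if xs is [::] then oneR else 0)) =
  (if xs is [::] then tpure (bw [::]) (aug a *: r) else 0) :> Q.
  case: (xs) => [|? ?]; first by rewrite rmul_unitr (linZ (tpure_linr _)).
  by rewrite (lin0 (rr _)) (lin0 (tpure_linr _)) scaler0.
abel.
Qed.

End BarStasheff.

Section BarStasheff2.
Variables (k : comNzRingType) (A A' A'' : hga k).
Variables (f' : hga_mor A A') (f : hga_mor A A'').
Notation R := (rbarc A A'').
Notation Q := (tens (bar A') R).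
Notation V := (bar2 A A' A'').
Notation L := (Lact f' (rmul f)).
Notation dR := (diffR f).
Notation J := (@pR k A A'').
Notation oneQ := (@oneQ k A A' A'').
Notation oneR := (@oneR k A A'').
Notation Phi := (Phi f' f).
Notation Theta := (Theta f' f).
Notation d0 := (@d0 k A A' A'' f).
Notation nu := (@nu k A A' A'').
Notation pV := (@pV k A A' A'').
Notation augV := (@augV k A A' A'').
Notation tau := (@tau k A A' A'').
Notation dQ := (@dQ k A A' A'' f).
Notation rmulX := (rmulX f).
Notation xi := (@xi k A A' A'' f).
Notation Fch := (Fch f' f).
Notation btl := (btl f' f).
Notation gam := (@gam k A A' A'' f).
Notation beta := (beta f' f).
Implicit Types (a b : A') (r s : R) (q z : Q) (x y v : V) (xs : seq V).

Let Ll := L_linl f' f.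
Let Lr := L_linr f' f.
Let rl := rmul_linl f.
Let rr := rmul_linr f.
Let ldR := diffR_lin f.
Let lJ := @pR_lin k A A''.
Let lPhil := Phi_linl f' f.
Let lPhir := Phi_linr f' f.
Let lThl := Theta_linl f' f.
Let lThr := Theta_linr f' f.
Let ltau : linear tau := @tau_lin k A A' A''.
Let ld0 : linear d0 := @d0_lin k A A' A'' f.
Let lnu : linear nu := @nu_lin k A A' A''.
Let lpV : linear pV := @pV_lin k A A' A''.
Let laug : linear augV := @augV_lin k A A' A''.
Let lXl (M : lmodType k) s : linear (fun v : tens M R => rmulX v s) := rmulX_linl f s.
Let lXr (M : lmodType k) (v : tens M R) : linear (rmulX v) := rmulX_linr f v.

Lemma xi_linl y : linear (fun x => xi x y).
Proof. exact: (lin_comp (lXl _) lpV). Qed.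

Lemma xi_linr x : linear (xi x).
Proof. exact: (lin_comp (lXr _) laug). Qed.

Lemma rmulX_L r q s : rmulX (L r q) s = L r (rmulX q s).
Proof.
move: q; apply: tens_ext => [||c t].
- exact: (lin_comp (lXl s) (Lr r)).
- exact: (lin_comp (Lr r) (lXl s)).
move: c; apply: bar_ext => [||c].
- exact: (lin_comp (lXl s) (lin_comp (Lr r) (tpure_linl _))).
- exact: (lin_comp (Lr r) (lin_comp (lXl s) (tpure_linl _))).
move: r; apply: rbar_ext => [||[u a]].
- exact: (lin_comp (lXl s) (Ll _)).
- exact: Ll.
rewrite rmulXE /rg /= !(Lact_gen f' rl rr _ _ _ (homog_bw c)) (lin_sumE (lXl s)).
by apply: eq_bigr => p _; rewrite (linZ (lXl s)) rmulXE -rmulA.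
Qed.

Lemma rmulX_Phi x q s : rmulX (Phi x q) s = Phi x (rmulX q s).
Proof.
move: x; apply: tens_ext => [||a r]; [exact: (lin_comp (lXl s) (lPhil _))|exact: lPhil|].
rewrite !PhiE -rmulX_L; move: (L r q); apply: tens_ext => [||c t].
- exact: (lin_comp (lXl s) (@TQ_linr k A A' A'' a)).
- exact: (lin_comp (@TQ_linr k A A' A'' a) (lXl s)).
by rewrite TQE !rmulXE TQE.
Qed.

Lemma rmulX_Theta x q s : rmulX (Theta x q) s = Theta x (rmulX q s).
Proof.
move: x; apply: tens_ext => [||a r]; [exact: (lin_comp (lXl s) (lThl _))|exact: lThl|].
rewrite !ThetaE -rmulX_L; move: (L r q); apply: tens_ext => [||c t].
- exact: (lin_comp (lXl s) (lin_comp (lact_linr_ _) ltau)).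
- exact: (lin_comp (lact_linr_ _) (lin_comp ltau (lXl s))).
by rewrite tauE lactE !rmulXE tauE lactE.
Qed.

Lemma Phi_rmulX x s q : Phi (rmulX x s) q = Phi x (L s q).
Proof.
move: x; apply: tens_ext => [||a r]; [exact: (lin_comp (lPhil _) (lXl s))|exact: lPhil|].
by rewrite rmulXE !PhiE L_mul.
Qed.

Lemma Theta_rmulX x s q : Theta (rmulX x s) q = Theta x (L s q).
Proof.
move: x; apply: tens_ext => [||a r]; [exact: (lin_comp (lThl _) (lXl s))|exact: lThl|].
by rewrite rmulXE !ThetaE L_mul.
Qed.

Lemma xi_nu x y : xi x y = - rmulX (nu x) (augV y).
Proof. by rewrite /xi /nu (linN (lXl _)) opprK. Qed.

Lemma Phi_nu_L x y q : Phi (nu x) (L (augV y) q) = - Phi (xi x y) q.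
Proof. by rewrite -Phi_rmulX xi_nu (linN (lPhil _)) opprK. Qed.

Lemma Theta_nu_L x y q : Theta (nu x) (L (augV y) q) = - Theta (xi x y) q.
Proof. by rewrite -Theta_rmulX xi_nu (linN (lThl _)) opprK. Qed.

(** Since [gam] vanishes on more than two arguments, x can absorb at most one further entry. *)
Lemma gam_sum (M : lmodType k) (G : V -> seq V -> M) x xs :
  (forall t, linear (fun v => G v t)) ->
  \sum_(q <- cuts xs) G (gam (x :: q.1)) q.2 =
  G (d0 x) xs + (if xs is y :: xs' then G (xi x y) xs' else 0).
Proof.
move=> lG; case: xs => [|y [|z xs]].
- by rewrite cuts_nil big_seq1 addr0.
- by rewrite cuts_cons cuts_nil !(big_cons, big_nil) /= addr0.
rewrite !cuts_cons !(big_cons, big_map) /= big1 ?addr0 // => p _.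
exact: (lin0 (lG _)).
Qed.

Definition head_term xs : Q := if xs is x :: s then L (augV x) (Fch s) else 0.

Definition tail_term xs : Q :=
  if xs is x :: s then rmulX (Fch (map nu (belast x s))) (augV (last x s)) else 0.

Lemma Fch_cons x xs : Fch (x :: xs) = Phi x (Fch xs). Proof. by []. Qed.

(** In the induction step, [Phi (nu x)] turns the head term of the shorter chain into the missing
    inner operation [xi x y], by [Phi_nu_L], and its tail term into the tail term of the longer
    chain. For a chain of length one the tail term is the counit term of [dQ_Phi]. *)
Lemma dQ_Fch xs : dQ (Fch xs) =
  - (\sum_(p <- cuts xs) \sum_(q <- cuts p.2) Fch (map nu p.1 ++ beta q.1 :: q.2))
  + head_term xs - tail_term xs.
Proof.
elim: xs => [|x xs IH].
  rewrite !(cuts_nil, big_seq1) /= beta_nil (lin0 (lPhil _)) oppr0 !addr0.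
  rewrite /oneQ dQE bar_diff1 (lin0 (tpure_linl _)) /oneR diffR1 (lin0 (tpure_linr _)) //.
  by rewrite add0r.
rewrite Fch_cons dQ_Phi IH (linB (lPhir _)) (linD (lPhir _)) (linN (lPhir _)).
rewrite [cuts (x :: xs)]cuts_cons big_cons big_map /= cuts_cons big_cons big_map /=.
rewrite beta_nil (lin0 (lPhil _)) add0r.
have -> : \sum_(p <- cuts xs) Phi (beta (x :: p.1)) (foldr Phi oneQ p.2) =
   \sum_(p <- cuts xs) Phi (btl (x :: p.1)) (Fch p.2)
   + (Phi (d0 x) (Fch xs) + (if xs is y :: xs' then Phi (xi x y) (Fch xs') else 0)).
  rewrite -(gam_sum (G := fun v t => Phi v (Fch t))) // -big_split; apply: eq_bigr => p _ /=.
  by rewrite {1}/beta (linD (lPhil _)).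
have -> : \sum_(j <- cuts xs) \sum_(q <- cuts j.2)
    Phi (nu x) (foldr Phi oneQ ([seq nu i | i <- j.1] ++ beta q.1 :: q.2)) =
   Phi (nu x) (\sum_(p <- cuts xs) \sum_(q <- cuts p.2) Fch (map nu p.1 ++ beta q.1 :: q.2)).
  by rewrite (lin_sumE (lPhir _)); apply: eq_bigr => p _; rewrite (lin_sumE (lPhir _)).
have -> : Phi (nu x) (head_term xs) = - (if xs is y :: xs' then Phi (xi x y) (Fch xs') else 0).
  by case: (xs) => [|y xs']; rewrite ?(lin0 (lPhir _)) ?oppr0 //= Phi_nu_L.
have -> : rmulX (Fch (map nu (belast x xs))) (augV (last x xs)) =
   Phi (nu x) (tail_term xs) + (if xs is [::] then tpure (bw [::]) (augV x) else 0).
  case: (xs) => [|y xs'] /=; last by rewrite rmulX_Phi addr0.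
  by rewrite (lin0 (lPhir _)) add0r /oneQ rmulXE rmul_unitl.
abel.
Qed.

(** The quadratic term of [d0_tau] contains t twice; by [tauQ_L_Fch] it is the sum of the operations
    [btl] inserted as first argument of another one. *)
Lemma d0_btl x xs : d0 (btl (x :: xs)) =
  - Theta (d0 x) (Fch xs) + Theta (nu x) (dQ (Fch xs))
  - \sum_(p <- cuts xs) Theta (btl (x :: p.1)) (Fch p.2).
Proof.
have lsum : linear (fun x => \sum_(p <- cuts xs) Theta (btl (x :: p.1)) (Fch p.2)).
  by apply: lin_sum => p; exact: (lin_comp (lThl _) (lThl _)).
have ltl := @ftau_lin k A A' A''.
move: x; apply: tens_ext => [||a r].
- exact: (lin_comp ld0 (lThl _)).
- apply: lin_add; last by apply: lin_opp; exact: lsum.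
  by apply: lin_add; [apply: lin_opp; exact: (lin_comp (lThl _) ld0)|exact:
    (lin_comp (lThl _) lnu)].
rewrite /= ThetaE d0_lact d0_tau dQ_L tauQ_L_Fch (lin_sumE ltl) (linD ltau).
rewrite d0E /nu pVE (linD (lThl _)) (linN (lThl _)) !ThetaE !pAK adiff_pA.
rewrite !(linB (lact_linr_ _)) (linN (lact_linr_ _)) (linD (lact_linr_ _)) (linN (lact_linl_ _)).
have -> : \sum_(p <- cuts xs) Theta (Theta (tpure a r) (Fch p.1)) (Fch p.2) =
   lact a (\sum_(i <- cuts xs) ftau (rtri f' f (Fch i.2) (tau (L r (Fch i.1))))).
  rewrite (lin_sumE (lact_linr_ _)); apply: eq_bigr => p _.
  by rewrite ThetaE lact_Theta pAK ftau_rtri.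
abel.
Qed.

Lemma pQ_Fch xs : pQ (Fch xs) = Fch (map nu xs).
Proof.
have lq : linear (@pQ k A A' A'') := @pQ_lin k A A' A''.
elim: xs => [|x xs IH]; first by rewrite /= /oneQ pQE pC1 pR1.
rewrite /= -!/(Fch _) -IH; move: x; apply: tens_ext => [||a r].
- exact: (lin_comp lq (lPhil _)).
- exact: (lin_comp (lPhil _) lnu).
rewrite /nu pVE (linN (lPhil _)) !PhiE -pQ_L; move: (L r _); apply: tens_ext => [||c s].
- exact: (lin_comp lq (@TQ_linr k A A' A'' a)).
- apply: lin_opp; exact: (lin_comp (@TQ_linr k A A' A'' _) lq).
by rewrite TQE !pQE TQE pC_brk (linN (tpure_linl _)).
Qed.

Lemma pV_btl xs : pV (btl xs) = btl (map nu xs).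
Proof.
case: xs => [|x xs] /=; first exact: (lin0 lpV).
rewrite -pQ_Fch; move: x; apply: tens_ext => [||a r].
- exact: (lin_comp lpV (lThl _)).
- exact: (lin_comp (lThl _) lnu).
rewrite /nu pVE (linN (lThl _)) !ThetaE -pQ_L pAK; move: (L r _); apply: tens_ext => [||c s].
- exact: (lin_comp lpV (lin_comp (lact_linr_ _) ltau)).
- apply: lin_opp; exact: (lin_comp (lact_linr_ _) (lin_comp ltau (@pQ_lin k A A' A''))).
by rewrite pQE !tauE !lactE pVE pA_mul pAK bar_t_pC mulrN (linN (tpure_linl _)) opprK.
Qed.

Lemma augV_Theta x q : augV (Theta x q) = 0.
Proof.
move: x; apply: tens_ext => [||a r]; [exact: (lin_comp laug (lThl _))|lin|].
rewrite ThetaE; move: (L r q); apply: tens_ext => [||c s].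
- exact: (lin_comp laug (lin_comp (lact_linr_ _) ltau)).
- lin.
by rewrite tauE lactE augVE rmorphM /= aug_bar_t mulr0 scale0r.
Qed.

(** The values of t lie in the augmentation ideal. Hence the augmentation only sees [gam], which
    also settles the augmentation identities for all m_n. *)
Lemma augV_btl xs : augV (btl xs) = 0.
Proof. by case: xs => [|x xs] /=; [exact: (lin0 laug)|exact: augV_Theta]. Qed.

Lemma augV_d0 x : augV (d0 x) = dR (augV x).
Proof.
move: x; apply: tens_ext => [||a r]; [exact: (lin_comp laug ld0)|exact: (lin_comp ldR laug)|].
by rewrite d0E (linD laug) !augVE adga_aug_diff aug_pA scale0r add0r (linZ ldR).
Qed.

Lemma d0_d0 x : d0 (d0 x) = 0.
Proof.
move: x; apply: tens_ext => [||a r]; [exact: (lin_comp ld0 ld0)|lin|].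
rewrite d0E (linD ld0) !d0E diffR2 (cx_square (adga_complex A')) adiff_pA.
rewrite (lin0 (tpure_linl _)) (lin0 (tpure_linr _)) (linN (tpure_linl _)); abel.
Qed.

Lemma pV_K x : pV (pV x) = x.
Proof.
move: x; apply: tens_ext => [||a r]; [exact: (lin_comp lpV lpV)|lin|].
by rewrite !pVE pAK pRK.
Qed.

Lemma d0_pV x : d0 (pV x) = - pV (d0 x).
Proof.
move: x; apply: tens_ext => [||a r]; [exact: (lin_comp ld0 lpV)|exact:
  (lin_opp (lin_comp lpV ld0))|].
rewrite pVE !d0E (linD lpV) !pVE adiff_pA diffR_pR pAK (linN (tpure_linl _)) (linN (tpure_linr _)).
by rewrite opprD.
Qed.

Lemma d0_rmulX v s : d0 (rmulX v s) = rmulX (d0 v) s + rmulX (pV v) (dR s).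
Proof.
move: v; apply: tens_ext => [||a r]; [exact: (lin_comp ld0 (lXl _))| |].
  by apply: lin_add; [exact: (lin_comp (lXl _) ld0)|exact: (lin_comp (lXl _) lpV)].
rewrite rmulXE !d0E pVE (linD (lXl _)) !rmulXE diffR_mul (linD (tpure_linr _)).
by rewrite addrA.
Qed.

Lemma d0_xi x y : d0 (xi x y) + xi (d0 x) y + xi (nu x) (d0 y) = 0.
Proof.
rewrite /xi d0_rmulX augV_d0 /nu (linN lpV) pV_K d0_pV !(linN (lXl _)); abel.
Qed.

Lemma rmulX_rmulX v r s : rmulX (rmulX v r) s = rmulX v (rmul f r s).
Proof.
move: v; apply: tens_ext => [||a t]; [exact: (lin_comp (lXl _) (lXl _))|exact: lXl|].
by rewrite !rmulXE rmulA.
Qed.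

Lemma pV_rmulX v s : pV (rmulX v s) = rmulX (pV v) (J s).
Proof.
move: v; apply: tens_ext => [||a t]; [exact: (lin_comp lpV (lXl _))|exact: (lin_comp (lXl _) lpV)|].
by rewrite !(pVE, rmulXE) pR_mul.
Qed.

Lemma augV_rmulX v s : augV (rmulX v s) = rmul f (augV v) s.
Proof.
move: v; apply: tens_ext => [||a t]; [exact: (lin_comp laug (lXl _))|exact:
  (lin_comp (rl _) laug)|].
by rewrite rmulXE !augVE (linZ (rl _)).
Qed.

Lemma augV_pV v : augV (pV v) = J (augV v).
Proof.
move: v; apply: tens_ext => [||a t]; [exact: (lin_comp laug lpV)|exact: (lin_comp lJ laug)|].
by rewrite pVE !augVE aug_pA (linZ lJ).
Qed.

Lemma xi_xi x y v : xi (xi x y) v + xi (nu x) (xi y v) = 0.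
Proof.
rewrite /xi augV_rmulX augV_pV pV_rmulX pV_K /nu (linN lpV) pV_K (linN (lXl _)).
by rewrite rmulX_rmulX subrr.
Qed.

(** With [gam] outermost, the inner operation must absorb all entries, all but the last or all but
    the first. *)
Lemma gam_all x xs :
  \sum_(p <- cuts (x :: xs)) \sum_(q <- cuts p.2) gam (map nu p.1 ++ beta q.1 :: q.2) =
  d0 (beta (x :: xs)) + xi (beta (belast x xs)) (last x xs) + xi (nu x) (beta xs).
Proof.
have inner (F : seq V -> V) (s : seq V) y : \sum_(q <- cuts (y :: s)) gam (F q.1 :: q.2) =
  d0 (F (y :: s)) + xi (F (belast y s)) (last y s).
  elim: s y F => [|z s IH] y F.
    by rewrite cuts_cons cuts_nil !(big_cons, big_nil) /= addr0 addrC.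
  by rewrite cuts_cons big_cons big_map /= add0r (IH z (fun t => F (y :: t))).
rewrite cuts_cons big_cons big_map inner; congr (_ + _).
have /= -> := @sum_cuts_nil _ V xs (fun p1 p2 =>
  \sum_(q <- cuts p2) gam (nu x :: map nu p1 ++ beta q.1 :: q.2)).
  by have /= -> := @sum_cuts_last _ V xs (fun t1 t2 => gam (nu x :: beta t1 :: t2)).
by move=> y w1 w2; rewrite big1 // => q _ /=; case: (map nu w1).
Qed.

Lemma stasheff_beta x xs :
  \sum_(p <- cuts (x :: xs)) \sum_(q <- cuts p.2) beta (map nu p.1 ++ beta q.1 :: q.2) = 0.
Proof.
have -> : \sum_(p <- cuts (x :: xs)) \sum_(q <- cuts p.2) beta (map nu p.1 ++ beta q.1 :: q.2) =
  \sum_(p <- cuts (x :: xs)) \sum_(q <- cuts p.2) btl (map nu p.1 ++ beta q.1 :: q.2) +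
  \sum_(p <- cuts (x :: xs)) \sum_(q <- cuts p.2) gam (map nu p.1 ++ beta q.1 :: q.2).
  by rewrite -big_split; apply: eq_bigr => p _; rewrite -big_split.
rewrite gam_all cuts_cons big_cons big_map /= cuts_cons big_cons big_map /=.
rewrite beta_nil (lin0 (lThl _)) add0r.
have -> : \sum_(p <- cuts xs) Theta (beta (x :: p.1)) (Fch p.2) =
   \sum_(p <- cuts xs) Theta (btl (x :: p.1)) (Fch p.2)
   + (Theta (d0 x) (Fch xs) + (if xs is y :: xs' then Theta (xi x y) (Fch xs') else 0)).
  rewrite -(gam_sum (G := fun v t => Theta v (Fch t))) // -big_split; apply: eq_bigr => p _ /=.
  by rewrite {1}/beta (linD (lThl _)).
have -> : \sum_(j <- cuts xs) \sum_(q <- cuts j.2)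
    Theta (nu x) (Fch ([seq nu i | i <- j.1] ++ beta q.1 :: q.2)) =
   Theta (nu x) (- dQ (Fch xs) + head_term xs - tail_term xs).
  (* [dQ_Fch] is solved for its double sum, so that the operations inserted after x are expressed by
     the differential of the chain. *)
  have hS (S H T : Q) : - (- S + H - T) + H - T = S by abel.
  rewrite dQ_Fch hS (lin_sumE (lThr _)); apply: eq_bigr => p _.
  by rewrite (lin_sumE (lThr _)).
have hE : Theta (nu x) (head_term xs) = - (if xs is y :: xs' then Theta (xi x y) (Fch xs') else 0).
  by case: (xs) => [|y xs']; rewrite ?(lin0 (lThr _)) ?oppr0 //= Theta_nu_L.
have tE : Theta (nu x) (tail_term xs) = xi (btl (belast x xs)) (last x xs).
  case: (xs) => [|y xs'] /=; first by rewrite (lin0 (lThr _)) (lin0 (xi_linl _)).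
  by rewrite /xi -/(btl (x :: belast y xs')) pV_btl /= rmulX_Theta.
rewrite (linB (lThr _)) (linD (lThr _)) (linN (lThr _)) hE tE.
have -> : beta (belast x xs) = btl (belast x xs) + gam (belast x xs) by [].
have -> : beta xs = btl xs + gam xs by [].
have -> : beta (x :: xs) = btl (x :: xs) + gam (x :: xs) by [].
(* [xi] applies the augmentation to its second argument, where values of t disappear. *)
have x0 : xi (nu x) (btl xs) = 0 by rewrite /xi augV_btl; exact: (lin0 (lXr _)).
rewrite (linD ld0) (linD (xi_linl _)) (linD (xi_linr _)) x0 d0_btl.
(* What does not involve t: according to the number of arguments, this is d0^2 = 0, the Leibniz rule
   for [xi], or its associativity, and it is trivial from four arguments on. *)
have G0 : d0 (gam (x :: xs)) + xi (gam (belast x xs)) (last x xs) + xi (nu x) (gam xs) = 0.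
  case: (xs) => [|y [|z [|t s]]] /=.
  - by rewrite d0_d0 (lin0 (xi_linl _)) (lin0 (xi_linr _)) !addr0.
  - exact: d0_xi.
  - by rewrite (lin0 ld0) add0r xi_xi.
  by rewrite (lin0 ld0) (lin0 (xi_linl _)) (lin0 (xi_linr _)) !addr0.
rewrite -[RHS]G0 /=; abel.
Qed.

End BarStasheff2.

(** * Homogeneous elements *)

Section Span.
Variables (k : comNzRingType) (M : lmodType k).

Inductive hspan (S : M -> Prop) : M -> Prop :=
| hspan0 : hspan S 0
| hspanD c x y : S x -> hspan S y -> hspan S (c *: x + y).

Lemma hspan_gen (S : M -> Prop) x : S x -> hspan S x.
Proof.
by move=> Sx; rewrite -[x]addr0 -[x]scale1r; apply: hspanD => //; apply: hspan0.
Qed.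

Lemma hspan_lin (S : M -> Prop) c x y : hspan S x -> hspan S y -> hspan S (c *: x + y).
Proof.
move=> hx hy; elim: hx c => [|d z w Sz hw IH] c; first by rewrite scaler0 add0r.
rewrite scalerDr scalerA -addrA; exact: hspanD.
Qed.

Lemma hspan_add (S : M -> Prop) x y : hspan S x -> hspan S y -> hspan S (x + y).
Proof. by move=> hx hy; rewrite -[x]scale1r; apply: hspan_lin. Qed.

Lemma hspan_scale (S : M -> Prop) c x : hspan S x -> hspan S (c *: x).
Proof. by move=> hx; rewrite -[_ *: _]addr0; apply: hspan_lin hx (hspan0 S). Qed.

Lemma hspan_opp (S : M -> Prop) x : hspan S x -> hspan S (- x).
Proof. by move=> hx; rewrite -scaleN1r; apply: hspan_scale. Qed.

Lemma hspan_sum (S : M -> Prop) I (s : seq I) (F : I -> M) :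
  (forall i, hspan S (F i)) -> hspan S (\sum_(i <- s) F i).
Proof.
move=> hF; elim: s => [|i s IH]; first by rewrite big_nil; apply: hspan0.
by rewrite big_cons; apply: hspan_add.
Qed.

Lemma hspan_homog (S : M -> Prop) (pr : int -> M -> M) p x : linear (pr p) ->
  (forall y, S y -> homog pr p y) -> hspan S x -> homog pr p x.
Proof.
move=> lpr Sh; elim=> [|c y z Sy _ hz]; first exact: homog0.
by apply: homogD => //; apply: homogZ => //; apply: Sh.
Qed.

End Span.

Lemma hspan_map (k : comNzRingType) (M M' : lmodType k) (f : M -> M') (S : M -> Prop)
  (T : M' -> Prop) x :
  linear f -> (forall y, S y -> hspan T (f y)) -> hspan S x -> hspan T (f x).
Proof.
move=> lf ST; elim=> [|c y z Sy _ hz]; first by rewrite (lin0 lf); apply: hspan0.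
by rewrite lf; apply: hspan_lin => //; apply: ST.
Qed.

Lemma hspan_bil (k : comNzRingType) (M N P : lmodType k) (f : M -> N -> P)
  (S : M -> Prop) (T : N -> Prop) (U : P -> Prop) x y :
  (forall y, linear (fun x => f x y)) -> (forall x, linear (f x)) ->
  (forall x y, S x -> T y -> hspan U (f x y)) ->
  hspan S x -> hspan T y -> hspan U (f x y).
Proof.
move=> fl fr STU hx hy; apply: (hspan_map (fl y)) hx => x' Sx'.
by apply: (hspan_map (fr x')) hy => y' Ty'; apply: STU.
Qed.

Lemma pmod_span (k : comNzRingType) (X : Type) (R : X -> seq (k * X) -> Prop) (x : pmod R) :
  hspan (fun y => exists g, y = pgen R g) x.
Proof.
have li : linear (@id (pmod R)) by [].
have -> : x = feval (pgen R) (prep x) by exact: (feval_pgen li).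
by apply: hspan_sum => p; apply/hspan_scale/hspan_gen; exists p.2.
Qed.

Section HomogSpan.
Variables (k : comNzRingType) (A : hga k).

(** The projection onto degree p, applied to any expression of c by words, fixes c and keeps only
    the words of degree p. *)
Lemma bar_homog_span p (c : bar A) : homog (@bar_pr k A) p c ->
  hspan (fun y => exists2 w : word A, wdeg w = p & y = bw w) c.
Proof.
rewrite /homog => <-; apply: (hspan_map (@bar_pr_lin k A p)) (pmod_span c) => _ [w ->].
rewrite -/(bw w) bar_pr_bw; case: eqP => [wp|_]; last exact: hspan0.
by apply: hspan_gen; exists w.
Qed.

Lemma hel_span (a : A) : hspan (fun y => exists x : hel A, y = hval x) a.
Proof.
rewrite (support_sum a).2; apply: hspan_sum => p; apply: hspan_gen.
by exists (comp_at p a).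
Qed.

Lemma homog_bmul_gen p q (c e : bar A) : homog (@bar_pr k A) p c ->
  homog (@bar_pr k A) q e -> homog (@bar_pr k A) (p + q) (bmul c e).
Proof.
move=> hc he; apply: (hspan_homog (S := homog (@bar_pr k A) (p + q))) => //; first exact:
  bar_pr_lin.
apply: (hspan_bil (@bmul_linl k A) (@bmul_linr k A) _ (bar_homog_span hc) (bar_homog_span he)).
by move=> _ _ [v <- ->] [w <- ->]; apply/hspan_gen/homog_bmul.
Qed.

Lemma homog_brk p q (a : A) (c : bar A) : homog apr p a -> homog (@bar_pr k A) q c ->
  homog (@bar_pr k A) (p - 1 + q) (brk a c).
Proof.
move=> ha hc; apply: (hspan_homog (S := homog (@bar_pr k A) (p - 1 + q))) => //; first exact:
  bar_pr_lin.
apply: (hspan_map (@brk_linr k A a) _ (bar_homog_span hc)) => _ [w <- ->].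
apply: hspan_gen; rewrite (brk_hel (Helt ha)).
have -> : p - 1 + wdeg w = wdeg (lbar (Helt ha) :: w) by rewrite wdeg_cons.
exact: homog_bw.
Qed.

End HomogSpan.

Section BarTwo.
Variables (k : comNzRingType) (A A' A'' : hga k).
Notation R := (rbarc A A'').
Notation V := (bar2 A A' A'').

Lemma bar2_ext (M : lmodType k) (F G : V -> M) : linear F -> linear G ->
  (forall g : gen2 A A' A'', F (g2 g) = G (g2 g)) -> forall x, F x = G x.
Proof.
move=> lF lG FG; apply: (tens_ext lF lG) => a r.
move: a; apply: hel_ext => [||a].
- exact: (lin_comp lF (tpure_linl _)).
- exact: (lin_comp lG (tpure_linl _)).
move: r; apply: rbar_ext => [||[w b]].
- exact: (lin_comp lF (tpure_linr _)).
- exact: (lin_comp lG (tpure_linr _)).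
exact: FG (a, w, b).
Qed.

Lemma lift2_ext (M : lmodType k) (f : gen2 A A' A'' -> M) (G : V -> M) :
  linear G -> (forall g, f g = G (g2 g)) -> forall x, lift2 f x = G x.
Proof.
move=> lG fG; apply: (tlift_ext lG) => a r.
apply: (hext_ext (G := fun a => G (tpure a r))) => [|x].
  exact: (lin_comp lG (tpure_linl _)).
apply: (rlift_ext (f := fun g => f (x, g.1, g.2)) (G := fun r => G (tpure (hval x) r))) => [|g].
  exact: (lin_comp lG (tpure_linr _)).
by rewrite fG; case: g.
Qed.

Section Lift.
Variables (M : lmodType k) (f : gen2 A A' A'' -> M).
Hypothesis fl : forall w b, hmulti (fun a => f (a, w, b)).
Hypothesis fw : forall a b, wmulti (fun w => f (a, w, b)).
Hypothesis fr : forall a w, hmulti (fun b => f (a, w, b)).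

Let f0 (a : A') (r : R) : M := hext (fun x => rlift (fun g => f (x, g.1, g.2)) r) a.

Let rlin x : linear (rlift (fun g => f (x, g.1, g.2)) : R -> M).
Proof. by apply: rlift_lin => [b|w]; [exact: fw|exact: fr]. Qed.

Let rE x g : rlift (fun g => f (x, g.1, g.2)) (rg g) = f (x, g.1, g.2).
Proof. by rewrite rliftE => [|b|w]; [|exact: fw|exact: fr]. Qed.

Let f0_multi r : hmulti (fun x => rlift (fun g => f (x, g.1, g.2)) r).
Proof.
move=> x y z c dy dz vx; move: r; apply: rbar_ext => [||g]; [exact: rlin| |].
  by apply: lin_add; [apply: lin_scale|]; exact: rlin.
by rewrite !rE; apply: fl.
Qed.

Let f0_linl r : linear (fun a => f0 a r).
Proof. exact: hext_lin. Qed.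

Let f0_linr a : linear (f0 a).
Proof.
move=> c r s; move: a; apply: hel_ext => [||a]; [exact: f0_linl| |].
  by apply: lin_add; [apply: lin_scale|]; exact: f0_linl.
by rewrite /f0 !hextE //; apply: rlin.
Qed.

Lemma lift2_lin : linear (lift2 f).
Proof. exact: tlift_lin f0_linl f0_linr. Qed.

Lemma lift2E g : lift2 f (g2 g) = f g.
Proof.
case: g => [[a w] b]; transitivity (f0 (hval a) (rg (w, b))).
  exact: (tliftE f0_linl f0_linr).
by rewrite /f0 hextE // rE.
Qed.

End Lift.

Lemma bar2_scale_lin (c : int -> k) :
  linear (lift2 (fun x : gen2 A A' A'' => c (gdeg x) *: g2 x)) /\
  forall g, lift2 (fun x : gen2 A A' A'' => c (gdeg x) *: g2 x) (g2 g) = c (gdeg g) *: g2 g.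
Proof.
have h1 w b : hmulti (fun a => c (gdeg (a, w, b)) *: (g2 (a, w, b) : V)).
  apply: (hmulti_lin (phi := fun n (a : A') => c (n + wdeg w + hdeg b) *: (el3 a (bw w) (hval b) : V))).
  by move=> n; apply: lin_scale; apply: tpure_linl.
have h2 a b : wmulti (fun w => c (gdeg (a, w, b)) *: (g2 (a, w, b) : V)).
  apply: (deg_multi (phi := fun n (u : bar A) => c (hdeg a + n + hdeg b) *: (el3 (hval a) u (hval b) : V))).
  move=> n; apply: lin_scale; exact: (lin_comp (tpure_linr _) (tpure_linl _)).
have h3 a w : hmulti (fun b => c (gdeg (a, w, b)) *: (g2 (a, w, b) : V)).
  apply: (hmulti_lin (phi := fun n (b : A'') => c (hdeg a + wdeg w + n) *: (el3 (hval a) (bw w) b : V))).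
  move=> n; apply: lin_scale; exact: (lin_comp (tpure_linr _) (tpure_linr _)).
by split; [exact: lift2_lin|move=> g; rewrite lift2E].
Qed.

Notation pr := (@bar2_pr k A A' A'').

Lemma bar2_pr_scale p v :
  pr p v = lift2 (fun x => (gdeg x == p)%:R *: g2 x) v.
Proof.
have [l E] := bar2_scale_lin (fun n => (n == p)%:R).
apply: (lift2_ext l) => g; rewrite E.
by case: eqP => _; rewrite ?scale1r ?scale0r.
Qed.

Lemma bar2_pr_lin p : linear (pr p).
Proof.
have [l E] := bar2_scale_lin (fun n => (n == p)%:R).
by move=> c x y; rewrite !bar2_pr_scale l.
Qed.

Lemma bar2_pr_g2 p g : pr p (g2 g) = if gdeg g == p then g2 g else 0.
Proof.
have [l E] := bar2_scale_lin (fun n => (n == p)%:R).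
by rewrite bar2_pr_scale E; case: eqP => _; rewrite ?scale1r ?scale0r.
Qed.

Definition gspan p (v : V) : Prop := hspan (fun y => exists2 g, gdeg g = p & y = g2 g) v.

Lemma gspan_homog p v : gspan p v -> homog pr p v.
Proof.
apply: hspan_homog; first exact: bar2_pr_lin.
by move=> _ [g <- ->]; rewrite /homog bar2_pr_g2 eqxx.
Qed.

Lemma bar_span (c : bar A) : hspan (fun y => exists w, y = bw w) c.
Proof. exact: pmod_span. Qed.

Lemma bar2_span (v : V) : hspan (fun y => exists g : gen2 A A' A'', y = g2 g) v.
Proof.
have li : linear (@id V) by [].
apply: (hspan_map li _ (pmod_span v)) => _ [[a r] ->]; rewrite /= -/(tpure a r).
have step a0 r0 : (exists x : hel A', a0 = hval x) ->
  (exists w (b : hel A''), r0 = tpure (bw w) (hval b)) ->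
   hspan (fun y : V => exists g : gen2 A A' A'', y = g2 g) (tpure a0 r0).
  by move=> [x ->] [w [b ->]]; apply: hspan_gen; exists (x, w, b).
have hr : hspan (fun y : R => exists w (b : hel A''), y = tpure (bw w) (hval b)) r.
  have li2 : linear (@id R) by [].
  apply: (hspan_map li2 _ (pmod_span r)) => _ [[u b] ->]; rewrite /= -/(tpure u b).
  apply: (hspan_bil (@tpure_linl _ _ _) (@tpure_linr _ _ _) _ (bar_span u) (hel_span b)).
  by move=> _ _ [w ->] [x ->]; apply: hspan_gen; exists w, x.
exact: (hspan_bil (@tpure_linl _ _ _) (@tpure_linr _ _ _) step (hel_span a) hr).
Qed.

Lemma homog_gspan p v : homog pr p v -> gspan p v.
Proof.
rewrite /homog => <-; apply: (hspan_map (bar2_pr_lin p)) (bar2_span v) => _ [g ->].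
rewrite bar2_pr_g2; case: eqP => [gp|_]; last exact: hspan0.
by apply: hspan_gen; exists g.
Qed.

Lemma bar2_grading : is_grading pr.
Proof.
split; first exact: bar2_pr_lin.
  move=> p q v; have lif : linear (fun v => if p == q then pr q v else 0).
    by case: eqP => _; [exact: bar2_pr_lin|exact: lin_zero].
  move: v; apply: bar2_ext => [|//|g]; first exact: (lin_comp (bar2_pr_lin p) (bar2_pr_lin q)).
  rewrite bar2_pr_g2; case: eqP => [gq|_]; last by rewrite (lin0 (bar2_pr_lin p)); case: eqP.
  by rewrite bar2_pr_g2 gq eq_sym.
move=> v.
(* The vanishing outside s is carried through the induction, so that s may be enlarged by the degree
   of the next generator. *)
have [s [us out sE]] : exists s, [/\ uniq s, (forall p, p \notin s -> pr p v = 0) & v =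
  \sum_(p <- s) pr p v].
  have := bar2_span v; elim=> [|c _ y [g ->] _ [s [us out sE]]].
    by exists [::]; split=> // [p _|]; rewrite ?big_nil // (lin0 (bar2_pr_lin p)).
  have [s' [us' gs' ss']] : exists s', [/\ uniq s', gdeg g \in s' & {subset s <= s'}].
    exists (undup (gdeg g :: s)); split; first exact: undup_uniq.
      by rewrite mem_undup mem_head.
    by move=> p ps; rewrite mem_undup inE ps orbT.
  exists s'; split=> //.
    move=> p ps; rewrite (bar2_pr_lin p) bar2_pr_g2 eq_sym out ?addr0; last exact: contra (ss' p)
      ps.
    by case: eqP => [pg|_]; [rewrite pg gs' in ps|rewrite scaler0].
  under eq_bigr => p _ do rewrite (bar2_pr_lin p).
  rewrite big_split /= -scaler_sumr; congr (_ *: _ + _).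
    rewrite (bigD1_seq (gdeg g)) //= bar2_pr_g2 eqxx big1 ?addr0 // => p pg.
    by rewrite bar2_pr_g2 eq_sym (negPf pg).
  rewrite {1}sE [RHS](bigID (mem s)) /= [X in _ + X]big1 ?addr0 => [|p ps]; last exact: out.
  rewrite -[RHS]big_filter; apply: perm_big; apply: uniq_perm => //.
    exact: filter_uniq.
  by move=> p; rewrite mem_filter andb_idr // => /ss'.
by exists s.
Qed.

End BarTwo.

(** * Comparison with the maps m_n *)

Section Splits.
Variables (k : comNzRingType) (A A' A'' : hga k) (f' : hga_mor A A').
Notation gen := (gen2 A A' A'').
Notation split := (gsplit A A' A'').

Lemma splitsE (a : hel A') w (b : hel A'') :
  splits (a, w, b) = [seq ((a, p.1), (p.2, b)) | p <- @cuts (letter A) w].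
Proof. by rewrite /splits /cuts -lock -map_comp. Qed.

Lemma sum_allsplits (V : nmodType) a w b (xs : seq gen) (F : seq split -> V) :
  \sum_(c <- allsplits ((a, w, b) :: xs)) F c =
  \sum_(p <- cuts w) \sum_(c <- allsplits xs) F (((a, p.1), (p.2, b)) :: c).
Proof. by rewrite -[allsplits (_ :: _)]/[seq p :: c | p <- splits (a, w, b), c <- allsplits xs]
  big_allpairs_dep splitsE big_map. Qed.

(** The exponent of the sign by which J^(n-1) (x) ... (x) J (x) 1 acts on n homogeneous elements. *)
Fixpoint gen_weight (xs : seq gen) : int :=
  if xs is x :: s then (size s)%:Z * gdeg x + gen_weight s else 0.

Fixpoint split_weight (c : seq split) : int :=
  if c is p :: s then (size s)%:Z * (lgdeg (left' f' p) + rgdeg p.2) + split_weight s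
  else 0.

Lemma lgdeg_left (p : split) : lgdeg (left' f' p) = hdeg p.1.1 + wdeg p.1.2.
Proof. by rewrite /lgdeg /left' /= wdeg_wmap. Qed.

(** Degrees of the two parts of a splitting add up, so under the sum the weight of xs may be
    computed from the splitting. *)
Lemma eq_allsplits (V : nmodType) (xs : seq gen) (F G : seq split -> V) :
  (forall c, size c = size xs -> gen_weight xs = split_weight c -> F c = G c) ->
  \sum_(c <- allsplits xs) F c = \sum_(c <- allsplits xs) G c.
Proof.
elim: xs F G => [|[[a w] b] xs IH] F G FG; first by rewrite !big_seq1 FG.
rewrite !sum_allsplits; apply: eq_cuts => p pE; apply: IH => c sc wc.
apply: FG => /=; rewrite sc // wc lgdeg_left /gdeg /rgdeg /= -pE wdeg_cat.
by congr (_ * _ + _); rewrite !addrA.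
Qed.

Lemma allsplits_nil (V : nmodType) (F : seq split -> V) :
  \sum_(c <- allsplits [::]) F c = F [::].
Proof. by rewrite big_seq1. Qed.

End Splits.

Section Factors.
Variables (k : comNzRingType) (A' : hga k).
Notation lgen := (lgen A').

Definition Fw (xs : seq lgen) : bar A' :=
  foldr (fun x z => brk (hval x.1) (bmul (bw x.2) z)) (bw [::]) xs.

Definition Fw_deg (xs : seq lgen) : int := \sum_(x <- xs) (lgdeg x - 1).

Lemma homog_Fw xs : homog (@bar_pr k A') (Fw_deg xs) (Fw xs).
Proof.
elim: xs => [|x xs IH]; first by rewrite /Fw_deg big_nil -(@wdeg_nil k A'); apply: homog_bw.
rewrite /Fw_deg big_cons /= -/(Fw xs) -/(Fw_deg xs) /lgdeg.
have -> : hdeg x.1 + wdeg x.2 - 1 + Fw_deg xs = hdeg x.1 - 1 + (wdeg x.2 + Fw_deg xs).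
  by abel.
apply: homog_brk; first exact: hvalP.
apply: homog_bmul_gen => //; exact: homog_bw.
Qed.

Fixpoint weight (xs : seq lgen) : int :=
  if xs is x :: s then (size s)%:Z * lgdeg x + weight s else 0.

Fixpoint rev_weight (rs : seq lgen) : int :=
  if rs is x :: s then \sum_(z <- s) lgdeg z + lgdeg x + rev_weight s else 0.

Lemma weight_rcons xs y : weight (rcons xs y) = \sum_(x <- xs) lgdeg x + weight xs.
Proof.
elim: xs => [|x xs IH] /=; first by rewrite big_nil mul0r.
rewrite IH size_rcons big_cons -addn1 PoszD mulrDl mul1r; abel.
Qed.

Lemma rev_weightE xs : rev_weight (rev xs) = \sum_(x <- xs) lgdeg x + weight xs.
Proof.
elim/last_ind: xs => [|xs y IH]; first by rewrite big_nil.
rewrite rev_rcons /= IH weight_rcons -cats1 big_cat big_seq1 /=.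
have -> : \sum_(z <- rev xs) lgdeg z = \sum_(z <- xs) lgdeg z.
  elim: xs {IH} => [|x xs IH]; first by [].
  by rewrite rev_cons -cats1 big_cat big_seq1 big_cons IH addrC.
abel.
Qed.

(** Since h consumes arguments from the right and S h(x, y) is a bracket around S y, the recursion
    becomes an iteration of brackets; [rev_weight] gathers the signs of h and those of moving it
    past earlier arguments. *)
Lemma SS_hn_rev rs (y : lbarc A') : SS (hn_rev rs y) =
  sg (rev_weight rs) *:
    foldl (fun z x => brk (hval x.1) (bmul (bw x.2) z)) (SS y) rs.
Proof.
have lS := @SS_lin k A'.
have lf : forall rs, linear (foldl (fun z (x : lgen) => brk (hval x.1) (bmul (bw x.2) z)) ^~ rs).
  elim=> [|x s IH] /=; first by lin.
  exact: (lin_comp IH (lin_comp (brk_linr _) (bmul_linr _))).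
elim: rs y => [|x rs IH] y /=; first by rewrite scale1r.
rewrite (linZ lS) IH /hh (linZ lS) -/(brk _ _) (linZ (lf _)) !scalerA.
by congr (_ *: _); rewrite !sgD mulrAC.
Qed.

Lemma SS_hn xs : (0 < size xs)%N -> SS (hn xs) = sg (weight xs) *: Fw xs.
Proof.
case/lastP: xs => // s y _.
rewrite /hn rev_rcons SS_hn_rev foldl_rev weight_rcons rev_weightE; congr (_ *: _).
by rewrite /Fw foldr_rcons /= bmulx1.
Qed.

End Factors.

Section Bridge.
Variables (k : comNzRingType) (A A' A'' : hga k).
Variables (f' : hga_mor A A') (f : hga_mor A A'').
Notation R := (rbarc A A'').
Notation V := (bar2 A A' A'').
Notation L := (Lact f' (rmul f)).
Notation Fch := (Fch f' f).
Notation btl := (btl f' f).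
Notation gam := (@gam k A A' A'' f).
Notation beta := (beta f' f).
Notation gen := (gen2 A A' A'').
Notation split := (gsplit A A' A'').
Notation left' := (left' f').

Definition Rf (ps : seq (rgen A A'')) : R :=
  foldr (fun p s => rmul f (rg p) s) (oneR A A'') ps.

Lemma rprodE p ps : rprod f p ps = rmul f (rg p) (Rf ps).
Proof.
rewrite /rprod; elim: ps (rg p) => [|q ps IH] y /=; first by rewrite rmul_unitr.
by rewrite IH -rmulA.
Qed.

(** The Koszul sign of moving each right part past the brackets formed from the later left parts. *)
Fixpoint cross (c : seq split) : int :=
  if c is p :: s then rgdeg p.2 * Fw_deg (map left' s) + cross s else 0.

Lemma L_Fch_gens (a : hel A') w (b : hel A'') (xs : seq gen) :
  Fch (map (@g2 k A A' A'') xs) =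
    \sum_(c <- allsplits xs) sg (cross c) *: tpure (Fw (map left' c)) (Rf (map snd c)) ->
  L (tpure (bw w) (hval b)) (Fch (map (@g2 k A A' A'') xs)) =
  \sum_(c <- allsplits ((a, w, b) :: xs)) if c is p :: c' then
     sg (cross c) *: tpure (bmul (bw (wmap f' p.1.2)) (Fw (map left' c')))
        (rmul f (rg p.2) (Rf (map snd c'))) else 0.
Proof.
move=> E; have Lr := L_linr f' f.
rewrite sum_allsplits exchange_big E (lin_sumE (Lr _)); apply: eq_bigr => c _.
rewrite (linZ (Lr _)) (Lact_gen f' (rmul_linl f) (rmul_linr f) _ _ _ (homog_Fw _)) scaler_sumr.
by apply: eq_bigr => p _; rewrite /= scalerA bmap_bw mulrC sgD.
Qed.

Lemma Fch_gens (xs : seq gen) : Fch (map (@g2 k A A' A'') xs) =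
  \sum_(c <- allsplits xs) sg (cross c) *: tpure (Fw (map left' c)) (Rf (map snd c)).
Proof.
elim: xs => [|[[a w] b] xs IH]; first by rewrite allsplits_nil /= scale1r.
rewrite [map _ _]/= Fch_cons PhiE (L_Fch_gens a w b IH).
rewrite (lin_sumE (@TQ_linr k A A' A'' _)) !sum_allsplits; apply: eq_bigr => p _.
by apply: eq_bigr => c _; rewrite (linZ (@TQ_linr k A A' A'' _)) TQE.
Qed.

Lemma btl_gens (a : hel A') w (b : hel A'') (xs : seq gen) :
  btl (map (@g2 k A A' A'') ((a, w, b) :: xs)) =
  \sum_(c <- allsplits ((a, w, b) :: xs)) if c is p :: c' then
    (sg (hdeg p.1.1) * sg (cross c)) *:
      tpure (hval p.1.1 * EE (bw (wmap f' p.1.2)) (Fw (map left' c')))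
        (rmul f (rg p.2) (Rf (map snd c'))) else 0.
Proof.
have lt := @tau_lin k A A' A''.
rewrite [map _ _]/= [btl _]/= ThetaE (L_Fch_gens a w b (Fch_gens xs)).
rewrite (lin_sumE lt) (lin_sumE (lact_linr_ _)) !sum_allsplits; apply: eq_bigr => p _.
apply: eq_bigr => c _; rewrite (linZ lt) (linZ (lact_linr_ _)) tauE lactE pA_hel.
by rewrite -scalerAl (linZ (tpure_linl _)) scalerA mulrC.
Qed.

Fixpoint rweight (c : seq split) : int :=
  if c is p :: s then (size s)%:Z * rgdeg p.2 + rweight s else 0.

Lemma split_weightE c : split_weight f' c = weight (map left' c) + rweight c.
Proof. by elim: c => [|p c IH] //=; rewrite IH size_map; lia. Qed.

Lemma Fw_degE (xs : seq (lgen A')) : Fw_deg xs = \sum_(x <- xs) lgdeg x - (size xs)%:Z.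
Proof.
elim: xs => [|x xs IH]; first by rewrite /Fw_deg !big_nil.
rewrite /Fw_deg !big_cons -/(Fw_deg xs) IH /=.
by move: (\sum_(j <- xs) _) (lgdeg x) => u v; lia.
Qed.

(** [cross] counts left parts inside brackets, [crossing] outside; each bracket lowers the degree by
    one, so a right part contributes its degree once for every later factor. *)
Lemma par_crossing c : par (crossing f' c) = par (cross c + rweight c).
Proof.
elim: c => [|p c IH] //=; rewrite Fw_degE size_map big_map !parE IH !parE.
move: (par (\sum_(q <- c) _)) (par (cross c)) (par (rweight c)) (par (wdeg _)) (par (hdeg _))
  (odd _).
by do 6 case.
Qed.

Lemma mtilde_gens (x y : gen) (xs : seq gen) :
  mtilde f' f [:: x, y & xs] = sg (gen_weight [:: x, y & xs]) *:
    btl (map (@g2 k A A' A'') [:: x, y & xs]).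
Proof.
case: x => [[a w] b]; rewrite btl_gens scaler_sumr /mtilde.
apply: (eq_allsplits (f' := f')) => -[|p [|p' c]] // _ ->.
have lt := @bar_t_lin k A'.
rewrite /mtilde_term SS_hn // rprodE /EE (linZ (bmul_linr _)) (linZ lt) -scalerAr.
rewrite (linZ (tpure_linl _)) !scalerA; congr (_ *: _).
rewrite split_weightE.
have -> : weight (map left' [:: p, p' & c]) = (size c).+1%:Z * lgdeg (left' p) + weight
  (map left' (p' :: c)).
  by rewrite /= size_map.
rewrite lgdeg_left /kappa sgD sgD !sgE par_crossing.
move: (weight _) (rweight _) (cross _) => W X Y.
rewrite -[(size [:: p, p' & c]).-1]/(size (p' :: c)) -[size [:: p, p' & c]]/(size (p' :: c)).+1.
rewrite !parE /=.
(* The comparison of kappa with the sign of the twist is now a Boolean identity in six parities. *)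
rewrite -!signr_addb; congr (_ ^+ _); congr nat_of_bool.
move: (par X) (par Y) (par W) (par (hdeg _)) (par (wdeg _)) (odd _).
by do 6 case.
Qed.

Lemma pV_g2 (x : gen) : pV (g2 x : V) = sg (gdeg x) *: (g2 x : V).
Proof.
case: x => [[a w] b]; rewrite pVE -[tpure (bw _) _]/(rg (w, b)) pR_gen pA_hel /=.
rewrite (linZ (tpure_linl _)) (linZ (tpure_linr _)) scalerA.
by congr (_ *: _); rewrite /gdeg /rgdeg /=; sgn.
Qed.

(** For two arguments the weight is the degree of the first one, whose sign cancels the [pV] in
    [xi]; this yields the unsigned extra summand of m_2. *)
Lemma mgen_beta (xs : seq gen) : (1 < size xs)%N ->
  mgen f' f xs = sg (gen_weight xs) *: beta (map (@g2 k A A' A'') xs).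
Proof.
case: xs => [|x [|y xs]] // _; rewrite /beta scalerDr -mtilde_gens.
case: xs => [|z xs]; last by case: x y => [[a w] b] [[a2 w2] b2]; rewrite /= scaler0 addr0.
case: x y => [[a w] b] [[a2 w2] b2]; rewrite /mgen; congr (_ + _).
have lX := rmulX_linl f; have lY := rmulX_linr f.
have -> : gen_weight [:: (a, w, b); (a2, w2, b2)] = gdeg (a, w, b).
  by rewrite /= mul0r !addr0 mul1r.
rewrite [gam _]/(xi f (g2 (a, w, b)) (g2 (a2, w2, b2))) /xi pV_g2.
rewrite -[g2 (a2, w2, b2)]/(tpure (hval a2) (rg (w2, b2))) augVE
  -[g2 (a, w, b)]/(tpure (hval a) (rg (w, b))).
rewrite (linZ (lX _ _)) scalerA sgsq scale1r rmulXE (linZ (rmul_linr f _)).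
by rewrite (linZ (tpure_linl _)) (linZ (tpure_linr _)).
Qed.

End Bridge.

Section CutsLetter.
Variables (T : Type) (V : zmodType).
Implicit Types (F : seq T -> seq T -> V).

Lemma sum_cuts_first l w F : (forall p q, size p <> 1%N -> F p q = 0) ->
  \sum_(p <- cuts (l :: w)) F p.1 p.2 = F [:: l] w.
Proof.
move=> F0; rewrite cuts_cons big_cons big_map F0 // add0r /=.
apply: (@sum_cuts_nil _ _ w (fun p q => F (l :: p) q)) => x p q; exact: F0.
Qed.

Lemma sum_cuts_lastletter l w F : (forall p q, size q <> 1%N -> F p q = 0) ->
  \sum_(p <- cuts (l :: w)) F p.1 p.2 = F (belast l w) [:: last l w].
Proof.
move=> F0; elim: w l F F0 => [|l' w IH] l F F0.
  by rewrite cuts_cons cuts_nil /= big_cons big_seq1 /= (F0 [:: l]) // addr0.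
rewrite cuts_cons big_cons big_map /= F0 // add0r.
by apply: (IH l' (fun p q => F (l :: p) q)) => p q; apply: F0.
Qed.

End CutsLetter.

Section Differential.
Variables (k : comNzRingType) (A A' A'' : hga k).
Variables (f' : hga_mor A A') (f : hga_mor A A'').
Notation V := (bar2 A A' A'').
Notation Fch := (Fch f' f).
Notation btl := (btl f' f).
Notation gam := (@gam k A A' A'' f).
Notation beta := (beta f' f).
Notation Theta := (Theta f' f).
Notation oneQ := (@oneQ k A A' A'').
Notation d0 := (@d0 k A A' A'' f).

Lemma beta_slot s t : linear (fun x => beta (s ++ x :: t)).
Proof.
have lF u v : linear (fun x : V => Fch (u ++ x :: v)).
  elim: u => [|y u IH] /=; first exact: Phi_linl.
  exact: (lin_comp (Phi_linr f' f y) IH).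
apply: lin_add.
  case: s => [|y s]; first exact: Theta_linl.
  exact: (lin_comp (Theta_linr f' f y) (lF s t)).
case: s t => [|y [|z s]] [|u [|v t]]; try exact: lin_zero.
- exact: d0_lin.
- exact: xi_linl.
- exact: xi_linr.
all: by case: s => [|? s]; exact: lin_zero.
Qed.

Lemma d0_g2 (a : hel A') w (b : hel A'') : d0 (g2 (a, w, b)) =
    el3 (adiff (hval a)) (bw w) (hval b)
  + sg (hdeg a) *: el3 (hval a) (bar_diff (bw w)) (hval b)
  + sg (hdeg a + wdeg w) *: el3 (hval a) (bw w) (adiff (hval b))
  - (if w is l :: w2 then sg (hdeg a + wdeg (belast l w2)) *:
       el3 (hval a) (bw (belast l w2)) (f (lval (last l w2)) * hval b) else 0).
Proof.
rewrite d0E diffRE pA_hel pC_bw (linZ (tpure_linl _)) (linB (tpure_linr _)) (linD (tpure_linr _)).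
rewrite scalerBr scalerDr (linZ (tpure_linl _)) (linZ (tpure_linr _)) scalerA -sgD !addrA.
congr (_ - _); rewrite kap_word.
pose F v u : rbarc A A'' := sg (wdeg v) *: tpure (bw v) (ft f (bw u) * hval b).
have F0 v u : size u <> 1%N -> F v u = 0.
  case: u => [|l [|l' u]] // _; rewrite /F /ft bar_t_bw (lin0 (amor_lin f)) mul0r.
    by rewrite (lin0 (tpure_linr _)) scaler0.
  by rewrite (lin0 (tpure_linr _)) scaler0.
case: w => [|l w2]; first by rewrite cuts_nil big_seq1 -/(F _ _) F0 // (lin0 (tpure_linr _))
  scaler0.
rewrite (sum_cuts_lastletter _ _ F0) /F /ft bar_t_bw (linZ (tpure_linr _)) scalerA -sgD.
by [].
Qed.

Lemma Theta_g2_oneQ (a : hel A') w (b : hel A'') : Theta (g2 (a, w, b)) oneQ =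
  if w is l :: w2 then
    sg (hdeg a) *: el3 (hval a * f' (lval l)) (bw w2) (hval b) else 0.
Proof.
have ltau := @tau_lin k A A' A''; have lta := @tpure_linl k A' (rbarc A A'').
have hb0 : homog (@bar_pr k A') 0 (bw [::]) by rewrite -(@wdeg_nil k A'); apply: homog_bw.
rewrite ThetaE (Lact_gen f' (rmul_linl f) (rmul_linr f) _ _ _ hb0).
rewrite (lin_sumE ltau) (lin_sumE (lact_linr_ _)).
pose F v u : V := sg (hdeg a) *: tpure (hval a * bar_t (bw (wmap f' v))) (tpure (bw u) (hval b)).
transitivity (\sum_(p <- cuts w) F p.1 p.2).
  apply: eq_bigr => p _; rewrite mulr0 sg0 scale1r bmulx1 bmap_bw rmul_unitr tauE lactE pA_hel.
  by rewrite -scalerAl (linZ (lta _)).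
have F0 v u : size v <> 1%N -> F v u = 0.
  by case: v => [|l [|l' v]] // _; rewrite /F bar_t_bw mulr0 (lin0 (lta _)) scaler0.
case: w => [|l w2]; first by rewrite cuts_nil big_seq1 F0.
by rewrite (sum_cuts_first _ _ F0) /F bar_t_bw.
Qed.

Lemma bar2_diff_beta v : bar2_diff f' f v = beta [:: v].
Proof.
apply: (lift2_ext (G := fun v => beta [:: v])); first exact: (beta_slot [::] [::]).
move=> [[a w] b]; rewrite /beta [btl _]/= [gam _]/= Theta_g2_oneQ d0_g2 /gen2_diff.
case: w => [|l w]; first by rewrite add0r subr0 addr0.
rewrite [RHS]addrC -!addrA; do 3 congr (_ + _); exact: addrC.
Qed.

End Differential.

Section Multilinear.
Variables (k : comNzRingType) (A A' A'' : hga k).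
Variables (f' : hga_mor A A') (f : hga_mor A A'').
Notation V := (bar2 A A' A'').
Notation gen := (gen2 A A' A'').
Notation beta := (beta f' f).
Notation pV := (@pV k A A' A'').
Notation helt := (helt (@bar2_pr k A A' A'')).
Notation "|[ xs ]|" := (hvals xs) (at level 0).

(** The nested lifts are peeled off one argument at a time, the earlier arguments being generators
    already. *)
Lemma multilift_ext (F : seq gen -> V) (G : seq V -> V) vs :
  (forall s t, (size s + size t).+1 = size vs -> linear (fun x => G (s ++ x :: t))) ->
  (forall gs, size gs = size vs -> F gs = G (map (@g2 k A A' A'') gs)) ->
  multilift F vs = G vs.
Proof.
elim: vs F G => [|v vs IH] F G lG FG; first by rewrite /= FG.
apply: (lift2_ext (G := fun v => G (v :: vs))) => [|g].
  exact: (lG [::] vs).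
apply: (IH _ (fun t => G (g2 g :: t))) => [s t st|gs gsE].
  by apply: (lG (g2 g :: s) t); rewrite /= addSn st.
by rewrite FG //= gsE.
Qed.

Lemma pV_homog p v : homog (@bar2_pr k A A' A'') p v -> pV v = sg p *: v.
Proof.
move/homog_gspan; elim=> [|c _ y [g <- ->] _ IH]; first by rewrite (lin0 (@pV_lin _ _ _ _)) scaler0.
by rewrite (@pV_lin k A A' A'') IH pV_g2 scalerDr !scalerA [c * _]mulrC.
Qed.

Lemma iter_pV_lin n : linear (iter n pV).
Proof. by elim: n => [|n IH] //=; exact: (lin_comp (@pV_lin _ _ _ _) IH). Qed.

Lemma iter_pV (x : helt) n : iter n pV (hval x) = sg (n%:Z * hdeg x) *: hval x.
Proof.
elim: n => [|n IH] /=; first by rewrite mul0r sg0 scale1r.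
rewrite IH (linZ (@pV_lin _ _ _ _)) (pV_homog (hvalP x)) scalerA -sgD.
by congr (sg _ *: _); rewrite -addn1 PoszD mulrDl mul1r.
Qed.

(* For m = 0, the operator J^(n-1) (x) ... (x) J (x) 1 with J = pV.            *)
Fixpoint twist m (vs : seq V) : seq V :=
  if vs is v :: s then iter (m + size s) pV v :: twist m s else [::].

Lemma twist_cat m s t : twist m (s ++ t) = twist (m + size t) s ++ twist m t.
Proof.
by elim: s => [|x s IH] //=; rewrite IH size_cat; congr (iter _ _ _ :: _); rewrite addnAC addnA.
Qed.

Lemma size_twist m s : size (twist m s) = size s.
Proof. by elim: s => //= x s ->. Qed.

Lemma twist_slot s t : linear (fun x => beta (twist 0 (s ++ x :: t))).
Proof.
move=> c x y; rewrite !twist_cat /= (iter_pV_lin _ c x y); exact: beta_slot.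
Qed.

Fixpoint hweight (xs : seq helt) : int :=
  if xs is x :: s then (size s)%:Z * hdeg x + hweight s else 0.

Lemma size_hvals (xs : seq helt) : size (hvals xs) = size xs.
Proof. exact: size_map. Qed.

Lemma beta_twist (xs : seq helt) : beta (twist 0 (hvals xs)) = sg (hweight xs) *: beta (hvals xs).
Proof.
(* A prefix s of arguments already treated is needed for the induction, as signs leave one slot
   after the other. *)
suff H s : beta (s ++ twist 0 (hvals xs)) = sg (hweight xs) *: beta (s ++ hvals xs) by exact:
  (H [::]).
elim: xs s => [|x xs IH] s; first by rewrite scale1r.
rewrite /= add0n size_hvals iter_pV (linZ (beta_slot f' f s _)) -cat_rcons IH cat_rcons scalerA.
by rewrite -sgD.
Qed.

Definition gen_helt (g : gen) : helt := Helt
  (gspan_homog (hspan_gen (ex_intro2 _ _ g (erefl _) (erefl _)))).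

(** Both sides are compared on generators, where [mgen_beta] applies. Since the twist is a linear
    operator, the formula holds for inhomogeneous arguments too, as the unit and augmentation laws
    require. *)
Lemma bar2_m_twist vs : (1 < size vs)%N -> bar2_m f' f vs = beta (twist 0 vs).
Proof.
move=> vs1; apply: (multilift_ext (G := fun vs => beta (twist 0 vs))) => [s t _|gs gsE]; first
  exact: twist_slot.
have -> : map (@g2 k A A' A'') gs = hvals (map gen_helt gs) by rewrite /hvals -map_comp.
rewrite beta_twist mgen_beta ?gsE // /hvals -map_comp; congr (sg _ *: _).
by elim: gs {gsE} => //= g gs ->; rewrite size_map.
Qed.

Lemma bar2_m_hvals (xs : seq helt) : (1 < size xs)%N ->
  bar2_m f' f (hvals xs) = sg (hweight xs) *: beta (hvals xs).
Proof. by move=> xs1; rewrite bar2_m_twist ?size_hvals // beta_twist. Qed.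

End Multilinear.

Lemma hspan_cuts (k : comNzRingType) (M : lmodType k) (S : M -> Prop) (T : Type) (w : seq T)
    (F : seq T * seq T -> M) :
  (forall p, p.1 ++ p.2 = w -> hspan S (F p)) -> hspan S (\sum_(p <- cuts w) F p).
Proof.
have := (@cuts_cat T)^~ w; elim: (cuts w) => [|p s IH] H FS.
  by rewrite big_nil; apply: hspan0.
rewrite big_cons; apply: hspan_add; first by apply/FS/H; left.
by apply: IH => // q qs; apply: H; right.
Qed.

(** * The augmented A-infinity structure *)

Section Degree.
Variables (k : comNzRingType) (A A' A'' : hga k).
Variables (f' : hga_mor A A') (f : hga_mor A A'').
Notation R := (rbarc A A'').
Notation V := (bar2 A A' A'').
Notation pr := (@bar2_pr k A A' A'').
Notation gen := (gen2 A A' A'').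
Notation split := (gsplit A A' A'').
Notation btl := (btl f' f).
Notation gam := (@gam k A A' A'' f).
Notation beta := (beta f' f).
Notation left' := (left' f').

Definition rspan q (r : R) : Prop := hspan (fun y => exists2 g, rgdeg g = q & y = rg g) r.

Lemma rspan_tpure p q (u : bar A) (b : A'') :
  homog (@bar_pr k A) p u -> homog apr q b -> rspan (p + q) (tpure u b).
Proof.
move=> hu hb; apply: (hspan_map (tpure_linl b) _ (bar_homog_span hu)) => _ [w <- ->].
by apply: hspan_gen; exists (w, Helt hb).
Qed.

Lemma gspan_tpure p q (a : A') (r : R) : homog apr p a -> rspan q r -> gspan (p + q) (tpure a r).
Proof.
move=> ha; apply: (hspan_map (tpure_linr a)) => _ [[w b] <- ->].
by apply: hspan_gen; exists (Helt ha, w, b); rewrite // /gdeg /= -addrA.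
Qed.

Lemma rspan_rmul p q r s : rspan p r -> rspan q s -> rspan (p + q) (rmul f r s).
Proof.
apply: (hspan_bil (rmul_linl f) (rmul_linr f)) => _ _ [[u a] <- ->] [[v b] <- ->].
rewrite rmul_gen; apply: hspan_cuts => t tE; apply: hspan_scale.
have -> : rgdeg (u, a) + rgdeg (v, b) = wdeg u + wdeg t.1 + (hdeg a + wdeg t.2 + hdeg b).
  by rewrite /rgdeg /= -tE wdeg_cat; abel.
apply: rspan_tpure; first exact: homog_bmul.
by apply: adga_mul (hvalP b); apply: homog_brr.
Qed.

Lemma rspan_Rf ps : rspan (\sum_(p <- ps) rgdeg p) (Rf f ps).
Proof.
elim: ps => [|p ps IH].
  rewrite big_nil -[0]/(0 + 0 : int) -{1}(@wdeg_nil k A).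
  exact: rspan_tpure (homog_bw _) (adga_one _).
by rewrite big_cons; apply: rspan_rmul => //; apply: hspan_gen; exists p.
Qed.

Lemma homog_EE p q (u v : bar A') : homog (@bar_pr k A') p u -> homog (@bar_pr k A') q v ->
  homog apr (p + q + 1) (EE u v).
Proof. by move=> hu hv; apply: homog_bar_t; apply: homog_bmul_gen. Qed.

Lemma allsplits_hspan (xs : seq gen) (F : seq split -> V) (S : V -> Prop) :
  (forall c, size c = size xs ->
     \sum_(p <- c) (lgdeg (left' p) + rgdeg p.2) = \sum_(x <- xs) gdeg x -> hspan S (F c)) ->
  hspan S (\sum_(c <- allsplits xs) F c).
Proof.
elim: xs F => [|[[a w] b] xs IH] F FS; first by rewrite allsplits_nil; apply: FS; rewrite ?big_nil.
rewrite sum_allsplits; apply: hspan_cuts => p pE; apply: IH => c sc cE; apply: FS; first by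
  rewrite /= sc.
rewrite !big_cons cE lgdeg_left /gdeg /rgdeg /= -pE wdeg_cat; abel.
Qed.

Lemma gspan_btl x (xs : seq gen) :
  gspan (\sum_(y <- x :: xs) gdeg y + 1 - (size xs)%:Z) (btl (map (@g2 k A A' A'') (x :: xs))).
Proof.
case: x => [[a w] b]; rewrite btl_gens; apply: allsplits_hspan => -[|p c] //= [sc] cE.
apply: hspan_scale; have -> : \sum_(y <- (a, w, b) :: xs) gdeg y + 1 - (size xs)%:Z =
  hdeg p.1.1 + (wdeg (wmap f' p.1.2) + Fw_deg (map left' c) + 1) +
    (rgdeg p.2 + \sum_(q <- map snd c) rgdeg q).
  rewrite -cE big_cons lgdeg_left wdeg_wmap Fw_degE size_map sc !big_map big_split /=.
  by abel.
apply: gspan_tpure; last by apply: rspan_rmul (rspan_Rf _); apply: hspan_gen; exists p.2.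
apply: adga_mul; first exact: hvalP.
exact: homog_EE (homog_bw _) (homog_Fw _).
Qed.

Lemma gspan_xi (x y : gen) : gspan (gdeg x + gdeg y) (xi f (g2 x) (g2 y)).
Proof.
rewrite /xi pV_g2 (linZ (rmulX_linl f _)); apply: hspan_scale.
case: x y => [[a w] b] [[a2 w2] b2].
rewrite -[g2 (a2, w2, b2)]/(tpure (hval a2) (rg (w2, b2))) augVE (linZ (rmulX_linr f _)).
have [a20|a20] := eqVneq (hdeg a2) 0; last first.
  by rewrite (adga_aug_deg (hvalP a2) a20) scale0r; apply: hspan0.
apply: hspan_scale; rewrite -[g2 (a, w, b)]/(tpure (hval a) (rg (w, b))) rmulXE.
have -> : gdeg (a, w, b) + gdeg (a2, w2, b2) = hdeg a + (rgdeg (w, b) + rgdeg (w2, b2)).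
  by rewrite /gdeg /rgdeg /= a20; abel.
apply: gspan_tpure; first exact: hvalP.
by apply: rspan_rmul; apply: hspan_gen; eexists.
Qed.

Lemma gspan_d0 (x : gen) : gspan (gdeg x + 1) (@d0 k A A' A'' f (g2 x)).
Proof.
case: x => [[a w] b]; rewrite d0_g2.
have T p q r (a1 : A') (u : bar A) (b1 : A'') : homog apr p a1 -> homog (@bar_pr k A) q u -> homog
  apr r b1 ->
    p + q + r = gdeg (a, w, b) + 1 -> gspan (gdeg (a, w, b) + 1) (el3 a1 u b1).
  by move=> h1 h2 h3 <-; rewrite -addrA; apply: gspan_tpure => //; apply: rspan_tpure.
have dg (B : adga k) (x : hel B) : homog apr (hdeg x + 1) (adiff (hval x)).
  exact: (cx_degree (adga_complex B) (hvalP x)).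
apply: hspan_add; first apply: hspan_add; first apply: hspan_add.
- by apply: T (dg _ a) (homog_bw w) (hvalP b) _; rewrite /gdeg /=; abel.
- by apply/hspan_scale/(T _ _ _ _ _ _ (hvalP a) (homog_bar_diff w) (hvalP b)); rewrite /gdeg /=;
  abel.
- by apply/hspan_scale/(T _ _ _ _ _ _ (hvalP a) (homog_bw w) (dg _ b)); rewrite /gdeg /=; abel.
apply: hspan_opp; case: w T => [|l w] T; first exact: hspan0.
apply/hspan_scale/(T _ _ _ _ _ _ (hvalP a) (homog_bw _)).
  by apply: adga_mul (hvalP b); rewrite /homog -amor_pr; congr (f _); apply: hvalP.
rewrite /gdeg /= lastI -cats1 wdeg_cat wdeg_cons wdeg_nil -/(ldeg _); abel.
Qed.

Lemma gspan_gam x (xs : seq gen) :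
  gspan (\sum_(y <- x :: xs) gdeg y + 1 - (size xs)%:Z) (gam (map (@g2 k A A' A'') (x :: xs))).
Proof.
case: xs => [|y [|z xs]]; last exact: hspan0.
  by rewrite big_seq1 subr0; apply: gspan_d0.
rewrite big_cons big_seq1 addrK; exact: gspan_xi.
Qed.

Notation helt := (helt pr).

Lemma beta_gdeg (x : gen) xs :
  homog pr (\sum_(y <- x :: xs) gdeg y + 1 - (size xs)%:Z) (beta (map (@g2 k A A' A'') (x :: xs))).
Proof. by apply: gspan_homog; apply: hspan_add; [exact: gspan_btl|exact: gspan_gam]. Qed.

Lemma beta_degree (xs : seq helt) : (0 < size xs)%N ->
  homog pr (tdeg xs + 2 - (size xs)%:Z) (beta (hvals xs)).
Proof.
(* Homogeneous arguments are replaced by generators of the same degree one at a time; s holds those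
   already replaced. *)
suff H (s : seq gen) (ys : seq helt) : (0 < size s + size ys)%N ->
    homog pr (\sum_(y <- s) gdeg y + tdeg ys + 2 - (size s + size ys)%:Z)
      (beta (map (@g2 k A A' A'') s ++ hvals ys)).
  by move=> xs0; have := H [::] xs xs0; rewrite big_nil add0r.
elim: ys s => [|y ys IH] s.
  case: s => [|x s] // _; rewrite /= cats0; have := beta_gdeg x s.
  by congr homog; rewrite /tdeg big_nil addr0 addn0 /=; move: (\sum_(_ <- _) _) => u; lia.
move=> _; have := homog_gspan (hvalP y).
rewrite /tdeg big_cons -/(tdeg ys) /=.
set D := _ - _ => hy; apply: (hspan_homog (S := homog pr D)) => //; first exact: bar2_pr_lin.
apply: (hspan_map (beta_slot f' f _ _) _ hy) => _ [g gy ->].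
apply: hspan_gen; rewrite -cat_rcons -map_rcons.
have -> : D = \sum_(z <- rcons s g) gdeg z + tdeg ys + 2 - (size (rcons s g) + size ys)%:Z.
  by rewrite /D -cats1 big_cat big_seq1 /= gy size_cat /= addn1 addSnnS !addrA.
by apply: IH; rewrite size_rcons.
Qed.

End Degree.

(** * Strict unit and augmentation *)

Section UnitAug.
Variables (k : comNzRingType) (A A' A'' : hga k).
Variables (f' : hga_mor A A') (f : hga_mor A A'').
Notation R := (rbarc A A'').
Notation Q := (tens (bar A') R).
Notation V := (bar2 A A' A'').
Notation pr := (@bar2_pr k A A' A'').
Notation L := (Lact f' (rmul f)).
Notation Fch := (Fch f' f).
Notation beta := (beta f' f).
Notation Theta := (Theta f' f).
Notation Phi := (Phi f' f).
Notation pV := (@pV k A A' A'').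
Notation xi := (@xi k A A' A'' f).
Notation augV := (@augV k A A' A'').
Notation tau := (@tau k A A' A'').
Notation epsQ := (@epsQ k A A' A'').
Notation oneR := (@oneR k A A'').
Notation oneQ := (@oneQ k A A' A'').
Notation e := (@bar2_unit k A A' A'').
Implicit Types (x y v : V) (q : Q).

Let ltau : linear tau := @tau_lin k A A' A''.

Lemma oneR_homog : rspan 0 oneR.
Proof.
rewrite -[0]/(0 + 0 : int) -{1}(@wdeg_nil k A).
exact: rspan_tpure (homog_bw _) (adga_one _).
Qed.

Lemma unit_homog : homog pr 0 e.
Proof. by apply: gspan_homog; rewrite -[0]/(0 + 0 : int); apply: gspan_tpure (adga_one _)
  oneR_homog. Qed.

Lemma pV_unit : pV e = e.
Proof. by rewrite (pV_homog unit_homog) sg0 scale1r. Qed.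

Lemma iter_pV_unit n : iter n pV e = e.
Proof. by elim: n => //= n ->; apply: pV_unit. Qed.

(** The bar of 1 is 0, so a bracket with first letter 1 vanishes. *)
Lemma Phi_unit q : Phi e q = 0.
Proof.
rewrite PhiE; move: (L _ q); apply: tens_ext => [||c s]; [exact: TQ_linr|exact: lin_zero|].
by rewrite TQE brk1 (lin0 (tpure_linl _)).
Qed.

Lemma Theta_unit q : Theta e q = tau q.
Proof. by rewrite ThetaE pA1 lact1 L_oneR. Qed.

Lemma tau_TQ (a : A') q : tau (TQ a q) = tpure (abar a) (epsQ q).
Proof.
move: q; apply: tens_ext => [||c s].
- exact: (lin_comp ltau (TQ_linr _)).
- exact: (lin_comp (tpure_linr _) (@epsQ_lin k A A' A'')).
by rewrite TQE tauE epsQE bar_t_brk (linZ (tpure_linl _)) (linZ (tpure_linr _)).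
Qed.

Lemma epsQ_oneQ : epsQ oneQ = oneR.
Proof. by rewrite epsQE bar_eps1 scale1r. Qed.

Lemma rmulX_oneR v : rmulX f v oneR = v.
Proof.
move: v; apply: tens_ext => [||a r]; [exact: rmulX_linl|exact: lin_id|].
by rewrite rmulXE rmul_unitr.
Qed.

Lemma rmulX_unit r : rmulX f e r = tpure 1 r.
Proof. by rewrite rmulXE rmul_unitl. Qed.

Lemma augV_unit : augV e = oneR.
Proof. by rewrite augVE rmorph1 scale1r. Qed.

Lemma beta_unit : beta [:: e] = 0.
Proof.
rewrite /beta /= Theta_unit tauE bar_t1 (lin0 (tpure_linl _)) add0r d0E adiff1.
by rewrite (lin0 (tpure_linl _)) diffR1 (lin0 (tpure_linr _)) addr0.
Qed.

Lemma beta_unitr x : beta [:: pV x; e] = x.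
Proof.
rewrite /beta /= Phi_unit (lin0 (Theta_linr _ _ _)) add0r /xi pV_K augV_unit.
exact: rmulX_oneR.
Qed.

(** For x = a (x) r, the part with t gives abar (x) r and the extra summand gives eps(a) 1 (x) r;
    together they are x. *)
Lemma beta_unitl x : beta [:: e; x] = x.
Proof.
rewrite /beta /= Theta_unit /xi pV_unit rmulX_unit.
move: x; apply: tens_ext => [||a r].
- apply: lin_add; first exact: (lin_comp ltau (Phi_linl _ _ _)).
  exact: (lin_comp (tpure_linr _) (@augV_lin k A A' A'')).
- exact: lin_id.
rewrite PhiE tau_TQ epsQ_L epsQ_oneQ rmul_unitr augVE (linZ (tpure_linr _)) -(linZ (tpure_linl _)).
by rewrite -(linD (tpure_linl r)) subrK.
Qed.

Lemma Fch_unit xs : e \in xs -> Fch xs = 0.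
Proof.
elim: xs => // x xs IH; rewrite inE /= => /predU1P [<-|/IH ->]; first exact: Phi_unit.
exact: (lin0 (Phi_linr _ _ _)).
Qed.

(** A unit behind the first place makes the chain vanish. In the first place, t is applied to a
    bracket that contains a further nonempty chain, and the counit of that chain is 0. *)
Lemma beta_unit_vanish xs : (2 < size xs)%N -> e \in xs -> beta xs = 0.
Proof.
case: xs => [|x [|y [|z xs]]] // _; rewrite inE.
have -> : beta [:: x, y, z & xs] = Theta x (Fch [:: y, z & xs]) by apply: addr0.
move=> /predU1P [<-|/Fch_unit ->]; last exact: (lin0 (Theta_linr _ _ _)).
rewrite Theta_unit -[Fch (y :: _)]/(Phi y (Fch (z :: xs))); move: y; apply: tens_ext => [||a r].
- exact: (lin_comp ltau (Phi_linl _ _ _)).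
- exact: lin_zero.
by rewrite PhiE tau_TQ epsQ_L epsQ_Fch (lin0 (rmul_linr f _)) (lin0 (tpure_linr _)).
Qed.

Lemma twist_unit m xs : e \in xs -> e \in twist m xs.
Proof.
elim: xs => // x xs IH; rewrite !inE /= => /predU1P [<-|/IH ->]; last exact: orbT.
by rewrite iter_pV_unit eqxx.
Qed.

Lemma bar2_strict_unit : is_strict_unit pr (bar2_diff f' f) (bar2_m f' f) e.
Proof.
split.
- exact: unit_homog.
- by rewrite bar2_diff_beta beta_unit.
- by move=> x; rewrite bar2_m_twist //= beta_unitr.
- by move=> x; rewrite bar2_m_twist //= pV_unit beta_unitl.
- move=> xs xs2 xse; rewrite bar2_m_twist ?(ltnW xs2) // beta_unit_vanish ?size_twist //.
  exact: twist_unit.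
Qed.

Definition augR : R -> k^o :=
  tlift (M := k^o) (fun (u : bar A) (b : A'') => (bar_eps u * aug b : k^o)).

Let augR_linl (b : A'') : linear (fun u : bar A => (bar_eps u * aug b : k^o)).
Proof.
move=> c u v; have -> : bar_eps (c *: u + v) = c * bar_eps u + bar_eps v := @bar_eps_lin k A c u v.
by rewrite mulrDl -mulrA.
Qed.
Let augR_linr (u : bar A) : linear (fun b : A'' => (bar_eps u * aug b : k^o)).
Proof.
move=> c a b; have -> : aug (c *: a + b) = c * aug a + aug b := @aug_lin k A'' c a b.
by rewrite mulrDr mulrCA.
Qed.

Lemma augR_lin : linear augR. Proof. exact: tlift_lin augR_linl augR_linr. Qed.
Lemma augRE (u : bar A) (b : A'') : augR (tpure u b) = bar_eps u * aug b.
Proof. exact: tliftE augR_linl augR_linr u b. Qed.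

Lemma augR_mul r s : augR (rmul f r s) = augR r * augR s.
Proof.
have lm c : linear (fun x : k^o => (c * x : k^o)) by move=> d x y; rewrite mulrDr [c * _]mulrCA.
have lmr c : linear (fun x : k^o => (x * c : k^o)) by move=> d x y; rewrite mulrDl -mulrA.
move: r; apply: rbar_ext => [||[u a]].
- exact: (lin_comp augR_lin (rmul_linl f s)).
- exact: (lin_comp (lmr _) augR_lin).
move: s; apply: rbar_ext => [||[v b]].
- exact: (lin_comp augR_lin (rmul_linr f _)).
- exact: (lin_comp (lm _) augR_lin).
rewrite rmul_gen (lin_sumE augR_lin).
pose F (p q : word A) : k^o := sg (hdeg a * wdeg p) *:
  (bar_eps (bw u) * bar_eps (bw p) * (aug (hval a) * bar_eps (bw q) * aug (hval b)) : k^o).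
transitivity (\sum_(p <- cuts v) F p.1 p.2).
  by apply: eq_bigr => p _; rewrite (linZ augR_lin) augRE bar_eps_mul rmorphM /= aug_brr.
have F0 l p (q' : word A) : F (l :: p) q' = 0 by rewrite /F [bar_eps (bw (_ :: _))]bar_eps_bw
  mulr0 mul0r scaler0.
rewrite (sum_cuts_nil _ F0).
rewrite /F wdeg_nil mulr0 sg0 scale1r bar_eps1 mulr1 !augRE.
by rewrite -!mulrA; congr (_ * _); rewrite !mulrA.
Qed.

Lemma augR_diff r : augR (diffR f r) = 0.
Proof.
have lk := kap_lin f; move: r; apply: rbar_ext => [||[w b]].
- exact: (lin_comp augR_lin (diffR_lin f)).
- exact: lin_zero.
rewrite diffRE (linB augR_lin) (linD augR_lin) !augRE bar_eps_diff mul0r add0r adga_aug_diff mulr0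
  sub0r.
rewrite kap_word (lin_sumE augR_lin) big1 ?oppr0 // => p _.
by rewrite (linZ augR_lin) augRE rmorphM /= amor_aug aug_bar_t mul0r mulr0 scaler0.
Qed.

Lemma augR_oneR : augR oneR = 1.
Proof. by rewrite augRE bar_eps1 rmorph1 mulr1. Qed.

Lemma bar2_augE v : @bar2_aug k A A' A'' v = augR (augV v).
Proof.
apply: (lift2_ext (G := fun v => augR (augV v))) => [|[[a w] b]].
  exact: (lin_comp augR_lin (@augV_lin k A A' A'')).
by rewrite augVE (linZ augR_lin) augRE /= -mulrA.
Qed.

Lemma bar2_aug_lin : linear (@bar2_aug k A A' A'' : V -> k^o).
Proof.
move=> c x y; rewrite !bar2_augE.
exact: (lin_comp augR_lin (@augV_lin k A A' A'')).
Qed.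

Lemma bar2_ainfty_aug : is_ainfty_aug pr (bar2_diff f' f) (bar2_m f' f) e (@bar2_aug k A A' A'').
Proof.
split.
- exact: bar2_aug_lin.
- move=> p v /homog_gspan hv p0; elim: hv => [|c _ y [[[a w] b] gp ->] _ IH].
    exact: (lin0 bar2_aug_lin).
  rewrite bar2_aug_lin IH addr0 bar2_augE augVE (linZ augR_lin) augRE bar_eps_bw.
  case: w gp => [|l w] gp; last by rewrite mul0r !scaler0.
  have [a0|a0] := eqVneq (hdeg a) 0; last by rewrite (adga_aug_deg (hvalP a) a0) scale0r scaler0.
  rewrite (adga_aug_deg (hvalP b)) ?mulr0 ?scaler0 //.
  by move: p0; rewrite -gp /gdeg /= a0 wdeg_nil !add0r.
- move=> v; rewrite bar2_diff_beta bar2_augE /beta (linD (@augV_lin k A A' A'')) augV_btl add0r.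
  by rewrite /= augV_d0 augR_diff.
- by rewrite bar2_augE augV_unit augR_oneR.
- move=> x y; rewrite bar2_m_twist // !bar2_augE /beta (linD (@augV_lin k A A' A'')) augV_btl add0r.
  by rewrite /= /xi augV_rmulX pV_K augR_mul.
- move=> xs xs2; rewrite bar2_m_twist ?(ltnW xs2) // bar2_augE /beta (linD (@augV_lin k A A' A'')).
  rewrite augV_btl add0r; move: xs2; rewrite -(size_twist 0 xs).
  by case: (twist 0 xs) => [|x [|y [|z s]]] // _; rewrite (lin0 (@augV_lin k A A' A''))
    (lin0 augR_lin).
Qed.

End UnitAug.

Ltac sgn_odd :=
  sgn; rewrite ?(oddD, oddM);
  repeat match goal with |- context [odd ?n] => case: (odd n) end;
  rewrite /= ?(expr0, expr1, mulN1r, mulrN1, mulr1, mul1r, opprK, mulrNN) //.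

(** * Signs in the Stasheff identities *)

Section Stasheff.
Variables (k : comNzRingType) (A A' A'' : hga k).
Variables (f' : hga_mor A A') (f : hga_mor A A'').
Notation V := (bar2 A A' A'').
Notation pr := (@bar2_pr k A A' A'').
Notation beta := (beta f' f).
Notation nu := (@nu k A A' A'').
Notation helt := (helt pr).
Notation d := (bar2_diff f' f).
Notation m := (bar2_m f' f).
Implicit Types (xs s t u : seq helt).

Lemma m_slot s t : (0 < size s + size t)%N -> linear (fun x => m (hvals s ++ x :: hvals t)).
Proof.
move=> st c x y; rewrite !bar2_m_twist ?size_cat /= ?size_hvals ?addnS ?ltnS //.
exact: twist_slot.
Qed.

Lemma tdeg_cons x s : tdeg (x :: s) = hdeg x + tdeg s.
Proof. exact: big_cons. Qed.

Lemma hweight_cat s t : hweight (s ++ t) = hweight s + (size t)%:Z * tdeg s + hweight t.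
Proof.
elim: s => [|x s IH] /=; first by rewrite /tdeg big_nil mulr0 !add0r.
rewrite IH tdeg_cons size_cat PoszD mulrDl mulrDr; abel.
Qed.

Lemma beta_nu s (vs : seq V) : beta (map nu (hvals s) ++ vs) =
  sg ((size s)%:Z + tdeg s) *: beta (hvals s ++ vs).
Proof.
suff H us : beta (us ++ map nu (hvals s) ++ vs) = sg ((size s)%:Z + tdeg s) *: beta
  (us ++ hvals s ++ vs).
  exact: (H [::]).
elim: s us => [|x s IH] us; first by rewrite /tdeg big_nil scale1r.
rewrite /= (linN (beta_slot f' f _ _)) (pV_homog (hvalP x)) (linZ (beta_slot f' f _ _)).
rewrite -cat_rcons IH cat_rcons scalerA -scaleNr tdeg_cons; congr (_ *: _).
by rewrite -addn1 PoszD; sgn_odd.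
Qed.

(** Carries the degree of beta(s), which enters [hweight] when the value becomes an argument of the
    outer operation. *)
Definition inner s (s0 : (0 < size s)%N) : helt := Helt (beta_degree f' f s0).

Lemma beta_inner s u t (u0 : (0 < size u)%N) : (0 < size s + size t)%N ->
  beta (map nu (hvals s) ++ beta (hvals u) :: hvals t) =
  sg ((size s)%:Z + tdeg s + hweight (s ++ inner u0 :: t)) *:
    m (hvals s ++ beta (hvals u) :: hvals t).
Proof.
move=> st; have E : hvals s ++ beta (hvals u) :: hvals t = hvals (s ++ inner u0 :: t).
  by rewrite /hvals map_cat.
rewrite beta_nu E bar2_m_hvals ?size_cat /= ?addnS ?ltnS // scalerA; congr (_ *: _).
by rewrite [in RHS]sgD -mulrA sgsq mulr1.
Qed.

Let T s u t := beta (map nu (hvals s) ++ beta (hvals u) :: hvals t).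

Lemma beta_diff s x t : (0 < size s + size t)%N -> T s [:: x] t =
  - (sg (hweight (s ++ x :: t)) * sg (2 - (size (s ++ x :: t))%:Z) * sg (tdeg s)) *:
    m (hvals s ++ d (hval x) :: hvals t).
Proof.
move=> st; rewrite /T (@beta_inner s [:: x] t isT st) bar2_diff_beta /=.
congr (_ *: _); rewrite !hweight_cat /= tdeg_cons /tdeg big_nil -/(tdeg s) -/(tdeg t).
rewrite size_cat /= !PoszD -addn1 PoszD; sgn_odd.
Qed.

(** Once the sign [hweight (s ++ u ++ t)], common to all terms, is split off, the remaining one is
    (-1)^(i + l(n-i-l)) times the Koszul sign of moving m_l past s. *)
Lemma beta_mm s u t : (1 < size u)%N -> (0 < size s + size t)%N -> T s u t =
  (sg (hweight (s ++ u ++ t)) * (-1) ^+ (size s + size u * size t) *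
     sg ((2 - (size u)%:Z) * tdeg s)) *:
    m (hvals s ++ m (hvals u) :: hvals t).
Proof.
move=> u1 st; rewrite /T (@beta_inner s u t (ltnW u1) st) bar2_m_hvals // (linZ (m_slot st))
  scalerA.
congr (_ *: _); rewrite !hweight_cat /= size_cat.
rewrite -[(-1) ^+ _]signr_odd !sgE -!signr_addb; congr (_ ^+ _); congr nat_of_bool.
rewrite -addn1 !PoszD !parE oddD oddM [odd 1]/=.
move: (par _) (par _) (par _) (par _) (par _) (odd _) (odd _) (odd _).
by do 8 case.
Qed.

Lemma beta_top xs : (1 < size xs)%N -> T [::] xs [::] = sg (hweight xs) *: d (m (hvals xs)).
Proof.
move=> xs1; rewrite bar2_diff_beta bar2_m_hvals // (linZ (beta_slot f' f [::] [::])).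
by rewrite scalerA sgsq scale1r.
Qed.

Lemma beta_empty s t : T s [::] t = 0.
Proof. by rewrite /T beta_nil (lin0 (beta_slot f' f _ _)). Qed.

Lemma hvals_take n xs : take n (hvals xs) = hvals (take n xs).
Proof. by rewrite /hvals map_take. Qed.

Lemma hvals_drop n xs : drop n (hvals xs) = hvals (drop n xs).
Proof. by rewrite /hvals map_drop. Qed.

Let X xs i l := T (take i xs) (take l (drop i xs)) (drop (i + l) xs).

(** [stasheff_beta] sums over the start of the inner operation first; here its length l comes first,
    as in the definition of an A-infinity structure. *)
Lemma stasheff_double xs : (0 < size xs)%N ->
  \sum_(0 <= l < (size xs).+1) \sum_(0 <= i < (size xs - l).+1) X xs i l = 0.
Proof.
case: xs => // x xs _; set n := size (x :: xs).
have E : \sum_(0 <= i < n.+1) \sum_(0 <= l < (n - i).+1) X (x :: xs) i l = 0.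
  rewrite -[RHS](stasheff_beta f' f (hval x) (hvals xs)) -[hval x :: _]/(hvals (x :: xs)).
  pose F (s t : seq V) := \sum_(q <- cuts t) beta (map nu s ++ beta q.1 :: q.2).
  rewrite -(sum_cuts _ F) size_hvals -(big_mkord xpredT (fun i => F (take i _) (drop i _))).
  apply: eq_big_nat => i _; rewrite /F -(sum_cuts _ (fun q r => beta (_ ++ beta q :: r))).
  rewrite size_drop size_hvals -(big_mkord xpredT
    (fun l => beta (_ ++ beta (take l _) :: drop l _))).
  apply: eq_big_nat => l _; rewrite /X /T drop_drop addnC.
  by rewrite !hvals_drop !hvals_take.
rewrite -[RHS]E.
(* The triangular range is written as a condition on a square, where the sums can be exchanged. *)
have W (G : nat -> V) i : (i < n.+1)%N -> \sum_(0 <= l < (n - i).+1) G l =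
  \sum_(0 <= l < n.+1 | (l + i <= n)%N) G l.
  move=> i_n; rewrite (big_nat_widen 0 (n - i).+1 n.+1) ?ltnS ?leq_subr //.
  by apply: eq_bigl => l /=; rewrite ltnS leq_subRL // addnC.
rewrite (eq_big_nat _ _ (F2 := fun l => \sum_(0 <= i < n.+1 | (i + l <= n)%N) X (x :: xs) i l));
  last first.
  by move=> l /andP [_ ln]; apply: W.
rewrite [RHS](eq_big_nat _ _ (F2 := fun i => \sum_(0 <= l < n.+1 | (l + i <= n)%N) X (x :: xs) i l)); last first.
  by move=> i /andP [_ i_n]; apply: W.
rewrite (exchange_big_dep_nat xpredT) //=; apply: eq_big_nat => i _.
by apply: eq_bigl => l; rewrite addnC.
Qed.

Lemma sum_diff xs : (1 < size xs)%N ->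
  \sum_(0 <= i < (size xs - 1).+1) X xs i 1 = - (sg (hweight xs) * sg (2 - (size xs)%:Z)) *:
    \sum_(i < size xs) sg (tdeg (take i xs)) *:
      m (take i (hvals xs) ++ d (hvals xs)`_i :: drop i.+1 (hvals xs)).
Proof.
move=> xs1; rewrite -(big_mkord xpredT (fun i => sg (tdeg (take i xs)) *: m (take i _ ++ d (_ `_ i) :: drop i.+1 _))).
rewrite subn1 prednK ?(ltnW xs1) // scaler_sumr; apply: eq_big_nat => i /andP [_ ixs].
have x0 : helt by case: (xs) ixs => [|y s].
have dE : drop i xs = nth x0 xs i :: drop i.+1 xs by exact: drop_nth.
rewrite scalerA /X addn1; have -> : take 1 (drop i xs) = [:: nth x0 xs i] by rewrite dE /= take0.
rewrite beta_diff; last by rewrite size_takel ?(ltnW ixs) // size_drop; lia.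
rewrite -dE cat_take_drop hvals_take hvals_drop.
have -> : (hvals xs)`_i = hval (nth x0 xs i) by rewrite (nth_map x0).
by rewrite mulNr.
Qed.

(** In the double sum the terms of length 0 vanish, those of length 1 and of full length form
    d(m_n), and the others give the right side; the common sign is cancelled at the end. *)
Lemma bar2_stasheff xs : (1 < size xs)%N -> dm d m xs =
  - \sum_(2 <= l < size xs) \sum_(0 <= i < (size xs - l).+1)
      (-1) ^+ (i + l * (size xs - i - l)) *: mm m l i xs.
Proof.
move=> xs1; have := stasheff_double (ltnW xs1).
rewrite big_ltn // big1 ?add0r; last by move=> i _; rewrite /X take0 beta_empty.
rewrite big_ltn ?ltnS ?(ltnW xs1) // (sum_diff xs1) big_nat_recr //= subnn big_nat1.
rewrite /X take0 drop0 take_size add0n drop_size beta_top //.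
rewrite (eq_big_nat _ _ (F2 := fun l => sg (hweight xs) *: \sum_(0 <= i < (size xs - l).+1)
      (-1) ^+ (i + l * (size xs - i - l)) *: mm m l i xs)); last first.
  move=> l /andP [l2 ln]; rewrite scaler_sumr; apply: eq_big_nat => i /andP [_ il].
  have sE : size (take i xs) = i by rewrite size_take; case: ltnP => //; lia.
  have uE : size (take l (drop i xs)) = l by rewrite size_take size_drop; case: ltnP => //; lia.
  have tE : size (drop (i + l) xs) = (size xs - i - l)%N by rewrite size_drop subnDA.
  rewrite beta_mm ?sE ?uE ?tE //; last by lia.
  rewrite -[in drop (i + l) xs]addnC -drop_drop !cat_take_drop drop_drop [(l + i)%N]addnC.
  by rewrite /mm !scalerA hvals_drop !hvals_take hvals_drop.
rewrite -scaler_sumr -mulrN -scalerA -!scalerDr => E.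
have {}E := congr1 (fun v => sg (hweight xs) *: v) E.
rewrite /= scalerA sgsq scale1r scaler0 scaleNr in E.
apply/eqP; rewrite -addr_eq0 -[X in _ == X]E; apply/eqP.
by rewrite addrC [RHS]addrC -[RHS]addrA.
Qed.

Lemma bar2_complex : is_complex pr d.
Proof.
split; first exact: bar2_grading.
- by move=> c x y; rewrite !bar2_diff_beta (beta_slot f' f [::] [::]).
- move=> p v hv; rewrite bar2_diff_beta.
  by have := @beta_degree _ _ _ _ f' f [:: Helt hv] isT; rewrite /tdeg big_seq1 /= -addrA.
(* For a single element the identity is d^2 = 0, the terms with an empty inner operation being 0. *)
- move=> v; rewrite !bar2_diff_beta; have := stasheff_beta f' f v [::].
  rewrite !cuts_cons cuts_nil !big_cons !big_nil /= !cuts_cons cuts_nil !big_cons !big_nil /=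
    beta_nil.
  by rewrite (lin0 (beta_slot f' f [::] [:: v])) (lin0 (beta_slot f' f [:: nu v] [::])) !add0r
    !addr0.
Qed.

Lemma bar2_ainfty : is_ainfty pr d m.
Proof.
split.
- exact: bar2_complex.
- move=> s x y c t st; rewrite !bar2_m_twist ?size_cat /= ?addnS ?ltnS //.
  exact: twist_slot.
- move=> xs xs1; rewrite bar2_m_hvals //; apply: homogZ; first exact: bar2_pr_lin.
  exact: beta_degree (ltnW xs1).
- exact: bar2_stasheff.
Qed.

End Stasheff.

Theorem theorem3p8 (k : comNzRingType) (A A' A'' : hga k)
    (f' : hga_mor A A') (f'' : hga_mor A A'') :
  is_augmented_ainfty (@bar2_pr k A A' A'') (bar2_diff f' f'') (bar2_m f' f'')
    (@bar2_unit k A A' A'') (@bar2_aug k A A' A'').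
Proof.
by split; [exact: bar2_ainfty|exact: bar2_strict_unit|exact: bar2_ainfty_aug].
Qed.
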